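(* Let $\Gamma$ be a group and let $F$ be a $\Gamma$-field, i.e. a field equipped with a group homomorphism from $\Gamma$ to its group of field automorphisms. Let $\phi: St(F)\to E(F)$ be the canonical surjection, and let $\Gamma(\phi):\Gamma St(F)\to \Gamma E(F)$ be the homomorphism it induces by restriction. Then there is an exact sequence $$0\to \operatorname{Ker}\Gamma(\phi)/\Gamma\operatorname{Ker}(\phi)\to Sym^{\Gamma}(F)\to K^{\Gamma}_{2}(F)\to 0 .$$
   Context: A $\Gamma$-group is a group on which $\Gamma$ acts by group automorphisms, written ${}^{\gamma}g$. For a $\Gamma$-group $G$, $\Gamma G$ denotes the normal subgroup of $G$ generated by all elements ${}^{\gamma}g\,g^{-1}$ ($g\in G,\gamma\in\Gamma$), and $G_\Gamma=G/\Gamma G$. A homomorphism of $\Gamma$-groups (compatible with the actions) induces homomorphisms on $\Gamma(-)$ (by restriction) and on $(-)_\Gamma$. For a ring $A$ with unit, $E(A)$ is the stable elementary group, generated by the elementary matrices $e_{ij}(a)$, and $St(A)$ is the stable Steinberg group, generated by $x_{ij}(a)$ ($i\ne j$, $a\in A$) subject to $x_{ij}(a)x_{ij}(b)=x_{ij}(a+b)$; $[x_{ij}(a),x_{kl}(b)]=1$ for $i\neq l$, $k\neq j$; $[x_{ij}(a),x_{jk}(b)]=x_{ik}(ab)$ for $i\ne k$. The canonical surjection $\phi:St(A)\to E(A)$ sends $x_{ij}(a)$ to $e_{ij}(a)$, and $K_2(A)=\operatorname{Ker}\phi$. If $\Gamma$ acts on $A$ by ring automorphisms, it acts on $E(A)$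 entrywise and on $St(A)$ by ${}^{\gamma}x_{ij}(a)=x_{ij}({}^{\gamma}a)$; $\phi$ is then a $\Gamma$-homomorphism and $K_2(A)$ is a $\Gamma$-subgroup of $St(A)$. One defines $K_2^{\Gamma}(A)=\operatorname{Ker}(\phi_\Gamma: St(A)_\Gamma\to E(A)_\Gamma)$. The symbol group $Sym(A)$ is the group generated by elements $\langle u,v\rangle$, $u,v\in A^{*}$ (the group of units of $A$), with relations: $\langle u,1-u\rangle=1$ for $u\neq1$, $1-u\in A^{*}$; $\langle uu',v\rangle=\langle u,v\rangle\langle u',v\rangle$; $\langle u,vv'\rangle=\langle u,v\rangle\langle u,v'\rangle$. The group $\Gamma$ acts on it by ${}^{\gamma}\langle u,v\rangle=\langle {}^{\gamma}u,{}^{\gamma}v\rangle$, and $Sym^{\Gamma}(A)=(Sym(A))_\Gamma$. *)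

(* Defs.v *)
From HB Require Import structures.
From mathcomp Require Import all_boot all_algebra.
From mathcomp Require Import boolp classical_sets functions cardinality fsbigop.

Set Implicit Arguments.
Unset Strict Implicit.
Unset Printing Implicit Defensive.

Import GRing.Theory.

Local Open Scope classical_set_scope.
Local Open Scope group_scope.
Local Open Scope quotient_scope.

(* Subgroups of a (possibly infinite) [groupType] are the library's
   [groupClosed] predicates; normal subgroups are the following. *)

HB.mixin Record isConjClosed (G : groupType) (S : {pred G}) := {
  gpredJr : forall x y : G, x \in S -> x ^ y \in S
}.

#[short(type="normalClosed")]
HB.structure Definition NormalClosed (G : groupType) :=
  {S of isInvClosed G S & isMul1Closed G S & isMulClosed G S
      & isConjClosed G S}.

Record subgrp (G : groupType) (S : {pred G}) :=
  Subgrp { subgrp_val :> G; subgrp_valP : subgrp_val \in S }.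

HB.instance Definition _ (G : groupType) (S : {pred G}) :=
  [isSub of subgrp S for @subgrp_val G S].
HB.instance Definition _ (G : groupType) (S : {pred G}) :=
  [Choice of subgrp S by <:].

Lemma groupClosed_closed (G : groupType) (S : groupClosed G) : group_closed S.
Proof. by split; [exact: gpred1 | exact: gpredF]. Qed.

HB.instance Definition _ (G : groupType) (S : groupClosed G) :=
  SubChoice_isSubGroup.Build G _ (subgrp S) (groupClosed_closed S).

Lemma subgrp_valV (G : groupType) (S : groupClosed G) (x : subgrp S) :
  val x^-1 = (val x)^-1.
Proof.
have xV : val (x * x^-1) = 1 by rewrite mulgV.
by apply: (mulgI (val x)); rewrite mulgV -[RHS]xV [RHS]valM.
Qed.

Lemma subgrp_valJ (G : groupType) (S : groupClosed G) (x y : subgrp S) :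
  val (x ^ y) = val x ^ val y.
Proof. by rewrite /conjg !valM subgrp_valV. Qed.

Section Generation.
Variables (G : groupType) (A : set G).

Definition generated : {pred G} :=
  [pred x | `[< forall H : groupClosed G, A `<=` [set y | y \in H] -> x \in H >]].

Definition normal_closure : {pred G} :=
  [pred x | `[< forall N : normalClosed G, A `<=` [set y | y \in N] -> x \in N >]].

Lemma generatedP x :
  reflect (forall H : groupClosed G, A `<=` [set y | y \in H] -> x \in H)
          (x \in generated).
Proof. by rewrite inE; apply: asboolP. Qed.

Lemma normal_closureP x :
  reflect (forall N : normalClosed G, A `<=` [set y | y \in N] -> x \in N)
          (x \in normal_closure).
Proof. by rewrite inE; apply: asboolP. Qed.

Lemma sub_generated x : A x -> x \in generated.
Proof. by move=> Ax; apply/generatedP => H; apply. Qed.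

Lemma sub_normal_closure x : A x -> x \in normal_closure.
Proof. by move=> Ax; apply/normal_closureP => H; apply. Qed.

Fact generatedM : mulg_closed generated.
Proof.
move=> x y /generatedP Hx /generatedP Hy; apply/generatedP => H AH.
by rewrite gpredM ?Hx ?Hy.
Qed.
Fact generated1 : 1 \in generated.
Proof. by apply/generatedP => H _; apply: gpred1. Qed.
Fact generatedV : invg_closed generated.
Proof.
move=> x /generatedP Hx; apply/generatedP => H AH.
by apply: gpredVr; apply: Hx.
Qed.
HB.instance Definition _ := isMulClosed.Build G generated generatedM.
HB.instance Definition _ := isMul1Closed.Build G generated generated1.
HB.instance Definition _ := isInvClosed.Build G generated generatedV.

Fact normal_closureM : mulg_closed normal_closure.
Proof.
move=> x y /normal_closureP Hx /normal_closureP Hy.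
by apply/normal_closureP => H AH; rewrite gpredM ?Hx ?Hy.
Qed.
Fact normal_closure1 : 1 \in normal_closure.
Proof. by apply/normal_closureP => H _; apply: gpred1. Qed.
Fact normal_closureV : invg_closed normal_closure.
Proof.
move=> x /normal_closureP Hx; apply/normal_closureP => H AH.
by apply: gpredVr; apply: Hx.
Qed.
Fact normal_closureJ x y : x \in normal_closure -> x ^ y \in normal_closure.
Proof.
move=> /normal_closureP Hx; apply/normal_closureP => H AH.
by apply: gpredJr; apply: Hx.
Qed.
HB.instance Definition _ := isMulClosed.Build G normal_closure normal_closureM.
HB.instance Definition _ := isMul1Closed.Build G normal_closure normal_closure1.
HB.instance Definition _ := isInvClosed.Build G normal_closure normal_closureV.
HB.instance Definition _ := isConjClosed.Build G normal_closure normal_closureJ.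

End Generation.

Section Kernel.
Variables (G H : groupType) (f : {multiplicative G -> H}).

Lemma hom1 : f 1 = 1.
Proof. by apply: (mulgI (f 1)); rewrite -gmulfM !mulg1. Qed.

Lemma homV x : f x^-1 = (f x)^-1.
Proof. by apply: (mulgI (f x)); rewrite -gmulfM !mulgV hom1. Qed.

Definition kernel : {pred G} := [pred x | f x == 1].

Fact kernelM : mulg_closed kernel.
Proof. by move=> x y; rewrite !inE gmulfM => /eqP-> /eqP->; rewrite mulg1. Qed.
Fact kernel1 : 1 \in kernel.
Proof. by rewrite inE hom1. Qed.
Fact kernelV : invg_closed kernel.
Proof. by move=> x; rewrite !inE homV => /eqP->; rewrite invg1. Qed.
Fact kernelJ x y : x \in kernel -> x ^ y \in kernel.
Proof. by rewrite !inE !gmulfM homV => /eqP->; rewrite mul1g mulVg. Qed.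
HB.instance Definition _ := isMulClosed.Build G kernel kernelM.
HB.instance Definition _ := isMul1Closed.Build G kernel kernel1.
HB.instance Definition _ := isInvClosed.Build G kernel kernelV.
HB.instance Definition _ := isConjClosed.Build G kernel kernelJ.

End Kernel.

Section Quotient.
Variables (G : groupType) (N : normalClosed G).

Definition coset_rel : rel G := fun x y => x^-1 * y \in N.

Fact coset_rel_equiv : equiv_class_of coset_rel.
Proof.
rewrite /coset_rel; split=> [x|x y|y x z]; first by rewrite mulVg gpred1.
  by rewrite -gpredV invgM invgK.
by move=> xy yz; have := gpredM _ _ xy yz; rewrite mulgA mulgK.
Qed.
Canonical coset_equiv := EquivRelPack coset_rel_equiv.

Definition quotient := {eq_quot coset_rel}.
HB.instance Definition _ := Choice.on quotient.
HB.instance Definition _ := Quotient.on quotient.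

Definition quot (x : G) : quotient := \pi_quotient x.

Lemma quotK q : quot (repr q) = q.
Proof. exact: reprK. Qed.

Lemma quotP x y : quot x = quot y <-> x^-1 * y \in N.
Proof. by split=> [/eqmodP//|xy]; apply/eqmodP. Qed.

Definition quot_mul (p q : quotient) := quot (repr p * repr q).
Definition quot_inv (p : quotient) := quot (repr p)^-1.

Lemma gpredJE x y : (x ^ y \in N) = (x \in N).
Proof.
apply/idP/idP; last exact: gpredJr.
by move=> /(gpredJr _ y^-1); rewrite -conjgM mulgV conjg1.
Qed.

Lemma gpredC x y : (x * y \in N) = (y * x \in N).
Proof. by rewrite -(gpredJE (x * y) x) /conjg -mulgA mulKg. Qed.

Lemma quot_reprP x : (repr (quot x))^-1 * x \in N.
Proof. exact/quotP/quotK. Qed.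

Lemma quot_mulE x y : quot_mul (quot x) (quot y) = quot (x * y).
Proof.
apply/quotP; rewrite invgM -mulgA gpredC -!mulgA mulgA.
by rewrite gpredM ?quot_reprP // gpredC quot_reprP.
Qed.

Lemma quot_invE x : quot_inv (quot x) = quot x^-1.
Proof.
by apply/quotP; rewrite invgK gpredC -gpredV invgM invgK quot_reprP.
Qed.

Fact quot_mulgA : associative quot_mul.
Proof.
move=> p q r; rewrite -[p]quotK -[q]quotK -[r]quotK.
by rewrite !quot_mulE mulgA.
Qed.
Fact quot_mul1g : left_id (quot 1) quot_mul.
Proof. by move=> p; rewrite -[p]quotK quot_mulE mul1g. Qed.
Fact quot_mulg1 : right_id (quot 1) quot_mul.
Proof. by move=> p; rewrite -[p]quotK quot_mulE mulg1. Qed.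
Fact quot_mulVg : left_inverse (quot 1) quot_inv quot_mul.
Proof. by move=> p; rewrite -[p]quotK quot_invE quot_mulE mulVg. Qed.
Fact quot_mulgV : right_inverse (quot 1) quot_inv quot_mul.
Proof. by move=> p; rewrite -[p]quotK quot_invE quot_mulE mulgV. Qed.
HB.instance Definition _ := isGroup.Build quotient
  quot_mulgA quot_mul1g quot_mulg1 quot_mulVg quot_mulgV.

Fact quotM : {morph quot : x y / x * y}.
Proof. by move=> x y; rewrite [RHS]quot_mulE. Qed.
HB.instance Definition _ := isMultiplicative.Build G quotient quot quotM.

End Quotient.

(* Groups given by generators and relations: [presented R] is the group with
   generators [X] subject to the relations [u = v] for [R u v].  A word lists
   letters [(x, e)], standing for [x] if [e = true] and for [x^-1] otherwise. *)
Section Presentation.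
Variables (X : choiceType).

Definition word := seq (X * bool).

Definition word_inv (w : word) : word := rev [seq (p.1, ~~ p.2) | p <- w].

Variable R : word -> word -> Prop.

Inductive word_cong : word -> word -> Prop :=
| word_cong_rel u v : R u v -> word_cong u v
| word_cong_cancel x e : word_cong [:: (x, e); (x, ~~ e)] [::]
| word_cong_refl u : word_cong u u
| word_cong_sym u v : word_cong u v -> word_cong v u
| word_cong_trans u v w : word_cong u v -> word_cong v w -> word_cong u w
| word_cong_cat u u' v v' :
    word_cong u u' -> word_cong v v' -> word_cong (u ++ v) (u' ++ v').

Definition word_rel : rel word := fun u v => `[< word_cong u v >].

Fact word_rel_equiv : equiv_class_of word_rel.
Proof.
rewrite /word_rel; split=> [u|u v|v u w].
- by apply/asboolP; apply: word_cong_refl.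
- by apply/asboolP/asboolP; apply: word_cong_sym.
- move=> /asboolP uv /asboolP vw; apply/asboolP.
  exact: word_cong_trans uv vw.
Qed.
Canonical word_equiv := EquivRelPack word_rel_equiv.

Definition presented := {eq_quot word_rel}.
HB.instance Definition _ := Choice.on presented.
HB.instance Definition _ := Quotient.on presented.

Definition pres (w : word) : presented := \pi_presented w.

Lemma presK q : pres (repr q) = q.
Proof. exact: reprK. Qed.

Lemma presP u v : pres u = pres v <-> word_cong u v.
Proof.
split=> [/eqmodP/asboolP//|uv].
by apply/eqmodP/asboolP.
Qed.

Definition pres_mul (p q : presented) := pres (repr p ++ repr q).
Definition pres_inv (p : presented) := pres (word_inv (repr p)).

Lemma word_invK : involutive word_inv.
Proof.
move=> w; rewrite /word_inv map_rev revK -map_comp map_id_in // => -[x e] _ /=.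
by rewrite negbK.
Qed.

Lemma word_inv_cat u v : word_inv (u ++ v) = word_inv v ++ word_inv u.
Proof. by rewrite /word_inv map_cat rev_cat. Qed.

Lemma word_mulgV w : word_cong (w ++ word_inv w) [::].
Proof.
elim/last_ind: w => [|w [x e] IHw]; first exact: word_cong_refl.
rewrite -cats1 word_inv_cat -catA [X in _ ++ X]catA.
apply: word_cong_trans IHw; apply: word_cong_cat (word_cong_refl _) _.
rewrite -[X in word_cong _ X]cat0s.
exact: word_cong_cat (word_cong_cancel x e) (word_cong_refl _).
Qed.

Lemma word_mulVg w : word_cong (word_inv w ++ w) [::].
Proof. by rewrite -[X in _ ++ X]word_invK; apply: word_mulgV. Qed.

Lemma word_cong_inv u v : word_cong u v -> word_cong (word_inv u) (word_inv v).
Proof.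
move=> uv; rewrite -[word_inv u]cats0.
apply: word_cong_trans (word_cong_cat (word_cong_refl _)
  (word_cong_sym (word_mulgV v))) _.
rewrite catA -[X in word_cong _ X]cat0s.
apply: word_cong_cat (word_cong_refl _).
apply: word_cong_trans (word_mulVg u).
exact: word_cong_cat (word_cong_refl _) (word_cong_sym uv).
Qed.

Lemma pres_mulE u v : pres_mul (pres u) (pres v) = pres (u ++ v).
Proof. by apply/presP; apply: word_cong_cat; apply/presP; apply: presK. Qed.

Lemma pres_invE u : pres_inv (pres u) = pres (word_inv u).
Proof. by apply/presP; apply: word_cong_inv; apply/presP; apply: presK. Qed.

Fact pres_mulgA : associative pres_mul.
Proof.
move=> p q r; rewrite -[p]presK -[q]presK -[r]presK.
by rewrite !pres_mulE catA.
Qed.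
Fact pres_mul1g : left_id (pres [::]) pres_mul.
Proof. by move=> p; rewrite -[p]presK pres_mulE. Qed.
Fact pres_mulg1 : right_id (pres [::]) pres_mul.
Proof. by move=> p; rewrite -[p]presK pres_mulE cats0. Qed.
Fact pres_mulVg : left_inverse (pres [::]) pres_inv pres_mul.
Proof.
move=> p; rewrite -[p]presK pres_invE pres_mulE.
by apply/presP; apply: word_mulVg.
Qed.
Fact pres_mulgV : right_inverse (pres [::]) pres_inv pres_mul.
Proof.
move=> p; rewrite -[p]presK pres_invE pres_mulE.
by apply/presP; apply: word_mulgV.
Qed.
HB.instance Definition _ := isGroup.Build presented
  pres_mulgA pres_mul1g pres_mulg1 pres_mulVg pres_mulgV.

Lemma presM u v : pres (u ++ v) = pres u * pres v.
Proof. by rewrite [RHS]pres_mulE. Qed.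

Definition pres_gen (x : X) : presented := pres [:: (x, true)].

Section Lift.
Variables (G : groupType) (f : X -> G).

Definition word_eval (w : word) : G :=
  \prod_(p <- w) (if p.2 then f p.1 else (f p.1)^-1).

Definition pres_lift (q : presented) : G := word_eval (repr q).

Lemma word_eval_cat u v : word_eval (u ++ v) = word_eval u * word_eval v.
Proof. exact: big_cat. Qed.

Hypothesis fR : forall u v, R u v -> word_eval u = word_eval v.

Lemma word_evalP u v : word_cong u v -> word_eval u = word_eval v.
Proof.
elim=> {u v} [u v /fR//|x e|//|u v _ ->//|u v w _ -> _ ->//|].
  rewrite /word_eval !big_cons big_nil /=.
  by case: e; rewrite mulg1 ?mulgV ?mulVg.
by move=> u u' v v' _ eu _ ev; rewrite !word_eval_cat eu ev.
Qed.

Lemma pres_liftE w : pres_lift (pres w) = word_eval w.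
Proof. by apply: word_evalP; apply/presP; apply: presK. Qed.

Lemma pres_liftM : {morph pres_lift : p q / p * q}.
Proof.
move=> p q; rewrite -[p]presK -[q]presK -presM !pres_liftE.
exact: word_eval_cat.
Qed.

Lemma pres_lift_gen x : pres_lift (pres_gen x) = f x.
Proof. by rewrite pres_liftE /word_eval big_cons big_nil mulg1. Qed.

End Lift.

Lemma pres_ext (G : groupType) (f g : presented -> G) :
  {morph f : x y / x * y} -> {morph g : x y / x * y} ->
  (forall x, f (pres_gen x) = g (pres_gen x)) -> f =1 g.
Proof.
move=> fM gM fg q; rewrite -[q]presK; elim: (repr q) => [|[x e] w IHw].
  have h1 (h : presented -> G) : {morph h : x y / x * y} -> h 1 = 1.
    by move=> hM; apply: (mulgI (h 1)); rewrite -hM !mulg1.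
  by rewrite [pres [::]](_ : _ = 1) // !h1.
rewrite -cat1s presM fM gM IHw; congr (_ * _).
case: e; first exact: fg.
have h1 (h : presented -> G) : {morph h : x y / x * y} -> h 1 = 1.
  by move=> hM; apply: (mulgI (h 1)); rewrite -hM !mulg1.
have hV (h : presented -> G) : {morph h : x y / x * y} ->
    h (pres_gen x)^-1 = (h (pres_gen x))^-1.
  by move=> hM; apply: (mulgI (h (pres_gen x))); rewrite -hM !mulgV h1.
by rewrite [pres _](_ : _ = (pres_gen x)^-1) ?hV ?fg // [RHS]pres_invE.
Qed.

End Presentation.

Section StableLinear.
Variable R : nzRingType.
Local Open Scope ring_scope.

Definition infmx := nat -> nat -> R.

Definition infmx1 : infmx := fun i j => (i == j)%:R.

(* [\sum_(k \in [set: nat])] is the sum over the finite support (and [0] if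
   the support is infinite, which does not happen for [finitary] matrices). *)
Definition infmx_mul (M N : infmx) : infmx :=
  fun i j => \sum_(k \in [set: nat]) M i k * N k j.

Definition infmx_elem (i j : nat) (a : R) : infmx :=
  fun k l => (k == l)%:R + a *+ ((k == i) && (l == j)).

Definition stably_trivial (n : nat) (M : infmx) :=
  forall i j : nat, (n <= i)%N || (n <= j)%N -> M i j = infmx1 i j.

(* [M] agrees with the identity outside a finite corner. *)
Definition finitary (M : infmx) := exists n, stably_trivial n M.

Lemma stably_trivialW m n M : (n <= m)%N ->
  stably_trivial n M -> stably_trivial m M.
Proof.
move=> nm Mn i j /orP ij; apply: Mn.
by case: ij => /(leq_trans nm) ->; rewrite ?orbT.
Qed.

Lemma infmx_mulE m n M N i j : stably_trivial n M -> (n <= m)%N -> (i < m)%N ->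
  infmx_mul M N i j = \sum_(k < m) M i k * N k j.
Proof.
move=> Mn nm im; rewrite /infmx_mul (fsbig_ord _ m (fun k => M i k * N k j)).
apply/esym/fsbig_widen => // k [_ /= /negP]; rewrite -leqNgt => mk.
rewrite /preimage /= Mn ?(leq_trans nm mk) ?orbT // /infmx1.
by rewrite ltn_eqF ?mul0r // (leq_trans im).
Qed.

Lemma infmx1_finitary : finitary infmx1.
Proof. by exists 0%N. Qed.

Lemma sum_delta_l m (F : nat -> R) i : (i < m)%N ->
  \sum_(k < m) (i == k)%:R * F k = F i.
Proof.
move=> im; rewrite (bigD1 (Ordinal im)) //= eqxx mul1r big1 ?addr0 // => k ki.
by rewrite -val_eqE /= eq_sym in ki; rewrite (negPf ki) mul0r.
Qed.

Lemma sum_delta_r m (F : nat -> R) i : (i < m)%N ->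
  \sum_(k < m) F k * ((k : nat) == i)%:R = F i.
Proof.
move=> im; rewrite (bigD1 (Ordinal im)) //= eqxx mulr1 big1 ?addr0 // => k ki.
by rewrite -val_eqE /= in ki; rewrite (negPf ki) mulr0.
Qed.

Lemma stably_trivialM n M N : stably_trivial n M -> stably_trivial n N ->
  stably_trivial n (infmx_mul M N).
Proof.
move=> Mn Nn i j nij; set m := maxn n (maxn i.+1 j.+1).
have [nm im jm] : [/\ n <= m, i < m & j < m]%N.
  by split; rewrite /m !leq_max ?leqnn ?orbT.
rewrite (infmx_mulE _ _ Mn nm im); case/orP: nij => [ni|nj].
  under eq_bigr => k _ do rewrite Mn ?ni // /infmx1.
  by rewrite (sum_delta_l (fun k => N k j)) // Nn ?ni.
under eq_bigr => k _ do rewrite Nn ?nj ?orbT // /infmx1.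
by rewrite (sum_delta_r (fun k => M i k)) // Mn ?nj ?orbT.
Qed.

Lemma finitaryM M N : finitary M -> finitary N -> finitary (infmx_mul M N).
Proof.
move=> [m Mm] [n Nn]; exists (maxn m n).
by apply: stably_trivialM; [apply: stably_trivialW Mm|apply: stably_trivialW Nn];
  rewrite leq_max leqnn ?orbT.
Qed.

Lemma infmx_eqP (M N : infmx) : (forall i j, M i j = N i j) <-> M = N.
Proof.
by split=> [MN|->//]; apply/funext => i; apply/funext => j.
Qed.

Lemma infmx_mulA M N P : finitary M -> finitary N -> finitary P ->
  infmx_mul M (infmx_mul N P) = infmx_mul (infmx_mul M N) P.
Proof.
move=> [m Mm] [n Nn] [p Pp]; apply/infmx_eqP => i j.
set q := maxn (maxn m n) (maxn i.+1 j.+1).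
have [mq nq iq jq] : [/\ m <= q, n <= q, i < q & j < q]%N.
  by split; rewrite /q !leq_max ?leqnn ?orbT.
have Mq := stably_trivialW mq Mm; have Nq := stably_trivialW nq Nn.
rewrite (infmx_mulE _ _ Mq (leqnn q) iq).
rewrite (infmx_mulE _ _ (stably_trivialM Mq Nq) (leqnn q) iq).
under eq_bigr => k _.
  rewrite (infmx_mulE _ _ Nq (leqnn q) (ltn_ord k)) mulr_sumr; over.
under [RHS]eq_bigr => k _.
  rewrite (infmx_mulE _ _ Mq (leqnn q) iq) mulr_suml; over.
rewrite exchange_big /=.
by apply: eq_bigr => k _; apply: eq_bigr => l _; rewrite mulrA.
Qed.

Lemma infmx_mul1 M : infmx_mul infmx1 M = M.
Proof.
apply/infmx_eqP => i j.
by rewrite (@infmx_mulE i.+1 0%N) // (sum_delta_l (fun k => M k j)).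
Qed.

Lemma infmx_mulr1 M : finitary M -> infmx_mul M infmx1 = M.
Proof.
move=> [n Mn]; apply/infmx_eqP => i j; set m := maxn n (maxn i.+1 j.+1).
have [nm im jm] : [/\ n <= m, i < m & j < m]%N.
  by split; rewrite /m !leq_max ?leqnn ?orbT.
by rewrite (infmx_mulE _ _ Mn nm im) (sum_delta_r (fun k => M i k)).
Qed.

Lemma infmx_elem_finitary i j a : finitary (infmx_elem i j a).
Proof.
exists (maxn i.+1 j.+1) => k l; rewrite !geq_max /infmx_elem.
case: (k =P i) => [->|_]; case: (l =P j) => [->|_] /=; rewrite ?addr0 //.
by rewrite ltnn /= ltnn andbF.
Qed.

Lemma infmx_mul_elem M i j a k l : finitary M ->
  infmx_mul M (infmx_elem i j a) k l = M k l + (M k i * a) *+ (l == j).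
Proof.
move=> [n Mn]; set m := maxn n (maxn k.+1 (maxn l.+1 i.+1)).
have [nm km lm im] : [/\ n <= m, k < m, l < m & i < m]%N.
  by split; rewrite /m !leq_max ?leqnn ?orbT.
rewrite (infmx_mulE _ _ Mn nm km) /infmx_elem.
under eq_bigr => p _ do rewrite mulrDr.
rewrite big_split /= (sum_delta_r (fun p => M k p)) //; congr (_ + _).
case: (l == j); last first.
  by rewrite mulr0n big1 // => p _; rewrite andbF mulr0n mulr0.
under eq_bigr => p _ do rewrite andbT -mulr_natr mulrA.
by rewrite (sum_delta_r (fun p => M k p * a)) // mulr1n.
Qed.

(* Finitary matrices bundled with their (unique, see [GL_inj]) inverse. *)
Record GL := MkGL {
  GLmx :> infmx;
  GLinvmx : infmx;
  GL_subproof : [/\ finitary GLmx, finitary GLinvmx,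
    infmx_mul GLmx GLinvmx = infmx1 & infmx_mul GLinvmx GLmx = infmx1] }.

HB.instance Definition _ := gen_eqMixin GL.
HB.instance Definition _ := gen_choiceMixin GL.

Lemma GL_finitary (g : GL) : finitary g.
Proof. by case: g => ? ? []. Qed.

Lemma GL_inj (g h : GL) : GLmx g = GLmx h -> g = h.
Proof.
case: g h => [M M' gP] [N N' hP] /= MN; rewrite -{N}MN in hP *.
suff M'N' : M' = N' by rewrite -{N'}M'N' in hP *; congr MkGL; apply: Prop_irrelevance.
case: gP hP => fM fM' MM' M'M [_ fN' MN' N'M].
by rewrite -[LHS]infmx_mul1 -N'M -infmx_mulA // MM' infmx_mulr1.
Qed.

Fact GL1_subproof : [/\ finitary infmx1, finitary infmx1,
  infmx_mul infmx1 infmx1 = infmx1 & infmx_mul infmx1 infmx1 = infmx1].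
Proof. by split; rewrite ?infmx_mul1 //; apply: infmx1_finitary. Qed.
Definition GL1 := MkGL GL1_subproof.

Fact GL_inv_subproof (g : GL) : [/\ finitary (GLinvmx g), finitary (GLmx g),
  infmx_mul (GLinvmx g) g = infmx1 & infmx_mul g (GLinvmx g) = infmx1].
Proof. by case: g => ? ? []. Qed.
Definition GL_inv g := MkGL (GL_inv_subproof g).

Fact GL_mul_subproof (g h : GL) :
  [/\ finitary (infmx_mul g h), finitary (infmx_mul (GLinvmx h) (GLinvmx g)),
  infmx_mul (infmx_mul g h) (infmx_mul (GLinvmx h) (GLinvmx g)) = infmx1 &
  infmx_mul (infmx_mul (GLinvmx h) (GLinvmx g)) (infmx_mul g h) = infmx1].
Proof.
case: g h => [M M' [fM fM' MM' M'M]] [N N' [fN fN' NN' N'N]] /=.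
split; try exact: finitaryM.
  rewrite -infmx_mulA //; last exact: finitaryM.
  by rewrite [X in infmx_mul _ X]infmx_mulA // NN' infmx_mul1.
rewrite -infmx_mulA //; last exact: finitaryM.
by rewrite [X in infmx_mul _ X]infmx_mulA // M'M infmx_mul1.
Qed.
Definition GL_mul g h := MkGL (GL_mul_subproof g h).

Fact GL_mulA : associative GL_mul.
Proof. by move=> f g h; apply/GL_inj/infmx_mulA; apply: GL_finitary. Qed.
Fact GL_mul1g : left_id GL1 GL_mul.
Proof. by move=> g; apply/GL_inj/infmx_mul1. Qed.
Fact GL_mulg1 : right_id GL1 GL_mul.
Proof. by move=> g; apply/GL_inj/infmx_mulr1/GL_finitary. Qed.
Fact GL_mulVg : left_inverse GL1 GL_inv GL_mul.
Proof. by case=> M M' gP; apply/GL_inj; case: gP. Qed.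
Fact GL_mulgV : right_inverse GL1 GL_inv GL_mul.
Proof. by case=> M M' gP; apply/GL_inj; case: gP. Qed.
HB.instance Definition _ := isGroup.Build GL
  GL_mulA GL_mul1g GL_mulg1 GL_mulVg GL_mulgV.

Lemma GL_mulE (g h : GL) : GLmx (g * h)%g = infmx_mul g h.
Proof. by []. Qed.

Fact GL_elem_subproof i j (ij : i != j) a :
  [/\ finitary (infmx_elem i j a), finitary (infmx_elem i j (- a)),
  infmx_mul (infmx_elem i j a) (infmx_elem i j (- a)) = infmx1 &
  infmx_mul (infmx_elem i j (- a)) (infmx_elem i j a) = infmx1].
Proof.
have H b : infmx_mul (infmx_elem i j b) (infmx_elem i j (- b)) = infmx1.
  apply/infmx_eqP => k l; rewrite infmx_mul_elem; last exact: infmx_elem_finitary.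
  rewrite /infmx_elem /infmx1 (negPf ij) andbF mulr0n addr0 -addrA.
  by case: (k == i); case: (l == j); rewrite /= ?mul1r ?mul0r ?mulr1n ?mulr0n
    ?mul0rn ?subrr ?addr0.
split; try exact: infmx_elem_finitary; first exact: H.
by rewrite -[X in infmx_mul _ (infmx_elem _ _ X)]opprK H.
Qed.
Definition GL_elem i j (ij : i != j) a : GL := MkGL (GL_elem_subproof ij a).

Definition elementary : set GL :=
  [set g | exists i j (ij : i != j) a, g = GL_elem ij a].

Definition E := subgrp (generated elementary).

Definition E_elem i j (ij : i != j) a : E :=
  Subgrp (sub_generated (ex_intro _ i (ex_intro _ j (ex_intro _ ij
    (ex_intro _ a (erefl (GL_elem ij a))))))).

End StableLinear.

Section WordMap.
Variables (X : choiceType) (R : word X -> word X -> Prop) (s : X -> X).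

Definition word_map (w : word X) : word X := [seq (s p.1, p.2) | p <- w].

Definition word_comm (u v : word X) : word X :=
  u ++ v ++ word_inv u ++ word_inv v.

Lemma word_map_cat u v : word_map (u ++ v) = word_map u ++ word_map v.
Proof. exact: map_cat. Qed.

Lemma word_map_inv u : word_map (word_inv u) = word_inv (word_map u).
Proof. by rewrite /word_map /word_inv map_rev -!map_comp. Qed.

Lemma word_map_comm u v :
  word_map (word_comm u v) = word_comm (word_map u) (word_map v).
Proof. by rewrite /word_comm !word_map_cat !word_map_inv. Qed.

Definition pres_map : presented R -> presented R :=
  pres_lift (fun x => pres_gen R (s x)).

Lemma word_eval_map w :
  word_eval (fun x => pres_gen R (s x)) w = pres R (word_map w).
Proof.
elim: w => [|[x e] w IHw]; first by rewrite /word_eval big_nil.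
rewrite /word_eval big_cons [X in _ * X]IHw /= -cat1s presM.
by case: e => //; rewrite [(pres_gen R _)^-1]pres_invE.
Qed.

Hypothesis sR : forall u v, R u v -> R (word_map u) (word_map v).

Lemma pres_map_subproof u v : R u v ->
  word_eval (fun x => pres_gen R (s x)) u =
  word_eval (fun x => pres_gen R (s x)) v.
Proof.
by move=> /sR uv; rewrite !word_eval_map; apply/presP/word_cong_rel.
Qed.

Lemma pres_mapM : {morph pres_map : p q / p * q}.
Proof. exact/pres_liftM/pres_map_subproof. Qed.

Lemma pres_map_gen x : pres_map (pres_gen R x) = pres_gen R (s x).
Proof. exact/pres_lift_gen/pres_map_subproof. Qed.

End WordMap.

Lemma word_eval_comm (X : choiceType) (G : groupType) (f : X -> G) x y :
  word_eval f (word_comm [:: (x, true)] [:: (y, true)]) =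
  f x * f y * (f x)^-1 * (f y)^-1.
Proof. by rewrite /word_eval !big_cons big_nil /= mulg1 !mulgA. Qed.

Section Steinberg.
Variable R : nzRingType.
Local Open Scope ring_scope.

Definition offdiag := {p : nat * nat | p.1 != p.2}.

Definition St_index : choiceType := (offdiag * R)%type.

Definition St_letter i j (ij : i != j) (a : R) : St_index :=
  (exist (fun p : nat * nat => p.1 != p.2) (i, j) ij, a).

Notation x_ ij a := [:: (St_letter ij a, true)].

Inductive St_rel : word St_index -> word St_index -> Prop :=
| St_relD i j (ij : i != j) (a b : R) :
    St_rel (x_ ij a ++ x_ ij b) (x_ ij (a + b))
| St_relC i j k l (ij : i != j) (kl : k != l) (a b : R) : i != l -> k != j ->
    St_rel (word_comm (x_ ij a) (x_ kl b)) [::]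
| St_relM i j k (ij : i != j) (jk : j != k) (ik : i != k) (a b : R) :
    St_rel (word_comm (x_ ij a) (x_ jk b)) (x_ ik (a * b)).

Definition St := presented St_rel.
HB.instance Definition _ := Group.on St.

Definition St_gen i j (ij : i != j) (a : R) : St :=
  pres_gen St_rel (St_letter ij a).

Definition phi_gen (x : St_index) : E R := E_elem (valP x.1) x.2.

Definition phi : St -> E R := pres_lift phi_gen.

Lemma phi_genE i j (ij : i != j) (a : R) : phi_gen (St_letter ij a) = E_elem ij a.
Proof. by apply/val_inj/GL_inj. Qed.

Lemma E_eqP (g h : E R) :
  (forall i j, GLmx (val g) i j = GLmx (val h) i j) -> g = h.
Proof. by move=> gh; apply/val_inj/GL_inj/infmx_eqP. Qed.

Lemma E_mul_elem (g : E R) i j (ij : i != j) (a : R) k l :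
  GLmx (val (g * E_elem ij a)%g) k l =
  GLmx (val g) k l + (GLmx (val g) k i * a) *+ (l == j).
Proof. by apply: infmx_mul_elem; apply: GL_finitary. Qed.

Lemma E_elemE i j (ij : i != j) (a : R) k l :
  GLmx (val (E_elem ij a)) k l = (k == l)%:R + a *+ ((k == i) && (l == j)).
Proof. by []. Qed.

Fact phi_subproof u v : St_rel u v -> word_eval phi_gen u = word_eval phi_gen v.
Proof.
case=> {u v} [i j ij a b|i j k l ij kl a b il kj|i j k ij jk ik a b].
- rewrite /word_eval !big_cons !big_nil /= !mulg1 !phi_genE.
  apply: E_eqP => p q; rewrite E_mul_elem !E_elemE (negPf ij) andbF addr0.
  by case: (p == i); case: (q == j); rewrite /= ?mul0r ?mul1r ?mulr0n ?mulr1n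
    ?addr0 -?addrA.
- rewrite word_eval_comm !phi_genE /word_eval big_nil.
  suff -> : (E_elem ij a * E_elem kl b = E_elem kl b * E_elem ij a)%g.
    by rewrite mulgK mulgV.
  apply: E_eqP => p q; rewrite !E_mul_elem !E_elemE.
  rewrite (negPf kj) [i == l](negPf il) !andbF !addr0 -!addrA; congr (_ + _).
  rewrite addrC; congr (_ + _).
    by case: (p == k); case: (q == l); rewrite /= ?mul0r ?mul1r ?mul0rn.
  by case: (p == i); case: (q == j); rewrite /= ?mul0r ?mul1r ?mul0rn.
- rewrite word_eval_comm !phi_genE.
  rewrite /word_eval big_cons big_nil mulg1 /= phi_genE.
  suff -> : (E_elem ij a * E_elem jk b =
      E_elem ik (a * b)%R * E_elem jk b * E_elem ij a)%g by rewrite !mulgK.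
  apply: E_eqP => p q; rewrite !E_mul_elem !E_elemE.
  have kj : (k == j) = false by rewrite eq_sym (negPf jk).
  rewrite (negPf jk) (negPf ik) eqxx !andbF !andbT !mulr0n !addr0.
  case: (p == i); case: (p == j); case: (q == j); case: (q == k);
    rewrite /= ?mulr0n ?mulr1n ?add0r ?mul0r ?mulrDl ?mul0r ?mul1r ?addr0 //;
    rewrite -!addrA; congr (_ + _);
    first [exact: addrC | by rewrite addrA [RHS]addrC; congr (_ + _); exact: addrC].
Qed.

Fact phiM : {morph phi : x y / x * y}%g.
Proof. exact/pres_liftM/phi_subproof. Qed.
HB.instance Definition _ := isMultiplicative.Build St (E R) phi phiM.

Lemma phi_St_gen i j (ij : i != j) (a : R) : phi (St_gen ij a) = E_elem ij a.
Proof. by rewrite [LHS]pres_lift_gen ?phi_genE //; apply: phi_subproof. Qed.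

End Steinberg.

Section Symbols.
Variable R : unitRingType.
Local Open Scope ring_scope.

Definition units := {u : R | u \is a GRing.unit}.

Definition Sym_index : choiceType := (units * units)%type.

Notation symb u v := [:: ((u, v), true)].

Inductive Sym_rel : word Sym_index -> word Sym_index -> Prop :=
| Sym_rel1B (u v : units) : val u != 1 -> val v = 1 - val u ->
    Sym_rel (symb u v) [::]
| Sym_relMl (u u' uu' v : units) : val uu' = val u * val u' ->
    Sym_rel (symb uu' v) (symb u v ++ symb u' v)
| Sym_relMr (u v v' vv' : units) : val vv' = val v * val v' ->
    Sym_rel (symb u vv') (symb u v ++ symb u v').

Definition Sym := presented Sym_rel.
HB.instance Definition _ := Group.on Sym.

Definition Sym_gen (u v : units) : Sym := pres_gen Sym_rel (u, v).

End Symbols.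

HB.mixin Record isGammaGroup (Gamma : groupType) G of Group G := {
  gact : Gamma -> G -> G;
  gact1 : forall x, gact 1 x = x;
  gactM : forall g h x, gact (g * h) x = gact g (gact h x);
  gactMr : forall g, {morph gact g : x y / x * y}
}.

#[short(type="gammaGroupType")]
HB.structure Definition GammaGroup (Gamma : groupType) :=
  {G of Group G & isGammaGroup Gamma G}.

(* By [ract1] and [ractM] each [ract g] is invertible, so that [ract] is a group
   homomorphism from [Gamma] to the ring automorphisms of [R]. *)
HB.mixin Record isGammaRing (Gamma : groupType) R of GRing.NzRing R := {
  ract : Gamma -> {rmorphism R -> R};
  ract1 : forall x, ract 1 x = x;
  ractM : forall g h x, ract (g * h) x = ract g (ract h x)
}.

#[short(type="gammaNzRingType")]
HB.structure Definition GammaNzRing (Gamma : groupType) :=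
  {R of GRing.NzRing R & isGammaRing Gamma R}.

#[short(type="gammaUnitRingType")]
HB.structure Definition GammaUnitRing (Gamma : groupType) :=
  {R of GRing.UnitRing R & isGammaRing Gamma R}.

#[short(type="gammaFieldType")]
HB.structure Definition GammaField (Gamma : groupType) :=
  {R of GRing.Field R & isGammaRing Gamma R}.

HB.mixin Record isGammaHom (Gamma : groupType) (G H : gammaGroupType Gamma)
    (f : G -> H) := {
  gact_hom : forall g x, f (gact g x) = gact g (f x)
}.

#[short(type="gammaHom")]
HB.structure Definition GammaHom (Gamma : groupType)
    (G H : gammaGroupType Gamma) :=
  {f of isMultiplicative G H f & isGammaHom Gamma G H f}.

HB.mixin Record isGammaClosed (Gamma : groupType) (G : gammaGroupType Gamma)
    (S : {pred G}) := {
  gpred_gact : forall (g : Gamma) (x : G), x \in S -> gact g x \in S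
}.

#[short(type="gammaClosed")]
HB.structure Definition GammaClosed (Gamma : groupType)
    (G : gammaGroupType Gamma) :=
  {S of isInvClosed G S & isMul1Closed G S & isMulClosed G S
      & isGammaClosed Gamma G S}.

Section GammaSubgroup.
Variables (Gamma : groupType) (G : gammaGroupType Gamma) (S : gammaClosed G).

Definition subgrp_gact (g : Gamma) (x : subgrp S) : subgrp S :=
  Subgrp (gpred_gact g _ (subgrp_valP x)).

Fact subgrp_gact1 x : subgrp_gact 1 x = x.
Proof. by apply/val_inj; rewrite /= gact1. Qed.
Fact subgrp_gactM g h x : subgrp_gact (g * h) x = subgrp_gact g (subgrp_gact h x).
Proof. by apply/val_inj; rewrite /= gactM. Qed.
Fact subgrp_gactMr g : {morph subgrp_gact g : x y / x * y}.
Proof. by move=> x y; apply/val_inj; rewrite /= gactMr. Qed.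
HB.instance Definition _ := isGammaGroup.Build Gamma (subgrp S)
  subgrp_gact1 subgrp_gactM subgrp_gactMr.

End GammaSubgroup.

Section GammaActions.
Variables (Gamma : groupType).
Local Open Scope ring_scope.

Section NzRing.
Variable R : gammaNzRingType Gamma.

Definition infmx_act (g : Gamma) (M : infmx R) : infmx R :=
  fun i j => ract g (M i j).

Lemma infmx_act1 g : infmx_act g (infmx1 R) = infmx1 R.
Proof. by apply/infmx_eqP => i j; rewrite /infmx_act rmorph_nat. Qed.

Lemma infmx_act_finitary g M : finitary M -> finitary (infmx_act g M).
Proof.
move=> [n Mn]; exists n => i j nij.
by rewrite /infmx_act Mn // /infmx1 rmorph_nat.
Qed.

Lemma infmx_actM g M N : finitary M ->
  infmx_act g (infmx_mul M N) = infmx_mul (infmx_act g M) (infmx_act g N).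
Proof.
move=> [n Mn]; apply/infmx_eqP => i j.
have gMn : stably_trivial n (infmx_act g M).
  by move=> k l nkl; rewrite /infmx_act Mn // /infmx1 rmorph_nat.
have [ni im] : (n <= maxn n i.+1 /\ i < maxn n i.+1)%N.
  by split; rewrite leq_max leqnn ?orbT.
rewrite (infmx_mulE _ _ gMn ni im) /infmx_act (infmx_mulE _ _ Mn ni im).
by rewrite rmorph_sum; apply: eq_bigr => k _; rewrite rmorphM.
Qed.

Fact GL_act_subproof g (M : GL R) :
  [/\ finitary (infmx_act g M), finitary (infmx_act g (GLinvmx M)),
  infmx_mul (infmx_act g M) (infmx_act g (GLinvmx M)) = infmx1 R &
  infmx_mul (infmx_act g (GLinvmx M)) (infmx_act g M) = infmx1 R].
Proof.
case: M => M M' [fM fM' MM' M'M] /=.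
by split; rewrite -?infmx_actM ?MM' ?M'M ?infmx_act1 //;
  apply: infmx_act_finitary.
Qed.

Definition GL_act g (M : GL R) : GL R := MkGL (GL_act_subproof g M).

Fact GL_gact1 M : GL_act 1%g M = M.
Proof. by apply/GL_inj/infmx_eqP => i j; apply: ract1. Qed.
Fact GL_gactM g h M : GL_act (g * h)%g M = GL_act g (GL_act h M).
Proof. by apply/GL_inj/infmx_eqP => i j; apply: ractM. Qed.
Fact GL_gactMr g : {morph GL_act g : M N / M * N}%g.
Proof. by move=> M N; apply/GL_inj/infmx_actM/GL_finitary. Qed.
HB.instance Definition _ := isGammaGroup.Build Gamma (GL R)
  GL_gact1 GL_gactM GL_gactMr.

Lemma GL_act_elem g i j (ij : i != j) (a : R) :
  gact g (GL_elem ij a) = GL_elem ij (ract g a).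
Proof.
apply/GL_inj/infmx_eqP => k l; rewrite /= /infmx_act /infmx_elem.
by rewrite rmorphD rmorph_nat rmorphMn.
Qed.

End NzRing.

End GammaActions.

Section GammaGenerated.
Variables (Gamma : groupType) (G : gammaGroupType Gamma).

Section Preim.
Variables (H K : groupType) (f : {multiplicative H -> K}).

Definition preimgrp (S : {pred K}) : {pred H} := [pred x | f x \in S].

Lemma in_preimgrp (S : {pred K}) x : (x \in preimgrp S) = (f x \in S).
Proof. by []. Qed.

Section GroupClosed.
Variable S : groupClosed K.
Fact preimgrpM : mulg_closed (preimgrp S).
Proof. by move=> x y; rewrite !inE gmulfM; apply: gpredM. Qed.
Fact preimgrp1 : 1 \in preimgrp S.
Proof. by rewrite inE hom1 gpred1. Qed.
Fact preimgrpV : invg_closed (preimgrp S).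
Proof. by move=> x; rewrite !inE homV gpredV. Qed.
HB.instance Definition _ := isMulClosed.Build H (preimgrp S) preimgrpM.
HB.instance Definition _ := isMul1Closed.Build H (preimgrp S) preimgrp1.
HB.instance Definition _ := isInvClosed.Build H (preimgrp S) preimgrpV.
End GroupClosed.

Section NormalClosed.
Variable S : normalClosed K.
Fact preimgrpJ x y : x \in preimgrp S -> x ^ y \in preimgrp S.
Proof. by rewrite !inE !gmulfM homV; apply: gpredJr. Qed.
HB.instance Definition _ := isConjClosed.Build H (preimgrp S) preimgrpJ.
End NormalClosed.

End Preim.

HB.instance Definition _ (g : Gamma) :=
  isMultiplicative.Build G G (gact g) (gactMr g).

Lemma generated_gact (A : set G) :
  (forall g x, A x -> A (gact (g : Gamma) x)) ->
  forall (g : Gamma) x, x \in generated A -> gact g x \in generated A.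
Proof.
move=> gA g x /generatedP Hx.
rewrite -(in_preimgrp (gact g)); apply: Hx => y /(gA g) Ay /=.
by rewrite in_preimgrp; apply: sub_generated.
Qed.

(* The normal subgroup [Gamma G] of [G]. *)
Definition GammaSub : {pred G} :=
  normal_closure [set z | exists (g : Gamma) x, z = gact g x * x^-1].
HB.instance Definition _ := NormalClosed.on GammaSub.

Definition coinv := quotient GammaSub.
HB.instance Definition _ := Group.on coinv.

End GammaGenerated.

Arguments GammaSub {Gamma} G.

Section GammaInstances.
Variable Gamma : groupType.
Local Open Scope ring_scope.

Section NzRing.
Variable R : gammaNzRingType Gamma.

Fact elementary_gact (g : Gamma) (M : GL R) :
  M \in generated (@elementary R) -> gact g M \in generated (@elementary R).
Proof.
apply: generated_gact => {}g _ [i [j [ij [a ->]]]].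
by exists i, j, ij, (ract g a); rewrite GL_act_elem.
Qed.
HB.instance Definition _ := isGammaClosed.Build Gamma (GL R)
  (generated (@elementary R)) elementary_gact.

HB.instance Definition _ := GammaGroup.on (E R).

Definition St_index_act (g : Gamma) (x : St_index R) : St_index R :=
  (x.1, ract g x.2).

Definition St_act (g : Gamma) : St R -> St R := pres_map (St_index_act g).

Fact St_rel_act g u v : @St_rel R u v ->
  St_rel (word_map (St_index_act g) u) (word_map (St_index_act g) v).
Proof.
case=> {u v} [i j ij a b|i j k l ij kl a b il kj|i j k ij jk ik a b].
- rewrite /word_map /St_index_act /= rmorphD.
  exact: (St_relD ij (ract g a) (ract g b)).
- rewrite word_map_comm.
  exact: (St_relC ij kl (ract g a) (ract g b)).
- rewrite word_map_comm /word_map /St_index_act /= rmorphM.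
  exact: (St_relM ij jk ik (ract g a) (ract g b)).
Qed.

Lemma St_actE g i j (ij : i != j) (a : R) :
  St_act g (St_gen ij a) = St_gen ij (ract g a).
Proof. exact/pres_map_gen/St_rel_act. Qed.

Fact St_gactMr g : {morph St_act g : x y / x * y}%g.
Proof. exact/pres_mapM/St_rel_act. Qed.
Fact St_gact1 x : St_act 1%g x = x.
Proof.
apply: (@pres_ext _ _ _ (St_act 1%g) id) => //; first exact: St_gactMr.
move=> [ij a]; rewrite [LHS]pres_map_gen; last exact: St_rel_act.
by rewrite /St_index_act ract1.
Qed.
Fact St_gactM g h x : St_act (g * h)%g x = St_act g (St_act h x).
Proof.
apply: (@pres_ext _ _ _ (St_act (g * h)%g) (St_act g \o St_act h)).
- exact: St_gactMr.
- by move=> y z /=; rewrite !St_gactMr.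
- move=> [ij a] /=; rewrite [LHS]pres_map_gen; last exact: St_rel_act.
  rewrite [St_act h _]pres_map_gen; last exact: St_rel_act.
  rewrite [RHS]pres_map_gen; last exact: St_rel_act.
  by rewrite /St_index_act ractM.
Qed.
HB.instance Definition _ := isGammaGroup.Build Gamma (St R)
  St_gact1 St_gactM St_gactMr.

Fact phi_gact (g : Gamma) (x : St R) : phi (gact g x) = gact g (phi x).
Proof.
apply: (@pres_ext _ _ _ (fun x : St R => phi (gact g x))
  (fun x => gact g (phi x))) => [y z|y z|[[[i j] ij] a]] /=.
- by rewrite gactMr gmulfM.
- by rewrite gmulfM gactMr.
rewrite -[pres_gen _ _]/(St_gen ij a) [gact g _]St_actE !phi_St_gen.
by apply/val_inj; rewrite /= GL_act_elem.
Qed.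
HB.instance Definition _ :=
  isGammaHom.Build Gamma (St R) (E R) (@phi R) phi_gact.

End NzRing.

Section UnitRing.
Variable R : gammaUnitRingType Gamma.

Definition units_act (g : Gamma) (u : units R) : units R :=
  exist (fun x : R => x \is a GRing.unit) (ract g (val u))
    (rmorph_unit (ract g) (valP u)).

Definition Sym_index_act (g : Gamma) (x : Sym_index R) : Sym_index R :=
  (units_act g x.1, units_act g x.2).

Definition Sym_act (g : Gamma) : Sym R -> Sym R := pres_map (Sym_index_act g).

Fact Sym_rel_act g u v : @Sym_rel R u v ->
  Sym_rel (word_map (Sym_index_act g) u) (word_map (Sym_index_act g) v).
Proof.
case=> [{}u {}v u1 uv|{}u u' uu' {}v uE|{}u {}v v' vv' vE];
  rewrite ?word_map_cat /word_map /=.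
- apply: Sym_rel1B; last by rewrite /= uv rmorphB rmorph1.
  apply: contra u1 => /eqP /= gu1; apply/eqP.
  rewrite -[val u](@ract1 Gamma) -[1%g](mulVg g) ractM gu1.
  exact: rmorph1.
- by apply: Sym_relMl; rewrite /= uE rmorphM.
- by apply: Sym_relMr; rewrite /= vE rmorphM.
Qed.

Lemma Sym_actE g (u v : units R) :
  Sym_act g (Sym_gen u v) = Sym_gen (units_act g u) (units_act g v).
Proof. exact/pres_map_gen/Sym_rel_act. Qed.

Fact Sym_gactMr g : {morph Sym_act g : x y / x * y}%g.
Proof. exact/pres_mapM/Sym_rel_act. Qed.
Fact Sym_gact1 x : Sym_act 1%g x = x.
Proof.
apply: (@pres_ext _ _ _ (Sym_act 1%g) id) => //; first exact: Sym_gactMr.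
move=> [u v]; rewrite [LHS]Sym_actE /Sym_gen.
by congr (pres_gen _ (_, _)); apply/val_inj/ract1.
Qed.
Fact Sym_gactM g h x : Sym_act (g * h)%g x = Sym_act g (Sym_act h x).
Proof.
apply: (@pres_ext _ _ _ (Sym_act (g * h)%g) (Sym_act g \o Sym_act h)).
- exact: Sym_gactMr.
- by move=> y z /=; rewrite !Sym_gactMr.
- move=> [u v] /=; rewrite -[pres_gen _ _]/(Sym_gen u v) !Sym_actE.
  by congr (pres_gen _ (_, _)); apply/val_inj/ractM.
Qed.
HB.instance Definition _ := isGammaGroup.Build Gamma (Sym R)
  Sym_gact1 Sym_gactM Sym_gactMr.

End UnitRing.

End GammaInstances.

Section GammaHomTheory.
Variables (Gamma : groupType) (G H : gammaGroupType Gamma) (f : gammaHom G H).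

Fact kernel_gact (g : Gamma) (x : G) : x \in kernel f -> gact g x \in kernel f.
Proof.
by rewrite !inE => /eqP fx; apply/eqP; rewrite [LHS]gact_hom [f x]fx hom1.
Qed.
HB.instance Definition _ :=
  isGammaClosed.Build Gamma G (kernel f) kernel_gact.

Fact GammaSub_hom x : x \in GammaSub G -> f x \in GammaSub H.
Proof.
move=> /normal_closureP /(_ (preimgrp f (GammaSub H))) Hx.
rewrite -(in_preimgrp f); apply: Hx => _ [g [y ->]] /=.
rewrite in_preimgrp gmulfM homV; apply: sub_normal_closure; exists g, (f y).
by congr (_ * _); apply: gact_hom.
Qed.

Definition GammaSub_map (x : subgrp (GammaSub G)) : subgrp (GammaSub H) :=
  Subgrp (GammaSub_hom (subgrp_valP x)).

Fact GammaSub_mapM : {morph GammaSub_map : x y / x * y}.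
Proof. by move=> x y; apply/val_inj; rewrite /= gmulfM. Qed.
HB.instance Definition _ := isMultiplicative.Build
  (subgrp (GammaSub G)) (subgrp (GammaSub H)) GammaSub_map GammaSub_mapM.

Definition coinv_map (q : coinv G) : coinv H := quot (GammaSub H) (f (repr q)).

Lemma coinv_mapE x : coinv_map (quot (GammaSub G) x) = quot (GammaSub H) (f x).
Proof.
by apply/quotP; rewrite -homV -gmulfM; apply/GammaSub_hom/quot_reprP.
Qed.

Fact coinv_mapM : {morph coinv_map : x y / x * y}.
Proof.
move=> x y; rewrite -[x]quotK -[y]quotK -quotM !coinv_mapE gmulfM.
exact: quotM.
Qed.
HB.instance Definition _ :=
  isMultiplicative.Build (coinv G) (coinv H) coinv_map coinv_mapM.

(* [Gamma Ker f], a set of elements of [Ker f], seen inside [Ker (Gamma f)];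
   both consist of elements of [G]. *)
Definition GammaKer : {pred subgrp (kernel GammaSub_map)} :=
  [pred x | `[< exists2 k : subgrp (kernel f),
                  k \in GammaSub (subgrp (kernel f)) &
                  val k = val (val x) >]].

Lemma GammaKerP x : reflect
  (exists2 k : subgrp (kernel f),
     k \in GammaSub (subgrp (kernel f)) & val k = val (val x))
  (x \in GammaKer).
Proof. by rewrite inE; apply: asboolP. Qed.

Fact GammaKer1 : 1 \in GammaKer.
Proof. by apply/GammaKerP; exists 1; first exact: gpred1. Qed.
Fact GammaKerM : mulg_closed GammaKer.
Proof.
move=> x y /GammaKerP[k Nk kx] /GammaKerP[l Nl ly]; apply/GammaKerP.
by exists (k * l); [exact: gpredM | exact: (congr2 *%g kx ly)].
Qed.
Fact GammaKerV : invg_closed GammaKer.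
Proof.
move=> x /GammaKerP[k Nk kx]; apply/GammaKerP.
by exists k^-1; [exact: gpredVr | rewrite !subgrp_valV kx].
Qed.
Fact GammaKerJ x y : x \in GammaKer -> x ^ y \in GammaKer.
Proof.
move=> /GammaKerP[k Nk kx]; apply/GammaKerP.
have fy : val (val y) \in kernel f.
  by have := subgrp_valP y; rewrite !inE => /eqP/(congr1 val) /= ->.
exists (k ^ Subgrp fy); first exact: gpredJr.
by rewrite !subgrp_valJ kx.
Qed.
HB.instance Definition _ := isMulClosed.Build _ GammaKer GammaKerM.
HB.instance Definition _ := isMul1Closed.Build _ GammaKer GammaKer1.
HB.instance Definition _ := isInvClosed.Build _ GammaKer GammaKerV.
HB.instance Definition _ := isConjClosed.Build _ GammaKer GammaKerJ.

End GammaHomTheory.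

Arguments phi R q : clear implicits.
Arguments GammaSub_map {Gamma G H} f x.
Arguments coinv_map {Gamma G H} f q.
Arguments GammaKer {Gamma G H} f.

Definition K2Gamma (Gamma : groupType) (R : gammaNzRingType Gamma) :=
  subgrp (kernel (coinv_map (phi R))).
HB.instance Definition _ (Gamma : groupType) (R : gammaNzRingType Gamma) :=
  Group.on (K2Gamma R).

Definition SymGamma (Gamma : groupType) (R : gammaUnitRingType Gamma) :=
  coinv (Sym R).
HB.instance Definition _ (Gamma : groupType) (R : gammaUnitRingType Gamma) :=
  Group.on (SymGamma R).

(* [Ker (Gamma f) / Gamma (Ker f)] *)
Definition KerGamma_quotient (Gamma : groupType) (G H : gammaGroupType Gamma)
  (f : gammaHom G H) := quotient (GammaKer f).
HB.instance Definition _ (Gamma : groupType) (G H : gammaGroupType Gamma)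
  (f : gammaHom G H) := Group.on (KerGamma_quotient f).

(* Exactness of [0 -> A -> B -> C -> 0]. *)
Definition short_exact (A B C : groupType)
    (i : {multiplicative A -> B}) (p : {multiplicative B -> C}) : Prop :=
  [/\ injective i,
      (forall b, b \in kernel p <-> exists a, i a = b)
    & forall c, exists b, p b = c].

(* Main.v *)
(* By Matsumoto's theorem <u,v> |-> [h_12(u), h_13(v)] identifies Sym(F) with
   Ker(phi), compatibly with Gamma.  The exact sequence
   1 -> Sym(F) -> St(F) -> E(F) -> 1 of Gamma-groups then gives the result: the
   kernel of Sym(F)_Gamma -> St(F)_Gamma is the image of Ker(phi) meet
   Gamma St(F), which is Ker Gamma(phi), and since Gamma E(F) is the image of
   Gamma St(F), every element of Ker(phi_Gamma) comes from Ker(phi).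

   In Matsumoto's theorem, Bruhat decomposition shows that Ker(phi) consists of
   symbols.  For injectivity one builds, for every bimultiplicative
   c : F^* x F^* -> A with c(u,1-u) = 0, a central extension of E(F) by A in
   which the commutators of lifted diagonal matrices are given by c, and maps
   St(F) to it by universality; then takes A = Sym(F).  The extension is
   realised by permutations of E(F) x A lifting the left translations of E(F):
   they are the ones commuting with suitable lifts of the right translations by
   x_ij(a), i < j, and by w_i = w_(i,i+1)(1).  The kernel is central because
   these right translations generate a transitive group. *)
Require Import Defs.
From HB Require Import structures.
From mathcomp Require Import all_boot all_algebra.
From mathcomp Require Import boolp classical_sets.
From mathcomp Require Import ring zify.

Set Implicit Arguments.
Unset Strict Implicit.
Unset Printing Implicit Defensive.

Import GRing.Theory.

Local Open Scope group_scope.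

(** * Commutators and generation *)

(** Defining the extension as a commutant spares every check of relations among lifted generators:
    it is a group by construction, and only a lift of each left translation has to be exhibited. The
    relations of the Steinberg group then come from universality, which asks only for surjectivity
    and a central kernel. What remains is a left operator for each w_i that commutes with the right
    operators ([commutation]). It is written in terms of a Bruhat decomposition g = p n q, using
    only what g determines: the permutation, the diagonal entries of n corrected by the sign of a
    canonical lift of the permutation, and one superdiagonal entry of p or q, which is well defined
    exactly where the permutation inverts two neighbours. If w_i n and n w_j permute differently,
    commutation amounts to following how diagonal entries are moved and rescaled. If they permute
    alike, it is a computation in SL_2, and there c(u,1-u) = 0 enters beyond its consequence that c
    is skew-symmetric. *)

HB.lock Definition lconj (G : groupType) (z x : G) := z * x * z^-1.
HB.lock Definition lcomm (G : groupType) (x y : G) := x * y * x^-1 * y^-1.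

Section Commutators.
Variable G : groupType.
Implicit Types x y z : G.

Lemma lconjE z x : lconj z x = z * x * z^-1.
Proof. by rewrite unlock. Qed.

Lemma lconj1 z : lconj z 1 = 1.
Proof. by rewrite lconjE mulg1 mulgV. Qed.

Lemma lconj1g x : lconj 1 x = x.
Proof. by rewrite lconjE invg1 mulg1 mul1g. Qed.

Lemma lconjM z : {morph lconj z : x y / x * y}.
Proof. by move=> x y; rewrite !lconjE !mulgA mulgVK. Qed.

Lemma lconjV z : {morph lconj z : x / x^-1}.
Proof. by move=> x; rewrite !lconjE !invgM invgK mulgA. Qed.

Lemma lconjMl x y z : lconj (x * y) z = lconj x (lconj y z).
Proof. by rewrite !lconjE invgM !mulgA. Qed.

Lemma lconjK z : cancel (lconj z) (lconj z^-1).
Proof. by move=> x; rewrite -lconjMl mulVg lconj1g. Qed.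

Lemma lconjVK z : cancel (lconj z^-1) (lconj z).
Proof. by move=> x; rewrite -[X in lconj X _]invgK lconjK. Qed.

Lemma mulg_lconj z x : z * x = lconj z x * z.
Proof. by rewrite lconjE mulgVK. Qed.

Lemma mulg_lconjV z x : x * z = z * lconj z^-1 x.
Proof. by rewrite lconjE invgK !mulgA mulgV mul1g. Qed.

Lemma lconj_fix z x : lconj z x = x <-> commute z x.
Proof.
rewrite lconjE /commute; split=> [e|->]; last by rewrite mulgK.
by rewrite -[in RHS]e mulgVK.
Qed.

Lemma lcommE x y : lcomm x y = lconj x y * y^-1.
Proof. by rewrite lconjE unlock. Qed.

Lemma lconj_lcomm z x y : lconj z (lcomm x y) = lcomm (lconj z x) (lconj z y).
Proof. by rewrite lcomm.unlock !lconjM !lconjV. Qed.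

Lemma lcommV x y : (lcomm x y)^-1 = lcomm y x.
Proof. by rewrite unlock !invgM !invgK !mulgA. Qed.

Lemma lcomm_eq1 x y : lcomm x y = 1 <-> commute x y.
Proof.
rewrite lcommE -lconj_fix; split=> [e|->]; last by rewrite mulgV.
by rewrite -[RHS]mul1g -e mulgVK.
Qed.

Lemma lcommMl x y z : lcomm (x * y) z = lconj x (lcomm y z) * lcomm x z.
Proof. by rewrite unlock lconjE !invgM !mulgA !mulgVK. Qed.

Lemma commute_lcomm x y z : commute z x -> commute z y -> commute z (lcomm x y).
Proof.
by move=> zx zy; rewrite unlock; do !apply: commuteM => //; apply: commuteV.
Qed.

End Commutators.

Lemma gmulf_lconj (G H : groupType) (f : {multiplicative G -> H}) x y :
  f (lconj x y) = lconj (f x) (f y).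
Proof. by rewrite !lconjE !gmulfM homV. Qed.

Lemma gmulf_lcomm (G H : groupType) (f : {multiplicative G -> H}) x y :
  f (lcomm x y) = lcomm (f x) (f y).
Proof. by rewrite lcomm.unlock !gmulfM !homV. Qed.

Section CentralKernel.
Variables (G H : groupType) (f : {multiplicative G -> H}).
Hypothesis fC : forall z y, f z = 1 -> commute z y.

Lemma central_div z y : f z = f y -> forall w, commute (z^-1 * y) w.
Proof. by move=> zy w; apply: fC; rewrite gmulfM homV zy mulVg. Qed.

(** A symbol may thus be evaluated on any convenient lifts; the bimultiplicativity of symbols and
    the universality argument both rest on this. *)
Lemma central_lcomm z y z' y' : f z = f z' -> f y = f y' ->
  lcomm z y = lcomm z' y'.
Proof.
have E (w w' x : G) : f w = f w' -> lcomm w x = lcomm w' x.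
  move=> /central_div/(_ x)/lcomm_eq1 e.
  by rewrite -[in RHS](mulVKg w w') lcommMl e lconj1 mul1g.
by move=> zz' yy'; rewrite (E _ _ _ zz') -[LHS]invgK lcommV (E _ _ _ yy') lcommV.
Qed.

End CentralKernel.

Section GeneratedInduction.
Variables (G : groupType) (A : set G) (P : G -> Prop).
Hypothesis AV : forall x, A x -> A x^-1.
Hypothesis PM : forall a x, A a -> P x -> P (a * x).

(** [generated] is an intersection of subgroups, so there are no words to induct on. The condition
    is an equivalence, not an implication, in order that inverses stay in the set. *)
Let stab : {pred G} := [pred x | `[< forall y, P y <-> P (x * y) >]].

Let stabP x : reflect (forall y, P y <-> P (x * y)) (x \in stab).
Proof. by rewrite inE; apply: asboolP. Qed.

Let stabM : mulg_closed stab.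
Proof.
move=> x y /stabP Px /stabP Py; apply/stabP => z; rewrite -mulgA.
by have [? ?] := Py z; have [? ?] := Px (y * z); split; auto.
Qed.
Let stab1 : 1 \in stab.
Proof. by apply/stabP => y; rewrite mul1g. Qed.
Let stabV : invg_closed stab.
Proof.
move=> x /stabP Px; apply/stabP => y.
by have := Px (x^-1 * y); rewrite mulVKg => -[? ?]; split; auto.
Qed.
HB.instance Definition _ := isMulClosed.Build G stab stabM.
HB.instance Definition _ := isMul1Closed.Build G stab stab1.
HB.instance Definition _ := isInvClosed.Build G stab stabV.

Lemma generated_act x y : x \in generated A -> P y -> P (x * y).
Proof.
move=> /generatedP/(_ stab) Hx; have /stabP/(_ y) []// : x \in stab.
apply: Hx => a Aa /=; apply/stabP => z; split; first exact: PM.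
by move=> /(PM (AV Aa)); rewrite mulKg.
Qed.

Lemma generated_ind x : P 1 -> x \in generated A -> P x.
Proof. by move=> P1 Ax; rewrite -[x]mulg1; apply: generated_act. Qed.

End GeneratedInduction.

Lemma generated_sub (G : groupType) (A : set G) (H : groupClosed G) :
  (forall x, A x -> x \in H) -> {subset generated A <= H}.
Proof. by move=> AH x /generatedP; apply. Qed.

Section SteinbergGenerators.
Variable R : nzRingType.
(* The total function extending the generators [x_ij(a)] by [1] for [i = j]. *)
Definition stX (i j : nat) (a : R) : St R :=
  match @idP (i != j) with
  | ReflectT ij => St_gen ij a
  | ReflectF _ => 1
  end.

Lemma stXE i j (ij : i != j) a : stX i j a = St_gen ij a.
Proof.
rewrite /stX; case: {-}_ / idP => [ij'|//].
by rewrite (bool_irrelevance ij' ij).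
Qed.

Lemma pres_comm (Y : choiceType) (r : word Y -> word Y -> Prop) u v :
  pres r (word_comm u v) = lcomm (pres r u) (pres r v).
Proof.
rewrite /word_comm !presM unlock !mulgA.
by congr (_ * _ * _ * _); rewrite [RHS]pres_invE.
Qed.

Lemma stXD i j a b : i != j -> stX i j (a + b)%R = stX i j a * stX i j b.
Proof.
move=> ij; rewrite !(stXE ij) -presM; apply/esym/presP/word_cong_rel.
exact: St_relD.
Qed.

Lemma stXC i j k l a b : i != j -> k != l -> i != l -> k != j ->
  commute (stX i j a) (stX k l b).
Proof.
move=> ij kl il kj; rewrite (stXE ij) (stXE kl); apply/lcomm_eq1.
rewrite -pres_comm; apply/presP/word_cong_rel; exact: St_relC.
Qed.

Lemma stXM i j k a b : i != j -> j != k -> i != k ->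
  lcomm (stX i j a) (stX j k b) = stX i k (a * b)%R.
Proof.
move=> ij jk ik; rewrite (stXE ij) (stXE jk) (stXE ik) -pres_comm.
by apply/presP/word_cong_rel; apply: St_relM.
Qed.

Lemma stX0 i j : i != j -> stX i j 0%R = 1.
Proof.
move=> ij; apply: (mulgI (stX i j 0%R)).
by rewrite mulg1 -stXD // addr0.
Qed.

Lemma stXN i j a : i != j -> stX i j (- a)%R = (stX i j a)^-1.
Proof.
move=> ij; apply: (mulgI (stX i j a)).
by rewrite mulgV -stXD // subrr stX0.
Qed.

Lemma St_gen_ind (P : St R -> Prop) : P 1 ->
  (forall i j a x, i != j -> P x -> P (stX i j a * x)) -> forall x, P x.
Proof.
move=> P1 PX x; rewrite -[x]presK; elim: (repr x) => [|[[[[i j] /= ij] a] e] w IHw].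
  exact: P1.
rewrite -cat1s presM; case: e.
  by have := PX _ _ a _ ij IHw; rewrite (stXE ij).
have := PX _ _ (- a)%R _ ij IHw; rewrite stXN // (stXE ij).
by congr (P (_ * _)); rewrite [LHS]pres_invE.
Qed.

Lemma phi_stXE i j (a : R) k l : i != j ->
  GLmx (val (phi R (stX i j a))) k l = ((k == l)%:R + a *+ ((k == i) && (l == j)))%R.
Proof. by move=> ij; rewrite (stXE ij) phi_St_gen. Qed.

Definition Emx (g : E R) := GLmx (val g).

Lemma Emx_finitary (g : E R) : finitary (Emx g).
Proof. exact: GL_finitary. Qed.

Lemma EmxM (g h : E R) : Emx (g * h) = infmx_mul (Emx g) (Emx h).
Proof. by []. Qed.

Lemma Emx1 k l : Emx 1 k l = (k == l)%:R%R.
Proof. by []. Qed.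

Lemma Emx_inj : injective Emx.
Proof. by move=> g h gh; apply: E_eqP => i j; rewrite -/(Emx g) gh. Qed.

Lemma Emx_phiX i j a k l : i != j ->
  Emx (phi R (stX i j a)) k l = ((k == l)%:R + a *+ ((k == i) && (l == j)))%R.
Proof. exact: phi_stXE. Qed.

Lemma Emx_mulX (g : E R) i j a k l : i != j ->
  Emx (g * phi R (stX i j a)) k l = (Emx g k l + (Emx g k i * a) *+ (l == j))%R.
Proof. by move=> ij; rewrite (stXE ij) phi_St_gen; apply: E_mul_elem. Qed.

Lemma infmx_elem_mul (M : infmx R) i j a k l : i != j ->
  infmx_mul (infmx_elem i j a) M k l = (M k l + (a * M j l) *+ (k == i))%R.
Proof.
move=> ij; have tE : stably_trivial (maxn i.+1 j.+1) (infmx_elem i j a).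
  move=> p q; rewrite !geq_max /infmx_elem.
  case: (p =P i) => [->|_]; case: (q =P j) => [->|_] /=; rewrite ?addr0 //.
  by rewrite ltnn /= ltnn andbF.
set m := maxn (maxn i.+1 j.+1) k.+1.
have [nm km jm] : [/\ maxn i.+1 j.+1 <= m, k < m & j < m].
  by split; rewrite /m ?leq_maxl ?leq_maxr // !leq_max ltnSn orbT.
rewrite (infmx_mulE _ _ tE nm km) /infmx_elem.
under eq_bigr => p _ do rewrite mulrDl.
rewrite big_split /= (sum_delta_l (fun p => M p l)) //; congr (_ + _)%R.
case: (k == i); last by rewrite [RHS]mulr0n; apply: big1 => p _; rewrite mulr0n mul0r.
rewrite mulr1n (bigD1 (Ordinal jm)) //= eqxx mulr1n big1 ?addr0 // => p pj.
by rewrite -val_eqE /= in pj; rewrite (negPf pj) mulr0n mul0r.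
Qed.

Lemma Emx_Xmul (g : E R) i j a k l : i != j ->
  Emx (phi R (stX i j a) * g) k l = (Emx g k l + (a * Emx g j l) *+ (k == i))%R.
Proof. by move=> ij; rewrite (stXE ij) phi_St_gen; apply: infmx_elem_mul. Qed.

Lemma phi_surj (g : E R) : exists x, phi R x = g.
Proof.
have aux (y : GL R) : y \in generated (@elementary R) ->
    exists x, val (phi R x) = y.
  move=> gy; apply: (generated_ind (P := fun y => exists x, val (phi R x) = y) _ _ _ gy).
  - move=> _ [i [j [ij [a ->]]]]; exists i, j, ij, (- a)%R.
    have := congr1 (phi R) (stXN a ij).
    rewrite homV /= !(stXE ij) (phi_St_gen ij a) phi_St_gen => /(congr1 val).
    by rewrite subgrp_valV => <-.
  - move=> _ y0 [i [j [ij [a ->]]]] [x <-].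
    by exists (stX i j a * x); rewrite gmulfM /= (stXE ij) phi_St_gen.
  - by exists 1; rewrite hom1.
by have [x xg] := aux _ (subgrp_valP g); exists x; apply: val_inj.
Qed.

End SteinbergGenerators.

(** * Monomial elements of the Steinberg group *)

Section MatrixProducts.
Variable R : nzRingType.
Local Open Scope ring_scope.

Lemma infmx_mul_row (M N : infmx R) d q m k : finitary M ->
  (forall p, M m p = d *+ (p == q)) -> infmx_mul M N m k = d * N q k.
Proof.
move=> [n Mn] Mm; set r := maxn n (maxn m q).+1.
have [nr mr qr] : [/\ n <= r, m < r & q < r]%N.
  by split; rewrite /r ?leq_maxl // !leq_max ltnS leq_max leqnn ?orbT.
rewrite (infmx_mulE _ _ Mn nr mr) (bigD1 (Ordinal qr)) //= Mm eqxx mulr1n.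
rewrite big1 ?addr0 // => p pq; rewrite -val_eqE /= in pq.
by rewrite Mm (negPf pq) mulr0n mul0r.
Qed.

Lemma infmx_mul_col (M N : infmx R) e q m k : finitary M ->
  (forall p, N p k = e *+ (p == q)) -> infmx_mul M N m k = M m q * e.
Proof.
move=> [n Mn] Nk; set r := maxn n (maxn m q).+1.
have [nr mr qr] : [/\ n <= r, m < r & q < r]%N.
  by split; rewrite /r ?leq_maxl // !leq_max ltnS leq_max leqnn ?orbT.
rewrite (infmx_mulE _ _ Mn nr mr) (bigD1 (Ordinal qr)) //= Nk eqxx mulr1n.
rewrite big1 ?addr0 // => p pq; rewrite -val_eqE /= in pq.
by rewrite Nk (negPf pq) mulr0n mulr0.
Qed.

End MatrixProducts.

Section SteinbergConjugation.
Variable R : nzRingType.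
Implicit Types a b : R.

Lemma lconj_stX_id i j k l a b : i != j -> k != l -> i != l -> k != j ->
  lconj (stX i j a) (stX k l b) = stX k l b.
Proof. by move=> ij kl il kj; apply/lconj_fix/stXC. Qed.

Lemma lconj_stXl i j k a b : i != j -> j != k -> i != k ->
  lconj (stX i j a) (stX j k b) = stX i k (a * b)%R * stX j k b.
Proof. by move=> ij jk ik; rewrite -(stXM a b ij jk ik) lcommE mulgVK. Qed.

Lemma lconj_stXr i j k a b : i != j -> k != i -> k != j ->
  lconj (stX i j a) (stX k i b) = stX k j (- (b * a))%R * stX k i b.
Proof.
move=> ij ki kj; rewrite stXN // -(stXM b a ki ij kj) lcommV lcommE.
by rewrite mulgVK.
Qed.

End SteinbergConjugation.

Definition sw (i j k : nat) := if k == i then j else if k == j then i else k.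

Lemma swK i j : involutive (sw i j).
Proof.
move=> k; rewrite /sw; have [->|ki] := eqVneq k i.
  by rewrite eqxx; case: eqVneq.
have [->|kj] := eqVneq k j; first by rewrite eqxx.
by rewrite (negPf ki) (negPf kj).
Qed.

(** The classical elements w_ij(u) and h_ij(u): lifts of a monomial matrix on the indices i, j, and
    of the diagonal matrix with entries u and u^-1 there ([mono_W], [mono_H]). *)
HB.lock Definition stW (F : fieldType) i j u : St F :=
  stX i j u * stX j i (- u^-1)%R * stX i j u.
HB.lock Definition stH (F : fieldType) i j u : St F :=
  stW i j u * stW i j (-1)%R.

Section Monomial.
Variable F : fieldType.
Implicit Types (u v a b : F) (i j k l m : nat) (z y : St F).

Lemma stW_def i j u : stW i j u = stX i j u * stX j i (- u^-1)%R * stX i j u.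
Proof. by rewrite unlock. Qed.
Lemma stH_def i j u : stH i j u = stW i j u * stW i j (-1)%R.
Proof. by rewrite unlock. Qed.

Lemma stWV i j u : i != j -> (stW i j u)^-1 = stW i j (- u)%R.
Proof.
move=> ij; have ji : j != i by rewrite eq_sym.
by rewrite !stW_def !invgM -!stXN // invrN !mulgA.
Qed.

(* [z] acts on the generators of the Steinberg group, and through [phi] on the
   standard basis, as the monomial matrix [e_k |-> d_k e_(s k)]. *)
Record mono z (s s' : nat -> nat) (d : nat -> F) : Prop := Mono {
  monoK : cancel s s';
  monoVK : cancel s' s;
  mono_neq0 : forall k, d k != 0%R;
  monoX : forall k l a, k != l ->
    lconj z (stX k l a) = stX (s k) (s l) (d k * a / d l)%R;
  mono_mx : forall m k, Emx (phi F z) m k = (d k *+ (m == s k))%R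
}.

Lemma mono_neq z s s' d k l : mono z s s' d -> (s k == s l) = (k == l).
Proof. by move=> Mz; apply: (inj_eq (can_inj (monoK Mz))). Qed.

Lemma mono1 : mono 1 id id (fun=> 1%R).
Proof.
split=> // [k|k l a kl|m k]; first exact: oner_neq0.
  by rewrite mul1r divr1 lconj1g.
by rewrite hom1.
Qed.

Lemma monoM z y s s' d t t' e : mono z s s' d -> mono y t t' e ->
  mono (z * y) (s \o t) (t' \o s') (fun k => e k * d (t k))%R.
Proof.
move=> Mz My; split=> [k|k|k|k l a kl|m k] /=.
- by rewrite (monoK Mz) (monoK My).
- by rewrite (monoVK My) (monoVK Mz).
- by rewrite mulf_neq0 ?(mono_neq0 Mz) ?(mono_neq0 My).
- rewrite lconjMl (monoX My) // (monoX Mz) ?(mono_neq _ _ My) //.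
  by congr stX; field; rewrite ?(mono_neq0 Mz) ?(mono_neq0 My).
- rewrite gmulfM EmxM (@infmx_mul_col _ _ _ (e k) (t k)).
  + by rewrite (mono_mx Mz) mulrnAl mulrC.
  + exact: Emx_finitary.
  + by move=> p; rewrite (mono_mx My).
Qed.

Lemma monoV z s s' d : mono z s s' d -> mono z^-1 s' s (fun k => (d (s' k))^-1)%R.
Proof.
move=> Mz; split=> [k|k|k|k l a kl|m k].
- exact: (monoVK Mz).
- exact: (monoK Mz).
- by rewrite invr_neq0 ?(mono_neq0 Mz).
- have kl' : s' k != s' l by rewrite (inj_eq (can_inj (monoVK Mz))).
  apply: (can_inj (lconjK z)); rewrite lconjVK (monoX Mz) // !(monoVK Mz).
  by congr stX; field; rewrite ?(mono_neq0 Mz) ?oner_neq0.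
- have := congr1 (fun x => Emx (phi F x) m (s' k)) (mulVg z).
  rewrite /= gmulfM EmxM (@infmx_mul_col _ _ _ (d (s' k)) k).
  + rewrite hom1 Emx1 => e.
    apply: (mulIf (mono_neq0 Mz (s' k))); rewrite [LHS]e mulrnAl mulVf //.
    exact: (mono_neq0 Mz).
  + exact: Emx_finitary.
  + by move=> p; rewrite (mono_mx Mz) (monoVK Mz).
Qed.

Section Weyl.
Variables (i j : nat) (u : F).
Hypotheses (ij : i != j) (u0 : u != 0%R).
Let ji : j != i. Proof. by rewrite eq_sym. Qed.

Lemma lconjW_il l a : l != i -> l != j ->
  lconj (stW i j u) (stX i l a) = stX j l (- u^-1 * a)%R.
Proof.
move=> li lj; have [il jl] : i != l /\ j != l by rewrite (eq_sym i) (eq_sym j).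
rewrite stW_def !lconjMl (@lconj_stX_id _ i j i l) // (@lconj_stXl _ j i l) //.
rewrite lconjM (@lconj_stXl _ i j l) // (@lconj_stX_id _ i j i l) //.
rewrite (_ : u * _ = - a)%R; last by field.
by rewrite stXN // -mulgA (stXC _ _ jl il jl il) mulKg.
Qed.

Lemma lconjW_jl l a : l != i -> l != j ->
  lconj (stW i j u) (stX j l a) = stX i l (u * a)%R.
Proof.
move=> li lj; have [il jl] : i != l /\ j != l by rewrite (eq_sym i) (eq_sym j).
rewrite stW_def !lconjMl (@lconj_stXl _ i j l) // lconjM (@lconj_stXl _ j i l) //.
rewrite (@lconj_stX_id _ j i j l) // (_ : - u^-1 * _ = - a)%R; last by field.
by rewrite stXN // -mulgA (stXC _ _ il jl il jl) mulKg lconj_stX_id.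
Qed.

Lemma lconjW_ki k a : k != i -> k != j ->
  lconj (stW i j u) (stX k i a) = stX k j (- (a * u))%R.
Proof.
move=> ki kj; rewrite stW_def !lconjMl (@lconj_stXr _ i j k) // lconjM.
rewrite (@lconj_stXr _ j i k) // (@lconj_stX_id _ j i k i) //.
rewrite (_ : - (- (a * u) * - u^-1) = - a)%R; last by field.
have C b := stXC b a kj ki ki kj.
by rewrite (stXN a) // -mulgA C mulKg lconj_stX_id.
Qed.

Lemma lconjW_kj k a : k != i -> k != j ->
  lconj (stW i j u) (stX k j a) = stX k i (a * u^-1)%R.
Proof.
move=> ki kj; rewrite stW_def !lconjMl (@lconj_stX_id _ i j k j) //.
rewrite (@lconj_stXr _ j i k) // lconjM (@lconj_stXr _ i j k) //.
rewrite (@lconj_stX_id _ i j k j) // (_ : - (- (a * - u^-1) * u) = - a)%R; last by field.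
rewrite (stXN a) // -mulgA (stXC _ _ ki kj kj ki) mulKg.
by congr stX; ring.
Qed.

(** No defining relation compares x_ij with x_ji. A third index k gives x_ij(a) =
    [x_ik(a), x_kj(1)], and [stW i j u] acts on both factors by the preceding rules. *)
Lemma lconjW_ij a : lconj (stW i j u) (stX i j a) = stX j i (- (a * u^-1 * u^-1))%R.
Proof.
pose k := (i + j).+1.
have [ki kj] : k != i /\ k != j by rewrite /k; split; lia.
have [ik jk] : i != k /\ j != k by rewrite (eq_sym i) (eq_sym j).
rewrite -[a]mulr1 -(stXM a 1%R ik kj ij) lconj_lcomm lconjW_il // lconjW_kj //.
by rewrite stXM //; congr stX; ring.
Qed.

Lemma lconjW_ji a : lconj (stW i j u) (stX j i a) = stX i j (- (u * a * u))%R.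
Proof.
pose k := (i + j).+1.
have [ki kj] : k != i /\ k != j by rewrite /k; split; lia.
have [ik jk] : i != k /\ j != k by rewrite (eq_sym i) (eq_sym j).
rewrite -[a]mulr1 -(stXM a 1%R jk ki ji) lconj_lcomm lconjW_jl // lconjW_ki //.
by rewrite stXM //; congr stX; ring.
Qed.

Definition wd k : F := if k == i then (- u^-1)%R else if k == j then u else 1%R.

Lemma Emx_W m k : Emx (phi F (stW i j u)) m k = (wd k *+ (m == sw i j k))%R.
Proof.
rewrite stW_def gmulfM /= Emx_mulX // gmulfM /= !Emx_mulX // !Emx_phiX // /wd /sw.
rewrite !eqxx (negPf ij) !andbF !andbT !mulr0n !addr0 !mulr1n.
have [->|ki] := eqVneq k i.
  rewrite (negPf ij) andbF !mulr0n !addr0 mulr1n.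
  have [->|mi] := eqVneq m i; last by rewrite mulr0n; case: (m == j) => /=; field.
  by rewrite (negPf ij) /= mulr0n; field.
have [->|kj] := eqVneq k j; last by rewrite andbF !mulr0n !addr0.
rewrite !andbT !mulr0n !addr0 !mulr1n.
have [->|mi] := eqVneq m i; last by case: (m == j) => /=; field.
by rewrite (negPf ij) /= mulr1n; field.
Qed.

Lemma mono_W : mono (stW i j u) (sw i j) (sw i j) wd.
Proof.
split; [exact: swK|exact: swK| | |exact: Emx_W].
  move=> k; rewrite /wd; case: ifP => _; first by rewrite oppr_eq0 invr_eq0.
  by case: ifP => _ //; apply: oner_neq0.
move=> k l a; rewrite /wd /sw.
have [->|ki] := eqVneq k i; have [->|li] := eqVneq l i => //.
- rewrite eq_sym; have [->|lj] := eqVneq l j => _ //; last first.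
    by rewrite lconjW_il // divr1.
  by rewrite lconjW_ij; congr stX; field.
- have [->|kj] := eqVneq k j => _ //; last first.
    by rewrite lconjW_ki // mul1r invrN invrK mulrN.
  by rewrite lconjW_ji invrN invrK mulrN.
have [->|kj] := eqVneq k j; have [->|lj] := eqVneq l j => //.
- by rewrite lconjW_jl // divr1.
- by rewrite lconjW_kj // mul1r.
move=> kl; rewrite mul1r divr1; apply/lconj_fix/commute_sym.
have C p q b : p != q -> k != q -> p != l -> commute (stX k l a) (stX p q b).
  by move=> pq kq pl; apply: stXC.
by rewrite stW_def; do !apply: commuteM; apply: C; rewrite // eq_sym.
Qed.

End Weyl.

Lemma mono_conjW z s s' d k l v : mono z s s' d -> k != l ->
  lconj z (stW k l v) = stW (s k) (s l) (d k * v / d l)%R.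
Proof.
move=> Mz kl; have lk : l != k by rewrite eq_sym.
rewrite !stW_def !lconjM !(monoX Mz) //; congr (_ * stX _ _ _ * _).
(* The convention [0^-1 = 0] makes both sides vanish. *)
have [->|v0] := eqVneq v 0%R; first by rewrite mulr0 mul0r invr0 oppr0 mulr0 mul0r.
by field; rewrite v0 !(mono_neq0 Mz).
Qed.

(** Conjugating w_ij(u) by itself changes nothing, while the monomial rule exchanges its indices and
    rescales its argument. *)
Lemma stW_sym i j u : i != j -> u != 0%R -> stW i j u = stW j i (- u^-1)%R.
Proof.
move=> ij u0; have := mono_conjW u (mono_W ij u0) ij.
rewrite lconjE mulgK => {1}->; rewrite /sw /wd !eqxx eq_sym (negPf ij).
by congr stW; field.
Qed.

Definition hd i j u k : F := if k == i then u else if k == j then (u^-1)%R else 1%R.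

Lemma eq_mono z s s' d t t' e : mono z s s' d -> s =1 t -> s' =1 t' -> d =1 e ->
  mono z t t' e.
Proof.
by move=> Mz /funext <- /funext <- /funext <-.
Qed.

Lemma mono_H i j u : i != j -> u != 0%R -> mono (stH i j u) id id (hd i j u).
Proof.
move=> ij u0; have n10 : (-1 : F)%R != 0%R by rewrite oppr_eq0 oner_eq0.
rewrite stH_def; apply: (eq_mono (monoM (mono_W ij u0) (mono_W ij n10))) => k;
  try exact: (swK i j k).
 rewrite /wd /hd /sw; have [_|ki] := eqVneq k i.
  by rewrite eqxx eq_sym (negPf ij) invrN invr1 opprK mul1r.
have [_|kj] := eqVneq k j; first by rewrite eqxx mulN1r opprK.
by rewrite (negPf ki) (negPf kj) mulr1.
Qed.

Lemma stWE i j u : i != j -> stW i j u = stH i j u * stW i j 1%R.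
Proof. by move=> ij; rewrite stH_def -stWV // mulgVK. Qed.

Lemma stH1 i j : i != j -> stH i j (1 : F)%R = 1.
Proof. by move=> ij; rewrite stH_def -stWV // mulgV. Qed.

(** The factor w_kl(-1) inside [stH k l v] is rescaled along with w_kl(v), and restoring it costs
    the second factor. [symE] turns this defect into a formula for the symbol. *)
Lemma mono_conjH z s s' d k l v : mono z s s' d -> k != l ->
  lconj z (stH k l v) =
    stH (s k) (s l) (d k * v / d l)%R * (stH (s k) (s l) (d k / d l)%R)^-1.
Proof.
move=> Mz kl; have skl : s k != s l by rewrite (mono_neq _ _ Mz).
rewrite stH_def lconjM !(mono_conjW _ Mz) // mulrN1 mulNr -(stWV (d k / d l)%R) // !stH_def invgM.
by rewrite mulgA mulgK.
Qed.

End Monomial.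

(** * The kernel of phi is central *)

Lemma generatedS (G : groupType) (A B : set G) : (forall x, A x -> B x) ->
  {subset generated A <= generated B}.
Proof. by move=> AB; apply: generated_sub => x /AB; apply: sub_generated. Qed.

(** Reduces an infinitely generated group to its finite-rank pieces, on which induction on the rank
    is possible. *)
Lemma generated_bigcup (G : groupType) (A : set G) (B : nat -> set G) :
  (forall x, A x -> A x^-1) -> (forall x, A x -> exists N, B N x) ->
  (forall M N x, (M <= N)%N -> B M x -> B N x) ->
  forall x, x \in generated A -> exists N, x \in generated (B N).
Proof.
move=> AV AB Bmono x Ax.
apply: (generated_ind (P := fun x => exists N, x \in generated (B N)) AV _ _ Ax).
  move=> a y /AB[M aM] [N yN]; exists (maxn M N); apply: gpredM.
    by apply/sub_generated/(Bmono M); rewrite ?leq_maxl.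
  by apply: generatedS yN => z; apply: Bmono; rewrite leq_maxr.
by exists 0%N; apply: gpred1.
Qed.

(** * Products over commuting root subgroups *)

Section CommutingFamily.
Variables (R : nzRingType) (G : groupType) (x : nat -> R -> G) (m : nat).
Hypothesis x0 : forall k, (k < m)%N -> x k 0%R = 1.
Hypothesis xD : forall k a b, (k < m)%N -> x k (a + b)%R = x k a * x k b.
Hypothesis xC : forall k l a b, (k < m)%N -> (l < m)%N -> commute (x k a) (x l b).

Definition famprod (n : nat) (a : nat -> R) := \prod_(0 <= k < n) x k (a k).

Lemma famprodS n a : famprod n.+1 a = famprod n a * x n (a n).
Proof. by rewrite /famprod big_nat_recr. Qed.

Lemma eq_famprod n a b : (forall k, (k < n)%N -> a k = b k) ->
  famprod n a = famprod n b.
Proof. by move=> ab; apply: eq_big_nat => k /ab ->. Qed.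

Lemma famprod0 n a : (n <= m)%N -> (forall k, (k < n)%N -> a k = 0%R) ->
  famprod n a = 1.
Proof.
move=> nm a0; rewrite /famprod big_nat big1 // => k kn.
by rewrite a0 // x0 // (leq_trans _ nm).
Qed.

Lemma famprodC n a k c : (k < m)%N -> (n <= m)%N ->
  commute (x k c) (famprod n a).
Proof.
move=> km; elim: n => [|n IHn] nm.
  by rewrite /famprod big_geq //; apply: commute1.
by rewrite famprodS; apply: commuteM; [apply/IHn/ltnW|apply: xC].
Qed.

Lemma famprod_mulX n a k c : (k < n)%N -> (n <= m)%N ->
  x k c * famprod n a = famprod n (fun l => a l + c *+ (l == k))%R.
Proof.
elim: n => // n IHn; rewrite ltnS leq_eqVlt !famprodS => /orP[/eqP ->|kn] nm.
  rewrite eqxx mulr1n xD // mulgA.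
  rewrite (famprodC a c nm (ltnW nm)) -[LHS]mulgA (xC _ _ nm nm).
  congr (_ * _); apply: eq_famprod => l ln.
  by rewrite (ltn_eqF ln) mulr0n addr0.
by rewrite mulgA IHn ?(ltnW nm) // (gtn_eqF kn) mulr0n addr0.
Qed.

Definition fam : {pred G} := [pred y | `[< exists a, y = famprod m a >]].

Lemma famP y : reflect (exists a, y = famprod m a) (y \in fam).
Proof. by rewrite inE; apply: asboolP. Qed.

Lemma fam1 : 1 \in fam.
Proof. by apply/famP; exists (fun=> 0%R); rewrite famprod0. Qed.

Lemma fam_mulX k c y : (k < m)%N -> y \in fam -> x k c * y \in fam.
Proof.
move=> km /famP[a ->]; apply/famP.
by exists (fun l => a l + c *+ (l == k))%R; rewrite famprod_mulX.
Qed.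

Lemma fam_lconj z :
  (forall k c y, (k < m)%N -> y \in fam -> lconj z (x k c) * y \in fam) ->
  forall y, y \in fam -> lconj z y \in fam.
Proof.
move=> zx _ /famP[a ->].
have H n y : (n <= m)%N -> y \in fam -> lconj z (famprod n a) * y \in fam.
  elim: n y => [|n IHn] y nm Hy; first by rewrite /famprod big_geq // lconj1 mul1g.
  rewrite famprodS lconjM -mulgA; apply: IHn; first exact: ltnW.
  exact: zx.
by rewrite -[lconj _ _]mulg1 H ?fam1.
Qed.

Section Coordinates.
Variable p : nat -> G -> R.
Hypothesis pE : forall k a, (k < m)%N -> p k (famprod m a) = a k.

Lemma fam_inj y z : y \in fam -> z \in fam ->
  (forall k, (k < m)%N -> p k y = p k z) -> y = z.
Proof.
move=> /famP[a ->] /famP[b ->] ab; apply: eq_famprod => k km.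
by rewrite -[LHS]pE // ab // pE.
Qed.

(** Conjugation by [z] keeps [x k c] inside the family and preserves its coordinates, which
    determine it. *)
Lemma fam_commute z k c : (forall y, y \in fam -> lconj z y \in fam) ->
  (forall k y, p k (lconj z y) = p k y) -> (k < m)%N -> commute z (x k c).
Proof.
move=> zfam pz km; have xfam : x k c \in fam.
  by rewrite -[x k c]mulg1; apply: fam_mulX => //; apply: fam1.
by apply/lconj_fix; apply: fam_inj => //; first exact: zfam.
Qed.

End Coordinates.
End CommutingFamily.

Section Center.
Variable R : nzRingType.
Implicit Types (a b c : R) (z : St R).

Definition stN_gen (N : nat) : set (St R) := fun z => exists i j a,
  [/\ (i < N)%N, (j < N)%N, i != j & z = stX i j a].

Definition stU_gen : set (St R) := fun z => exists i j a,
  (i < j)%N /\ z = stX i j a.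

Definition stUN_gen (N : nat) : set (St R) := fun z => exists i j a,
  [/\ (i < j)%N, (j < N)%N & z = stX i j a].

Definition stU := generated stU_gen.
HB.instance Definition _ := GroupClosed.on stU.

Lemma stN_exists z : exists N, z \in generated (stN_gen N).
Proof.
elim/St_gen_ind: z => [|i j a x ij [N xN]]; first by exists 0%N; apply: gpred1.
exists (maxn N (maxn i j).+1); apply: gpredM; last first.
  apply: generatedS xN => _ [k [l [b [kN lN kl ->]]]].
  by exists k, l, b; split; rewrite // leq_max ?kN ?lN.
apply: sub_generated; exists i, j, a; split => //.
  by rewrite !leq_max !ltnS leq_max leqnn orbT.
by rewrite !leq_max !ltnS leq_max leqnn !orbT.
Qed.

Lemma stU_exists z : z \in stU -> exists N, z \in generated (stUN_gen N).
Proof.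
apply: generated_bigcup.
- move=> _ [i [j [a [ij ->]]]]; exists i, j, (- a)%R; split=> //.
  by rewrite stXN // neq_ltn ij.
- by move=> _ [i [j [a [ij ->]]]]; exists j.+1, i, j, a.
- move=> M N _ MN [i [j [a [ij jM ->]]]]; exists i, j, a; split=> //.
  exact: leq_trans MN.
Qed.

Section Column.
Variables (n m : nat).
Hypothesis mn : (m <= n)%N.

Let x k a := stX k n a.
Let y k a := stX n k a.

Let kn k : (k < m)%N -> k != n.
Proof. by move=> km; rewrite neq_ltn (leq_trans km). Qed.
Let nk k : (k < m)%N -> n != k.
Proof. by move=> km; rewrite eq_sym kn. Qed.

Let x0 k : (k < m)%N -> x k 0%R = 1.
Proof. by move=> /kn; apply: stX0. Qed.
Let xD k a b : (k < m)%N -> x k (a + b)%R = x k a * x k b.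
Proof. by move=> /kn; apply: stXD. Qed.
Let xC k l a b : (k < m)%N -> (l < m)%N -> commute (x k a) (x l b).
Proof. by move=> /kn km /kn lm; apply: stXC. Qed.
Let y0 k : (k < m)%N -> y k 0%R = 1.
Proof. by move=> /nk; apply: stX0. Qed.
Let yD k a b : (k < m)%N -> y k (a + b)%R = y k a * y k b.
Proof. by move=> /nk; apply: stXD. Qed.
Let yC k l a b : (k < m)%N -> (l < m)%N -> commute (y k a) (y l b).
Proof. by move=> /nk km /nk lm; apply: stXC => //; rewrite eq_sym. Qed.

Definition colfam := fam x m.
Definition rowfam := fam y m.

Lemma colfam_mulX k c z : (k < m)%N -> z \in colfam -> stX k n c * z \in colfam.
Proof. exact: (fam_mulX xD xC). Qed.

Lemma colfam1 : 1 \in colfam. Proof. exact: fam1. Qed.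

Lemma phi_colprod q (a : nat -> R) k l : (q <= m)%N ->
  Emx (phi R (famprod x q a)) k l = ((k == l)%:R + a k *+ ((k < q)%N && (l == n)))%R.
Proof.
elim: q l => [|q IHq] l qm; first by rewrite /famprod big_geq // hom1 addr0.
have qm' := ltnW qm.
rewrite famprodS gmulfM /= Emx_mulX ?kn // !IHq //.
rewrite (negPf (kn qm)) andbF addr0 [(_ < q.+1)%N]ltnS (leq_eqVlt k) -addrA; congr (_ + _)%R.
have [->|kq] := eqVneq k q; first by rewrite ltnn /= add0r mul1r.
by rewrite mul0r mul0rn addr0.
Qed.

Lemma phi_rowprod q (a : nat -> R) k l : (q <= m)%N ->
  Emx (phi R (famprod y q a)) k l = ((k == l)%:R + a l *+ ((l < q)%N && (k == n)))%R.
Proof.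
elim: q k l => [|q IHq] k l qm; first by rewrite /famprod big_geq // hom1 addr0.
have qm' := ltnW qm.
rewrite famprodS gmulfM /= Emx_mulX ?nk // !IHq //.
rewrite (ltnNge n) (leq_trans qm' mn) /= addr0 [(_ < q.+1)%N]ltnS (leq_eqVlt l) -addrA.
congr (_ + _)%R.
have [->|lq] := eqVneq l q; last by rewrite mulr0n addr0.
by rewrite ltnn /= mulr0n add0r mulr1n; case: eqP; rewrite ?mul1r ?mul0r.
Qed.

Lemma colfam_coord k (a : nat -> R) : (k < m)%N ->
  Emx (phi R (famprod x m a)) k n = a k.
Proof. by move=> km; rewrite phi_colprod // km eqxx (negPf (kn km)) add0r. Qed.

Lemma rowfam_coord k (a : nat -> R) : (k < m)%N ->
  Emx (phi R (famprod y m a)) n k = a k.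
Proof. by move=> km; rewrite phi_rowprod // km eqxx (negPf (nk km)) add0r. Qed.

Lemma colfam_lconj i j b z : i != j -> (i < m)%N -> (j < m)%N -> z \in colfam ->
  lconj (stX i j b) z \in colfam.
Proof.
move=> ij im jm; apply: (fam_lconj x0) => k c {}z km zfam.
have [->|kj] := eqVneq k j.
  rewrite lconj_stXl ?kn // -mulgA; do !apply: (fam_mulX xD xC) => //.
by rewrite lconj_stX_id ?kn //; apply: (fam_mulX xD xC).
Qed.

Lemma rowfam_lconj i j b z : i != j -> (i < m)%N -> (j < m)%N -> z \in rowfam ->
  lconj (stX i j b) z \in rowfam.
Proof.
move=> ij im jm; apply: (fam_lconj y0) => k c {}z km zfam.
have [->|ki] := eqVneq k i.
  rewrite lconj_stXr ?nk // -mulgA.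
  by do !apply: (fam_mulX yD yC) => //.
by rewrite lconj_stX_id ?nk // 1?eq_sym //; apply: (fam_mulX yD yC).
Qed.

Lemma stN_ind (P : St R -> Prop) z : P 1 ->
  (forall i j a z, i != j -> (i < m)%N -> (j < m)%N -> P z -> P (stX i j a * z)) ->
  z \in generated (stN_gen m) -> P z.
Proof.
move=> P1 PX zm; apply: (generated_ind _ _ P1 zm).
  move=> _ [i [j [a [im jm ij ->]]]]; exists i, j, (- a)%R; split=> //.
  by rewrite stXN.
by move=> _ w [i [j [a [im jm ij ->]]]]; apply: PX.
Qed.

Lemma kernel_commute z k a : z \in generated (stN_gen m) -> phi R z = 1 ->
  (k < m)%N -> commute z (stX k n a) /\ commute z (stX n k a).
Proof.
move=> zm z1 km; have phiz w : phi R (lconj z w) = phi R w.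
  by rewrite gmulf_lconj /= z1 lconj1g.
split.
  apply: (fam_commute x0 xD xC (p := fun k z => Emx (phi R z) k n)) => //.
  - exact: colfam_coord.
  - elim/stN_ind: zm {z1 phiz} => [w|i j b z' ij im jm IH w wfam].
      by rewrite lconj1g.
    by rewrite lconjMl; apply/colfam_lconj/IH.
  - by move=> l w; rewrite phiz.
apply: (fam_commute y0 yD yC (p := fun k z => Emx (phi R z) n k)) => //.
- exact: rowfam_coord.
- elim/stN_ind: zm {z1 phiz} => [w|i j b z' ij im jm IH w wfam].
    by rewrite lconj1g.
  by rewrite lconjMl; apply/rowfam_lconj/IH.
- by move=> l w; rewrite phiz.
Qed.

End Column.

(* Conjugation by [z] preserves the column [x_kn] and the row [x_nk], [k < n],
   for [n] large, and [phi] is injective on both. *)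
Theorem kernel_phi_central z w : phi R z = 1 -> commute z w.
Proof.
move=> z1; have [N zN] := stN_exists z.
elim/St_gen_ind: w => [|i j a w ij zw]; first exact: commute1.
apply: commuteM => //; pose n := maxn N (maxn i j).+1.
have zn : z \in generated (stN_gen n).
  apply: generatedS zN => _ [k [l [b [kN lN kl ->]]]].
  by exists k, l, b; split; rewrite // leq_max ?kN ?lN.
have [i_n jn] : (i < n)%N /\ (j < n)%N by rewrite /n; split; lia.
rewrite -[a]mulr1 -(@stXM _ i n j) ?(ltn_eqF i_n) ?(gtn_eqF jn) //.
have [zi _] := kernel_commute (leqnn n) a zn z1 i_n.
have [_ zj] := kernel_commute (leqnn n) 1%R zn z1 jn.
exact: commute_lcomm.
Qed.

(** Induction on the rank. The last column is a commuting family normalised by the smaller group, so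
    z = y v with y in that family. Since the matrix of v has a trivial last column, the coordinates
    of y are read off the last column of [phi] of y v. *)
Lemma stU_kernel z : z \in stU -> phi R z = 1 -> z = 1.
Proof.
move=> /stU_exists[N]; elim: N z => [|N IHN] z zN.
  apply: (generated_ind (P := fun z => phi R z = 1 -> z = 1) _ _ _ zN) => //.
    by move=> w [i [j [a [_ j0 _]]]]; rewrite ltn0 in j0.
  by move=> w v [i [j [a [_ j0 _]]]]; rewrite ltn0 in j0.
have [y [v [yfam vN ->]]] : exists y v, [/\ y \in colfam N N,
    v \in generated (stUN_gen N) & z = y * v].
  apply: (generated_ind (P := fun z => exists y v, [/\ y \in colfam N N,
    v \in generated (stUN_gen N) & z = y * v]) _ _ _ zN).
  - move=> _ [i [j [a [ij jM ->]]]]; exists i, j, (- a)%R; split=> //.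
    by rewrite stXN // neq_ltn ij.
  - move=> _ w [i [j [a [ij jN ->]]]] [y [v [yfam vN ->]]].
    move: jN; rewrite ltnS leq_eqVlt => /orP[/eqP jN|jN].
      exists (stX i N a * y), v; split; rewrite ?jN ?mulgA //.
      by apply: colfam_mulX; rewrite // -jN.
    exists (lconj (stX i j a) y), (stX i j a * v).
    have ij' : i != j by rewrite neq_ltn ij.
    split; first by apply: colfam_lconj; rewrite // (ltn_trans ij).
      by apply: gpredM => //; apply: sub_generated; exists i, j, a.
    by rewrite [RHS]mulgA -mulg_lconj mulgA.
  - by exists 1, 1; split; rewrite ?mulg1 ?colfam1 ?gpred1.
move=> yv1; have vcol p : Emx (phi R v) p N = (p == N)%:R%R.
  apply: (generated_ind (P := fun v => forall p, Emx (phi R v) p N = (p == N)%:R%R)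
    _ _ _ vN).
  - move=> _ [i [j [a [ij jM ->]]]]; exists i, j, (- a)%R; split=> //.
    by rewrite stXN // neq_ltn ij.
  - move=> _ w [i [j [a [ij jN ->]]]] IHw q; rewrite gmulfM /=.
    rewrite Emx_Xmul ?neq_ltn ?ij // !IHw (ltn_eqF jN) mulr0 mul0rn addr0 //.
  - by move=> q; rewrite hom1.
have y1 : y = 1.
  have /famP[a ya] := yfam; rewrite ya; apply: (famprod0 (m := N)) => // k.
    by move=> kN; apply: stX0; rewrite neq_ltn kN.
  move=> kN; have := congr1 (fun g => Emx g k N) yv1.
  rewrite gmulfM EmxM (@infmx_mul_col _ _ _ 1%R N) => [||p].
  - by rewrite Emx1 mulr1 ya (colfam_coord (leqnn N)) // (ltn_eqF kN).
  - exact: Emx_finitary.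
  - by rewrite vcol.
by rewrite y1 mul1g; apply: IHN => //; rewrite -yv1 y1 mul1g.
Qed.

End Center.

(** * Symbols in the Steinberg group *)

Section Symbols.
Variable F : fieldType.
Implicit Types (u v a b : F) (i j k l m : nat) (z y : St F).

Lemma mono_phi_eq z y s s' t' d : mono z s s' d -> mono y s t' d ->
  phi F z = phi F y.
Proof.
move=> Mz My; apply/Emx_inj/infmx_eqP => i j.
by rewrite (mono_mx Mz) (mono_mx My).
Qed.

Lemma mono_phi1 z s' : mono z id s' (fun=> 1%R) -> phi F z = 1.
Proof.
move=> Mz; apply/Emx_inj/infmx_eqP => i j.
by rewrite (mono_mx Mz) Emx1.
Qed.

Lemma lcomm_phi z y z' y' : phi F z = phi F z' -> phi F y = phi F y' ->
  lcomm z y = lcomm z' y'.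
Proof. exact/central_lcomm/kernel_phi_central. Qed.

Lemma stHM_phi i j u v : i != j -> u != 0%R -> v != 0%R ->
  phi F (stH i j (u * v)) = phi F (stH i j v * stH i j u).
Proof.
move=> ij u0 v0; have uv0 : (u * v != 0)%R by rewrite mulf_neq0.
apply: (mono_phi_eq (mono_H ij uv0)).
apply: (eq_mono (monoM (mono_H ij v0) (mono_H ij u0))) => // k.
by rewrite /hd /=; case: ifP => // _; case: ifP; rewrite ?mulr1 ?invfM.
Qed.

Definition sym i j k u v := lcomm (stH i j u) (stH i k v).

Lemma symE i j k u v : i != j -> i != k -> j != k -> u != 0%R ->
  sym i j k u v = stH i k (u * v)%R * (stH i k u)^-1 * (stH i k v)^-1.
Proof.
move=> ij ik jk u0; rewrite /sym lcommE (mono_conjH v (mono_H ij u0) ik).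
by rewrite /hd eqxx (eq_sym k i) (negPf ik) (eq_sym k j) (negPf jk) !divr1.
Qed.

Lemma symV i j k u v : (sym i j k u v)^-1 = sym i k j v u.
Proof. exact: lcommV. Qed.

Lemma phi_sym i j k u v : i != j -> i != k -> j != k -> u != 0%R -> v != 0%R ->
  phi F (sym i j k u v) = 1.
Proof.
move=> ij ik jk u0 v0; rewrite symE // !gmulfM /= stHM_phi // !homV /= gmulfM.
by rewrite mulgK mulgV.
Qed.

Lemma sym_indep2 i j j' k u v : i != j -> i != j' -> i != k -> j != k -> j' != k ->
  u != 0%R -> sym i j k u v = sym i j' k u v.
Proof. by move=> *; rewrite !symE. Qed.

Lemma sym_indep3 i j k k' u v : i != j -> i != k -> i != k' -> j != k -> j != k' ->
  v != 0%R -> sym i j k u v = sym i j k' u v.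
Proof.
move=> ij ik ik' jk jk' v0; apply: invg_inj; rewrite !symV.
by rewrite (@sym_indep2 i k k' j) // eq_sym.
Qed.

(** Conjugation by w_ii'(1) fixes the symbol, which is central, and carries h_il(x) to h_i'l(x) up
    to the kernel of [phi], which commutators ignore. *)
Lemma sym_indep1 i i' j k u v : i != i' -> i != j -> i != k -> i' != j ->
  i' != k -> j != k -> u != 0%R -> v != 0%R -> sym i j k u v = sym i' j k u v.
Proof.
move=> ii' ij ik i'j i'k jk u0 v0.
have Mw := mono_W ii' (oner_neq0 F); set w := stW _ _ _ in Mw.
have Hphi l x : x != 0%R -> i != l -> i' != l ->
    phi F (lconj w (stH i l x)) = phi F (stH i' l x).
  move=> x0 il i'l; rewrite (mono_conjH x Mw il).
  rewrite /sw /wd eqxx (eq_sym l i) (negPf il) (eq_sym l i') (negPf i'l) !divr1.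
  rewrite invr1 mulN1r gmulfM homV /= -mulN1r stHM_phi // ?oppr_eq0 ?oner_eq0 //.
  by rewrite gmulfM mulgK.
have <- : lconj w (sym i j k u v) = sym i j k u v.
  by apply/lconj_fix/commute_sym/kernel_phi_central/phi_sym.
by rewrite lconj_lcomm; apply: lcomm_phi; apply: Hphi.
Qed.

Definition symb u v := sym 0 1 2 u v.

Lemma symbE i j k u v : i != j -> i != k -> j != k -> u != 0%R -> v != 0%R ->
  sym i j k u v = symb u v.
Proof.
move=> ij ik jk u0 v0.
(* Two triples of indices may overlap; each is compared with one triple beyond both. *)
have H i0 j0 k0 (a : nat) : i0 != j0 -> i0 != k0 -> j0 != k0 ->
    (maxn i0 (maxn j0 k0) < a)%N -> sym i0 j0 k0 u v = sym a a.+1 a.+2 u v.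
  rewrite !gtn_max => ? ? ? /and3P[? ? ?].
  rewrite (@sym_indep2 i0 j0 a.+1 k0) //; try lia.
  rewrite (@sym_indep3 i0 a.+1 k0 a.+2) //; try lia.
  by apply: sym_indep1 => //; lia.
pose a := (maxn 2 (maxn i (maxn j k))).+1.
have a1 : (maxn i (maxn j k) < a)%N by rewrite /a; lia.
have a2 : (maxn 0 (maxn 1 2) < a)%N by rewrite /a; lia.
by rewrite /symb (H i j k a) // (H 0%N 1%N 2%N a).
Qed.

Lemma symbHE i k u v : i != k -> u != 0%R -> v != 0%R ->
  symb u v = stH i k (u * v)%R * (stH i k u)^-1 * (stH i k v)^-1.
Proof.
move=> ik u0 v0; pose j := (i + k).+1.
have [ij jk] : i != j /\ j != k by rewrite /j; split; lia.
by rewrite -(symbE ij ik jk) // symE.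
Qed.

Lemma phi_symb u v : u != 0%R -> v != 0%R -> phi F (symb u v) = 1.
Proof. exact: phi_sym. Qed.

Lemma symb_central u v z : u != 0%R -> v != 0%R -> commute (symb u v) z.
Proof. by move=> u0 v0; apply/kernel_phi_central/phi_symb. Qed.

Lemma symbMl u u' v : u != 0%R -> u' != 0%R -> v != 0%R ->
  symb (u * u')%R v = symb u v * symb u' v.
Proof.
move=> u0 u'0 v0.
(* The order of the two factors is the one for which [lcommMl] lists the symbols as in the
   statement. *)
rewrite [symb (_ * _)%R _](@lcomm_phi _ _ (stH 0 1 u' * stH 0 1 u) (stH 0 2 v)) //.
  rewrite lcommMl; apply: (congr2 *%g _ (erefl _)).
  by apply/lconj_fix/commute_sym/symb_central.
exact: stHM_phi.
Qed.

Lemma symbMr u v v' : u != 0%R -> v != 0%R -> v' != 0%R ->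
  symb u (v * v')%R = symb u v * symb u v'.
Proof.
move=> u0 v0 v'0.
have sV a b : symb a b = (sym 0 2 1 b a)^-1 by rewrite symV.
rewrite !sV !(@symbE 0%N 2%N 1%N) ?mulf_neq0 // symbMl //.
by rewrite (symb_central _ v0 u0) invgM.
Qed.

(** It suffices that w(v) w(-1) w(u) = w(uv) when u + v = 1. Write w_01(-1) = w_10(1) = y(1) x(-1)
    y(1) and move the outer y(1) across w(v) and w(u). The inner x-arguments v - 1 + u cancel, and
    what is left is x y x with y-argument -(u^-1 + v^-1) = -(uv)^-1. *)
Lemma symb_1B u : u != 0%R -> (1 - u != 0)%R -> symb u (1 - u)%R = 1.
Proof.
move=> u0; set v := (1 - u)%R => v0; rewrite (@symbHE 0%N 1%N) //.
set W := @stW F 0%N 1%N; set X := @stX F 0%N 1%N; set Y := @stX F 1%N 0%N.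
have n10 : (-1 : F)%R != 0%R by rewrite oppr_eq0 oner_eq0.
have YW x : x != 0%R -> W x * Y 1%R = X (- (x * x))%R * W x.
  by move=> x0; rewrite mulg_lconj lconjW_ji // mulr1.
have WY x : x != 0%R -> Y 1%R * W x = W x * X (- (x * x))%R.
  move=> x0; have := YW (- x)%R; rewrite oppr_eq0 => /(_ x0).
  rewrite mulrNN (_ : W (- x)%R = (W x)^-1); last by rewrite [RHS]stWV.
  move=> /(congr1 (fun z => W x * z * W x)).
  by rewrite -!mulgA mulVg mulg1 !mulgA mulgV mul1g.
suff WW : W v * W (-1)%R * W u = W (u * v)%R.
  rewrite !stH_def -/W -WW !invgM !mulgA.
  by rewrite mulgK mulgK mulgK mulgV.
have -> : W (-1)%R = Y 1%R * X (-1)%R * Y 1%R.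
  by rewrite /W stW_sym // invrN invr1 opprK stW_def invr1.
rewrite !mulgA YW // -(mulgA _ (Y 1%R) (W u)) WY //.
have WE x : W x = X x * Y (- x^-1)%R * X x by rewrite /W stW_def.
rewrite !WE !mulgA.
have XX a b g : g * X a * X b = g * X (a + b)%R.
  by rewrite -mulgA [X (_ + _)%R]stXD.
have YY a b g : g * Y a * Y b = g * Y (a + b)%R.
  by rewrite -mulgA [Y (_ + _)%R]stXD.
rewrite -[X (- (v * v))%R]mul1g !XX (_ : v + (-1 + u) = 0)%R; last by rewrite /v; ring.
rewrite [X 0%R]stX0 // mulg1 YY mul1g.
congr (X _ * Y _ * X _); last by rewrite /v; ring.
  by rewrite /v; ring.
rewrite -opprD; congr (- _)%R.
have -> : (v^-1 + u^-1 = (u + v) / (u * v))%R by field; rewrite u0 v0.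
by rewrite /v addrC subrK div1r.
Qed.

End Symbols.

Section SymToSt.
Variable F : fieldType.

Definition symF (x : Sym_index F) : St F := symb (val x.1) (val x.2).

Lemma units_neq0 (u : units F) : val u != 0%R.
Proof. by rewrite -unitfE; apply: valP. Qed.

Lemma symF_rel u v : @Sym_rel F u v -> word_eval symF u = word_eval symF v.
Proof.
case=> {u v} [u v u1 uv|u u' uu' v uE|u v v' vv' vE];
  rewrite /word_eval !big_cons !big_nil /= !mulg1 /symF /=.
- by rewrite uv symb_1B ?units_neq0 // -uv units_neq0.
- by rewrite uE symbMl ?units_neq0.
- by rewrite vE symbMr ?units_neq0.
Qed.

Definition SymSt : Sym F -> St F := pres_lift symF.

Fact SymStM : {morph SymSt : x y / x * y}.
Proof. exact/pres_liftM/symF_rel. Qed.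
HB.instance Definition _ := isMultiplicative.Build (Sym F) (St F) SymSt SymStM.

Lemma SymSt_gen u v : SymSt (Sym_gen u v) = symb (val u) (val v).
Proof. exact/pres_lift_gen/symF_rel. Qed.

Lemma Sym_ind (P : Sym F -> Prop) : P 1 ->
  (forall u v x, P x -> P (Sym_gen u v * x)) ->
  (forall u v x, P x -> P ((Sym_gen u v)^-1 * x)) -> forall x, P x.
Proof.
move=> P1 PM PV x; rewrite -[x]presK; elim: (repr x) => [|[[u v] e] w IHw].
  exact: P1.
rewrite -cat1s presM; case: e; first exact: PM.
by have := PV u v _ IHw; congr (P (_ * _)); rewrite [LHS]pres_invE.
Qed.

Lemma phi_SymSt x : phi F (SymSt x) = 1.
Proof.
elim/Sym_ind: x => [|u v x IH|u v x IH]; first by rewrite !hom1.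
  by rewrite !gmulfM /= IH mulg1 SymSt_gen phi_symb ?units_neq0.
by rewrite !gmulfM /= IH mulg1 !homV /= SymSt_gen phi_symb ?units_neq0 ?invg1.
Qed.

Definition symimg : {pred St F} := [pred z | `[< exists x, SymSt x = z >]].

Lemma symimgP z : reflect (exists x, SymSt x = z) (z \in symimg).
Proof. by rewrite inE; apply: asboolP. Qed.

Fact symimgM : mulg_closed symimg.
Proof.
move=> _ _ /symimgP[x <-] /symimgP[y <-]; apply/symimgP.
by exists (x * y); rewrite gmulfM.
Qed.
Fact symimg1 : 1 \in symimg.
Proof. by apply/symimgP; exists 1; rewrite hom1. Qed.
Fact symimgV : invg_closed symimg.
Proof.
by move=> _ /symimgP[x <-]; apply/symimgP; exists x^-1; rewrite homV.
Qed.
Fact symimgJ x y : x \in symimg -> x ^ y \in symimg.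
Proof.
move=> xS; suff -> : x ^ y = x by [].
have /symimgP[w <-] := xS.
rewrite conjgE (kernel_phi_central y (phi_SymSt w)) mulKg //.
Qed.
HB.instance Definition _ := isMulClosed.Build _ symimg symimgM.
HB.instance Definition _ := isMul1Closed.Build _ symimg symimg1.
HB.instance Definition _ := isInvClosed.Build _ symimg symimgV.
HB.instance Definition _ := isConjClosed.Build _ symimg symimgJ.

Lemma symb_img u v : u != 0%R -> v != 0%R -> symb u v \in symimg.
Proof.
rewrite -!unitfE => uU vU; apply/symimgP.
by exists (Sym_gen (exist _ u uU) (exist _ v vU)); rewrite SymSt_gen.
Qed.

End SymToSt.

(** * Bruhat decomposition *)

Section Generation.
Variable F : fieldType.
Implicit Types (u v a b : F) (i j k l m : nat) (z y w h : St F).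

Definition stW_gen : set (St F) := fun z => exists i j u,
  [/\ i != j, u != 0%R & z = stW i j u].
Definition stWN_gen (N : nat) : set (St F) := fun z => exists i j u,
  [/\ (i < N)%N, (j < N)%N, i != j, u != 0%R & z = stW i j u].
Definition stH_gen : set (St F) := fun z => exists i j u,
  [/\ i != j, u != 0%R & z = stH i j u \/ z = (stH i j u)^-1].
Definition stHN_gen (N : nat) : set (St F) := fun z => exists i j u,
  [/\ (i < N)%N, (j < N)%N, i != j, u != 0%R &
    z = stH i j u \/ z = (stH i j u)^-1].

Lemma stW_genV z : stW_gen z -> stW_gen z^-1.
Proof.
move=> [i [j [u [ij u0 ->]]]]; exists i, j, (- u)%R.
by rewrite stWV // oppr_eq0.
Qed.

Lemma stWN_genV N z : stWN_gen N z -> stWN_gen N z^-1.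
Proof.
move=> [i [j [u [iN jN ij u0 ->]]]]; exists i, j, (- u)%R.
by rewrite stWV // oppr_eq0.
Qed.

Lemma stWeyl_exists z : z \in generated stW_gen ->
  exists N, z \in generated (stWN_gen N).
Proof.
apply: generated_bigcup; first exact: stW_genV.
  move=> _ [i [j [u [ij u0 ->]]]]; exists (maxn i j).+1, i, j, u.
  by split; rewrite // ltnS ?leq_maxl ?leq_maxr.
move=> M N _ MN [i [j [u [iM jM ij u0 ->]]]]; exists i, j, u.
by split; rewrite // (leq_trans _ MN).
Qed.

Lemma stWN_mono N z : z \in generated (stWN_gen N) ->
  exists s s' d, mono z s s' d /\ forall m, (N <= m)%N -> s m = m.
Proof.
move=> zN; apply: (generated_ind (P := fun z => exists s s' d,
  mono z s s' d /\ forall m, (N <= m)%N -> s m = m) (@stWN_genV N) _ _ zN).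
  move=> _ y [i [j [u [iN jN ij u0 ->]]]] [s [s' [d [My sm]]]].
  exists (sw i j \o s), (s' \o sw i j), (fun k => d k * wd i j u (s k))%R.
  split=> [|m Nm]; first exact: monoM (mono_W ij u0) My.
  by rewrite /= sm // /sw !gtn_eqF // (leq_trans _ Nm).
by exists id, id, (fun=> 1%R); split=> //; apply: mono1.
Qed.

Lemma stWeyl_mono z : z \in generated stW_gen -> exists s s' d, mono z s s' d.
Proof.
move=> /stWeyl_exists[N /stWN_mono[s [s' [d [Mz _]]]]].
by exists s, s', d.
Qed.

Section UnipotentRadical.
Variable i : nat.
Let ii : i != i.+1. Proof. by rewrite ltn_eqF. Qed.

(** Generators of the unipotent radical of the minimal parabolic subgroup attached to the simple
    root (i, i+1): all positive roots but this one, which w_i keeps positive. *)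
Definition stUi_gen : set (St F) := fun z => exists k l a,
  [/\ (k < l)%N, (k != i) || (l != i.+1) & z = stX k l a].

Lemma stUi_genV z : stUi_gen z -> stUi_gen z^-1.
Proof.
move=> [k [l [a [kl kli ->]]]]; exists k, l, (- a)%R.
by rewrite stXN // ltn_eqF.
Qed.

Lemma stUi_sub : {subset generated stUi_gen <= @stU F}.
Proof. by apply: generatedS => _ [k [l [a [kl _ ->]]]]; exists k, l, a. Qed.

Lemma stUi_lconjW v z : v != 0%R -> z \in generated stUi_gen ->
  lconj (stW i i.+1 v) z \in @stU F.
Proof.
move=> v0 zU; apply: (generated_ind
  (P := fun z => lconj (stW i i.+1 v) z \in @stU F) stUi_genV _ _ zU).
  move=> _ y [k [l [a [kl kli ->]]]] yU; rewrite lconjM; apply: gpredM => //.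
  rewrite (monoX (mono_W ii v0)) ?ltn_eqF //.
  apply: sub_generated; eexists _, _, _; split; last by [].
  rewrite /sw; move: kl kli.
  case: (k =P i); case: (k =P i.+1); case: (l =P i); case: (l =P i.+1) => /=; lia.
by rewrite lconj1 gpred1.
Qed.

Lemma stUi_lconjX b z : z \in generated stUi_gen ->
  lconj (stX i i.+1 b) z \in generated stUi_gen.
Proof.
move=> zU; apply: (generated_ind
  (P := fun z => lconj (stX i i.+1 b) z \in _) stUi_genV _ _ zU); last first.
  by rewrite lconj1 gpred1.
move=> _ y [k [l [a [kl kli ->]]]] yU; rewrite lconjM; apply: gpredM => //.
have gen p q c : (p < q)%N -> (p != i) || (q != i.+1) ->
  stX p q c \in generated stUi_gen.
  by move=> pq pqi; apply: sub_generated; exists p, q, c.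
have [ki|ki] := eqVneq k i.+1.
  rewrite ki in kl kli *.
  rewrite lconj_stXl ?ltn_eqF //; last exact: ltnW.
  by apply: gpredM; apply: gen => //; lia.
have [li|li] := eqVneq l i.
  rewrite li in kl kli *.
  rewrite lconj_stXr ?ltn_eqF //; last exact: ltnW.
  by apply: gpredM; apply: gen => //; lia.
have il : i != l by rewrite eq_sym.
have kl' : k != l by rewrite ltn_eqF.
by rewrite lconj_stX_id //; apply: gen.
Qed.

Lemma stU_decomp z : z \in @stU F ->
  exists a w, w \in generated stUi_gen /\ z = w * stX i i.+1 a.
Proof.
move=> zU; apply: (generated_ind (P := fun z => exists a w,
  w \in generated stUi_gen /\ z = w * stX i i.+1 a) _ _ _ zU).
- move=> _ [k [l [a [kl ->]]]]; exists k, l, (- a)%R; split=> //.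
  by rewrite stXN // ltn_eqF.
- move=> _ y [k [l [b [kl ->]]]] [a [w [wU ->]]].
  have [/andP[/eqP-> /eqP->]|] := boolP ((k == i) && (l == i.+1)); last first.
    rewrite negb_and => kli; exists a, (stX k l b * w); rewrite mulgA; split=> //.
    by apply: gpredM => //; apply: sub_generated; exists k, l, b.
  exists (b + a)%R, (lconj (stX i i.+1 b) w); split; first exact: stUi_lconjX.
  by rewrite stXD // !mulgA -mulg_lconj.
- by exists 0%R, 1; rewrite gpred1 stX0 // mulg1.
Qed.

End UnipotentRadical.

(** Negative root elements are obtained from the others: x_(k+1,k) is a conjugate of x_(k,k+1) by a
    simple Weyl element, and deeper ones are commutators of shallower ones. *)
Lemma stX_ind (P : St F -> Prop) : (forall z y, P z -> P y -> P (z * y)) ->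
  (forall i j a, (i < j)%N -> P (stX i j a)) ->
  (forall i, P (stW i i.+1 1%R)) -> (forall i, P (stW i i.+1 (-1)%R)) ->
  forall i j a, i != j -> P (stX i j a).
Proof.
move=> PM PX PW PWV i j a.
have lower1 k b : P (stX k.+1 k b).
  have kk : k != k.+1 by rewrite ltn_eqF.
  have n1 := oner_neq0 F.
  have -> : stX k.+1 k b = stW k k.+1 1%R * stX k k.+1 (- b)%R * stW k k.+1 (-1)%R.
    by rewrite -stWV // -lconjE lconjW_ij // invr1 !mulr1 opprK.
  by apply: (PM _ _ _ (PWV k)); apply: (PM _ _ (PW k)); apply: PX.
have lower n : forall k b, P (stX (k + n.+1) k b).
  elim: n => [|n IHn] k b; first by rewrite addn1.
  have -> : stX (k + n.+2) k b =
      lcomm (stX (k + n.+2) k.+1 b) (stX k.+1 k 1%R).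
    by rewrite stXM ?mulr1 //; lia.
  have nk c : P (stX (k + n.+2) k.+1 c) by rewrite -addSnnS.
  rewrite lcommE lconjE -!stXN //; last 2 first; try lia.
  exact: (PM _ _ (PM _ _ (PM _ _ (nk b) (lower1 k _)) (nk _)) (lower1 k _)).
rewrite neq_ltn => /orP[ij|ji]; first exact: PX.
by rewrite -(subnKC ji) addSnnS; apply: lower.
Qed.

Lemma St_ind (P : St F -> Prop) : P 1 -> (forall z y, P z -> P y -> P (z * y)) ->
  (forall i j a, (i < j)%N -> P (stX i j a)) ->
  (forall i, P (stW i i.+1 1%R)) -> (forall i, P (stW i i.+1 (-1)%R)) ->
  forall z, P z.
Proof.
move=> P1 PM PX PW PWV z; elim/St_gen_ind: z => // i j a z ij Pz.
exact: (PM _ _ (stX_ind PM PX PW PWV _ ij) Pz).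
Qed.

Definition bruhat z := exists p n q : St F,
  [/\ p \in @stU F, n \in generated stW_gen, q \in @stU F & z = p * n * q].

Lemma bruhat_stU (p : St F) z : p \in @stU F -> bruhat z -> bruhat (p * z).
Proof.
move=> uU [u' [n [v [u'U nW vU ->]]]]; exists (p * u'), n, v.
by rewrite !mulgA; split=> //; apply: gpredM.
Qed.

Lemma stX_stU i j a : (i < j)%N -> stX i j a \in @stU F.
Proof. by move=> ij; apply: sub_generated; exists i, j, a. Qed.

Lemma stW_stWeyl i j u : i != j -> u != 0%R -> stW i j u \in generated stW_gen.
Proof. by move=> ij u0; apply: sub_generated; exists i, j, u. Qed.

(** The axiom of a BN-pair. Of the left factor in U, the part in the radical crosses w_i to the
    left. The remaining x_(i,i+1)(a) crosses n to the right if n^-1 keeps this root positive;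
    otherwise an identity in SL_2 replaces n by w(b) w(v) n, and x_(i,i+1)(-b) then crosses w(v)
    n. *)
Lemma bruhat_stW i v z : v != 0%R -> bruhat z -> bruhat (stW i i.+1 v * z).
Proof.
move=> v0 [u [n [u' [uU nW u'U ->]]]].
have ii : i != i.+1 by rewrite ltn_eqF.
have [a [w [wU ->]]] := stU_decomp i uU.
rewrite -!mulgA (mulgA _ w) (mulg_lconj _ w) -!mulgA; apply: bruhat_stU.
  exact: (stUi_lconjW v0 wU).
have [s [s' [d Mn]]] := stWeyl_mono nW.
have WnW : stW i i.+1 v * n \in generated stW_gen.
  by apply: gpredM => //; apply: stW_stWeyl.
have MWn := monoM (mono_W ii v0) Mn.
have trivial_case : bruhat (stW i i.+1 v * (n * u')).
  by exists 1, (stW i i.+1 v * n), u'; rewrite gpred1 mul1g mulgA.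
have [si|si] := ltnP (s' i) (s' i.+1).
  exists 1, (stW i i.+1 v * n), (lconj n^-1 (stX i i.+1 a) * u').
  split=> //; first exact: gpred1.
    rewrite (monoX (monoV Mn)) //; apply: gpredM => //; exact: stX_stU.
  by rewrite mul1g (mulgA (stX _ _ a)) (mulg_lconjV n) !mulgA.
have [->|a0] := eqVneq a 0%R; first by rewrite stX0 // mul1g.
(* Chosen so that w(v) conjugates x_(i,i+1)(a) to x_(i+1,i)(-b^-1), which equals x(-b) w(b) x(-b) by
   the definition of w(b). *)
pose b := (v * v / a)%R; have b0 : b != 0%R by rewrite !mulf_neq0 ?invr_neq0.
have -> : stW i i.+1 v * (stX i i.+1 a * (n * u')) =
    stX i i.+1 (- b)%R * (stW i i.+1 b *
      (stX i i.+1 (- b)%R * (stW i i.+1 v * n) * u')).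
  rewrite (mulgA _ (stX _ _ a)) (mulg_lconj _ (stX _ _ a)) lconjW_ij //.
  have -> : (- (a * v^-1 * v^-1) = - b^-1)%R.
    by rewrite /b; field; rewrite a0 v0.
  by rewrite (stW_def i i.+1 b) !mulgA -stXD // addNr stX0 // mul1g (stXN b) // mulgK.
apply: bruhat_stU; first exact: stX_stU.
have s'lt : (s' i.+1 < s' i)%N.
  by rewrite ltn_neqAle si andbT (inj_eq (can_inj (monoVK Mn))) gtn_eqF.
exists 1, (stW i i.+1 b * (stW i i.+1 v * n)),
  (lconj (stW i i.+1 v * n)^-1 (stX i i.+1 (- b)%R) * u').
split; first exact: gpred1.
- by apply: gpredM => //; apply: stW_stWeyl.
- rewrite (monoX (monoV MWn)) //; apply: gpredM => //; apply: stX_stU.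
  by rewrite /= /sw eqxx gtn_eqF // eqxx.
- by rewrite mul1g (mulg_lconjV (stW i i.+1 v * n)) !mulgA.
Qed.

(** Closure of [bruhat] under products is not visible beforehand, whereas its left stabiliser is
    closed under them; [St_ind] is therefore run on the stabiliser. *)
Definition bstable z := forall y, bruhat y -> bruhat (z * y).

Lemma bstableM z y : bstable z -> bstable y -> bstable (z * y).
Proof. by move=> Hz Hy w Hw; rewrite -mulgA; apply/Hz/Hy. Qed.

Lemma bruhat_all z : bruhat z.
Proof.
suff Hz : bstable z.
  by rewrite -[z]mulg1; apply: Hz; exists 1, 1, 1; rewrite !gpred1 !mulg1.
elim/St_ind: z => [z|z y Hz Hy|i j a ij z|i z|i z]; first by rewrite mul1g.
- exact: bstableM.
- exact/bruhat_stU/stX_stU.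
- exact/bruhat_stW/oner_neq0.
- by apply: bruhat_stW; rewrite oppr_eq0 oner_eq0.
Qed.

End Generation.

(** * The kernel of phi consists of symbols *)

Section Torus.
Variable F : fieldType.
Implicit Types (u v a b : F) (i j k l m : nat) (z y w h : St F).

Let n10 : (-1 : F)%R != 0%R. Proof. by rewrite oppr_eq0 oner_eq0. Qed.

Definition stT := generated (@stH_gen F).
HB.instance Definition _ := GroupClosed.on stT.

Lemma stH_genV z : stH_gen z -> stH_gen z^-1.
Proof.
move=> [i [j [u [ij u0 [] ->]]]]; exists i, j, u; rewrite ?invgK.
  by split=> //; right.
by split=> //; left.
Qed.

Lemma stHN_genV N z : stHN_gen N z -> stHN_gen N z^-1.
Proof.
move=> [i [j [u [iN jN ij u0 [] ->]]]]; exists i, j, u; rewrite ?invgK.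
  by split=> //; right.
by split=> //; left.
Qed.

Lemma stT_exists z : z \in stT -> exists N, z \in generated (stHN_gen N).
Proof.
apply: generated_bigcup; first exact: stH_genV.
  move=> x [i [j [u [ij u0 zE]]]]; exists (maxn i j).+1, i, j, u.
  by split; rewrite // ltnS ?leq_maxl ?leq_maxr.
move=> M N x MN [i [j [u [iM jM ij u0 zE]]]]; exists i, j, u.
by split; rewrite // (leq_trans _ MN).
Qed.

Lemma stH_T i j u : i != j -> u != 0%R -> stH i j u \in stT.
Proof. by move=> ij u0; apply: sub_generated; exists i, j, u; split=> //; left. Qed.

Lemma stW_sqr i j : i != j -> stW i j (1 : F)%R * stW i j 1%R = (stH i j (-1)%R)^-1.
Proof. by move=> ij; rewrite stH_def invgM !stWV // opprK. Qed.

Lemma stT_mono h : h \in stT -> exists d, mono h id id d.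
Proof.
move=> hT; apply: (generated_ind (P := fun h => exists d, mono h id id d)
  stH_genV _ _ hT).
  move=> _ y [i [j [u [ij u0 [] ->]]]] [d My].
    by eexists; apply: (monoM (mono_H ij u0) My).
  by eexists; apply: (monoM (monoV (mono_H ij u0)) My).
by exists (fun=> 1%R); apply: mono1.
Qed.

Lemma stW_stT h i j u : h \in stT -> i != j -> u != 0%R ->
  exists2 v, v != 0%R & stW i j u * h = h * stW i j v.
Proof.
move=> hT ij u0; have [d Md] := stT_mono (gpredVr _ hT).
exists (d i * u / d j)%R; first by rewrite !mulf_neq0 ?invr_eq0 ?(mono_neq0 Md).
by rewrite mulg_lconjV (mono_conjW _ Md).
Qed.

Lemma stWN_T N i j u : i != j -> (i < N)%N -> (j < N)%N -> u != 0%R ->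
  stW i j u \in generated (@stWN_gen F N).
Proof. by move=> ij iN jN u0; apply: sub_generated; exists i, j, u. Qed.

(** Modulo the torus, these are the cosets of the symmetric group on N letters in the one on N + 1
    letters, represented by 1 and the transpositions (k N). *)
Definition weyl_cosets N z := exists h y, [/\ h \in stT,
  y \in generated (@stWN_gen F N) &
  z = h * y \/ exists2 k, (k < N)%N & z = h * stW k N 1%R * y].

Lemma weyl_cosets_last N i u z : (i < N)%N -> u != 0%R -> weyl_cosets N z ->
  weyl_cosets N (stW i N u * z).
Proof.
move=> iN u0 [h [y [hT yN zE]]].
have neqN k : (k < N)%N -> k != N by move=> kN; rewrite ltn_eqF.
have iN' := neqN _ iN; have [v v0 uh] := stW_stT hT iN' u0.
have hvT : h * stH i N v \in stT by apply: gpredM => //; apply: stH_T.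
case: zE => [->|[k kN ->]].
  exists (h * stH i N v), y; split=> //; right; exists i => //.
  by rewrite mulgA uh stWE // !mulgA.
(* Equal transpositions cancel up to the torus, because w(1)^2 = h(-1)^-1. For distinct ones, moving
   w_iN to the right of w_kN turns it into some w_ik, of smaller indices. *)
have [ik|ik] := eqVneq i k.
  exists (h * stH i N v * (stH i N (-1)%R)^-1), y; split=> //.
    by apply: gpredM => //; apply: gpredVr; apply: stH_T.
  left; rewrite -stW_sqr // -ik !mulgA uh (stWE v) //.
  by rewrite !mulgA.
have Mw := mono_W (neqN _ kN) (oner_neq0 F); have Mk := monoV Mw.
exists h, (lconj (stW k N 1%R)^-1 (stW i N v) * y); split=> //; last first.
  right; exists k => //.
  by rewrite !mulgA uh -(mulgA h) (mulg_lconjV (stW k N 1%R)) !mulgA.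
apply: gpredM => //; rewrite (mono_conjW _ Mk) //; set c := (_ / _)%R.
have c0 : c != 0%R by rewrite !mulf_neq0 ?invr_eq0 ?(mono_neq0 Mw).
rewrite /sw (negPf iN') (negPf ik) eqxx [N == k]eq_sym (negPf (neqN _ kN)).
exact: stWN_T.
Qed.

Lemma weyl_cosets_lt N i j u z : (i < N)%N -> (j < N)%N -> i != j -> u != 0%R ->
  weyl_cosets N z -> weyl_cosets N (stW i j u * z).
Proof.
move=> iN jN ij u0 [h [y [hT yN zE]]].
have neqN k : (k < N)%N -> k != N by move=> kN; rewrite ltn_eqF.
have [v v0 uh] := stW_stT hT ij u0.
have WyN : stW i j v * y \in generated (@stWN_gen F N).
  by apply: gpredM => //; apply: stWN_T.
case: zE => [->|[k kN ->]].
  by exists h, (stW i j v * y); split=> //; left; rewrite !mulgA uh.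
have Mv := mono_W ij v0; have skN : (sw i j k < N)%N.
  by rewrite /sw; case: ifP => // _; case: ifP.
set c := (wd i j v k * 1 / wd i j v N)%R.
have c0 : c != 0%R by rewrite !mulf_neq0 ?invr_eq0 ?oner_eq0 ?(mono_neq0 Mv).
exists (h * stH (sw i j k) N c), (stW i j v * y); split=> //.
  by apply: gpredM => //; apply: stH_T; rewrite ?neqN.
right; exists (sw i j k) => //.
rewrite !mulgA uh -(mulgA h) (mulg_lconj (stW i j v)) (mono_conjW _ Mv) ?neqN //.
by rewrite {2}/sw !gtn_eqF // stWE ?neqN // !mulgA.
Qed.

Lemma weyl_cosets_all N z : z \in generated (@stWN_gen F N.+1) -> weyl_cosets N z.
Proof.
apply: (generated_ind (@stWN_genV _ _)).
  move=> _ y [i [j [u [iN jN ij u0 ->]]]].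
  move: iN jN; rewrite !ltnS leq_eqVlt => /orP[/eqP iN|iN].
    rewrite leq_eqVlt => /orP[/eqP jN|jN]; first by rewrite iN jN eqxx in ij.
    rewrite stW_sym // iN; apply: weyl_cosets_last => //.
    by rewrite oppr_eq0 invr_eq0.
  rewrite leq_eqVlt => /orP[/eqP -> |jN]; first exact: weyl_cosets_last.
  exact: weyl_cosets_lt.
by exists 1, 1; rewrite !gpred1; split=> //; left; rewrite mulg1.
Qed.

Lemma mono_inj z s s' d t t' e k : mono z s s' d -> mono z t t' e -> s k = t k.
Proof.
move=> Mz Mz'; have := mono_mx Mz (s k) k.
rewrite eqxx mulr1n (mono_mx Mz'); case: (s k =P t k) => // _ /eqP.
by rewrite mulr0n eq_sym (negPf (mono_neq0 Mz k)).
Qed.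

(** Induction on the rank: an element of a nontrivial coset moves the last index N to some k < N, so
    only the trivial coset is compatible with the identity permutation. *)
Lemma stWeyl_T z d : z \in generated (@stW_gen F) -> mono z id id d -> z \in stT.
Proof.
move=> /stWeyl_exists[N]; elim: N z d => [|N IHN] z d zN Mz.
  apply: (generated_sub _ zN) => w [i [j [u []]]].
  by rewrite ltn0.
have [h [y [hT yN zE]]] := weyl_cosets_all zN.
have [s [s' [e [My sN]]]] := stWN_mono yN.
have [f Mf] := stT_mono hT.
case: zE => [zE|[k kN zE]].
  rewrite zE gpredM //; have [g Mg] := stT_mono (gpredVr _ hT).
  apply: (IHN _ (fun k => d k * g k)%R) => //.
  by rewrite -[y](mulKg h) -zE; apply: monoM Mg Mz.
have kN' : k != N by rewrite ltn_eqF.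
have Mkz := monoM (monoM Mf (mono_W kN' (oner_neq0 F))) My.
rewrite zE in Mz; have := mono_inj N Mkz Mz.
rewrite /= sN // /sw eqxx eq_sym (negPf kN') => kNE.
by rewrite kNE eqxx in kN'.
Qed.

(** Modulo symbols, h_ij(u) becomes multiplicative in u, all of these elements commute, and h_ij(u)
    = h_ji(u^-1), h_ik = h_ij h_jk hold as for diagonal matrices. *)
Let Q := quotient (@symimg F).
Let q : St F -> Q := quot (@symimg F).

Let qM : {morph q : x y / x * y}. Proof. exact: quotM. Qed.
Let qV : {morph q : x / x^-1}. Proof. by move=> x; exact: homV. Qed.

Lemma q_eq1 z : q z = 1 <-> z \in @symimg F.
Proof.
have -> : q z = 1 <-> q z = q 1 by rewrite [q 1]hom1.
have e := Defs.quotP (@symimg F) z 1; rewrite mulg1 gpredV in e; exact: e.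
Qed.

Lemma qHM i j u v : i != j -> u != 0%R -> v != 0%R ->
  q (stH i j (u * v)%R) = q (stH i j v) * q (stH i j u).
Proof.
move=> ij u0 v0; have /q_eq1 := symb_img u0 v0.
rewrite (symbHE ij u0 v0) !qM !qV => e.
by rewrite -[LHS](mulgVK (q (stH i j u))) -[X in X * _](mulgVK (q (stH i j v))) e mul1g.
Qed.

Lemma qHV i j u : i != j -> u != 0%R -> q (stH i j u)^-1 = q (stH i j u^-1%R).
Proof.
move=> ij u0; rewrite qV; apply: (mulgI (q (stH i j u))).
by rewrite mulgV -qHM ?invr_eq0 // mulVf // stH1.
Qed.

Lemma qHC i j k l u v : i != j -> k != l -> u != 0%R -> v != 0%R ->
  commute (q (stH i j u)) (q (stH k l v)).
Proof.
move=> ij kl u0 v0; rewrite /commute -!qM mulg_lconj.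
rewrite (mono_conjH _ (mono_H ij u0)) // !qM; congr (_ * _).
set c := (hd i j u k / hd i j u l)%R.
have c0 : c != 0%R by apply: mulf_neq0; rewrite ?invr_eq0; exact: (mono_neq0 (mono_H ij u0)).
rewrite (_ : hd i j u k * v / hd i j u l = v * c)%R; last first.
  by rewrite /c mulrAC mulrC.
by rewrite qV mulrC qHM // mulgK.
Qed.

Lemma qH_sym i j u : i != j -> u != 0%R -> q (stH i j u) = q (stH j i u^-1%R).
Proof.
move=> ij u0; have ji : j != i by rewrite eq_sym.
have nu0 : (- u^-1)%R != 0%R by rewrite oppr_eq0 invr_eq0.
rewrite stH_def (stW_sym ij u0) (stW_sym ij n10) invrN invr1 opprK.
rewrite stWE // -mulgA stW_sqr // qM qV -[(- u^-1)%R]mulN1r qHM ?invr_eq0 //.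
by rewrite mulgK.
Qed.

(** Two evaluations of the conjugate of h_ij(u) by w_jk(1): one lets w_jk(1) act on h_ij(u), the
    other lets h_ij(u) act on w_jk(1). *)
Lemma qH_trans i j k u : i != j -> j != k -> i != k -> u != 0%R ->
  q (stH i k u) = q (stH i j u) * q (stH j k u).
Proof.
move=> ij jk ik u0; have Mw := mono_W jk (oner_neq0 F).
have [ki kj ji] : [/\ k != i, k != j & j != i] by split; rewrite eq_sym.
have e1 : lconj (stW j k (1 : F)%R) (stH i j u) =
    stH i k (u * -1)%R * (stH i k (-1)%R)^-1.
  rewrite (mono_conjH u Mw ij) /sw /wd eqxx (negPf ij) (negPf ik).
  by rewrite !invrN !invr1 !mul1r.
have e2 : lconj (stW j k (1 : F)%R) (stH i j u) = stH i j u * stH j k u.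
  rewrite lconjE (mulg_lconjV (stH i j u)) (mono_conjW _ (monoV (mono_H ij u0))) //.
  rewrite /hd eqxx (negPf ji) (negPf ki) (negPf kj) invrK mulr1 invr1 divr1.
  by rewrite stWV // -mulgA -stH_def.
by rewrite -qM -e2 e1 mulrC qM qV qHM // mulgK.
Qed.

Lemma q_phi x y : q x = q y -> phi F x = phi F y.
Proof.
have e := Defs.quotP (@symimg F) x y.
move/e/symimgP => -[w /(congr1 (phi F))]; rewrite phi_SymSt gmulfM homV /=.
by move=> h1; rewrite -[RHS](mulVKg (phi F x)) -h1 mulg1.
Qed.

Lemma stHN_genW N z : stHN_gen N z -> exists i j u,
  [/\ (i < N)%N, (j < N)%N, i != j, u != 0%R & q z = q (stH i j u)].
Proof.
move=> [i [j [u [iN jN ij u0 [] ->]]]]; first by exists i, j, u.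
by exists i, j, u^-1%R; rewrite qHV // invr_eq0.
Qed.

(** By h_Nk = h_N0 h_0k every occurrence of the last index is collected in a single h_N0. The index
    0 serves as base point, hence 0 < N. *)
Lemma qHN_decomp N z : (0 < N)%N -> z \in generated (@stHN_gen F N.+1) ->
  exists u y, [/\ u != 0%R, y \in generated (@stHN_gen F N) &
    q z = q (stH N 0 u) * q y].
Proof.
move=> N0 zN; have N0' : N != 0%N by rewrite gtn_eqF.
have genN i j u : (i < N)%N -> (j < N)%N -> i != j -> u != 0%R ->
    stH i j u \in generated (@stHN_gen F N).
  by move=> iN jN ij u0; apply: sub_generated; exists i, j, u; split=> //; left.
apply: (generated_ind (P := fun z => exists u y,
  [/\ u != 0%R, y \in generated (@stHN_gen F N) &
    q z = q (stH N 0 u) * q y]) (@stHN_genV _) _ _ zN); last first.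
  by exists 1%R, 1; rewrite gpred1 oner_eq0 stH1 // -qM mul1g.
move=> g w /stHN_genW[i [j [v [iN jN ij v0 gE]]]] [u [y [u0 yN wE]]].
have last_case k x : (k < N)%N -> x != 0%R -> q g = q (stH N k x) ->
    exists u y, [/\ u != 0%R, y \in generated (@stHN_gen F N) &
      q (g * w) = q (stH N 0 u) * q y].
  move=> kN x0 {}gE; have [k0|k0] := eqVneq k 0%N.
    exists (u * x)%R, y; split=> //; first exact: mulf_neq0.
    by rewrite qM gE wE k0 mulgA -qHM.
  exists (u * x)%R, (stH 0 k x * y); split; first exact: mulf_neq0.
    by apply: gpredM => //; apply: genN; rewrite // eq_sym.
  have [Nk k0'] : N != k /\ 0%N != k by split; rewrite eq_sym // ltn_eqF.
  rewrite !qM gE wE (@qH_trans N 0 k) //.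
  rewrite qHM // !mulgA; congr (_ * _); rewrite -!mulgA; congr (_ * _).
  by apply: qHC; rewrite // eq_sym.
move: iN jN; rewrite !ltnS leq_eqVlt => /orP[/eqP iN|iN].
  rewrite leq_eqVlt => /orP[/eqP jN|jN]; first by rewrite iN jN eqxx in ij.
  by apply: (last_case j v) => //; rewrite -iN.
rewrite leq_eqVlt => /orP[/eqP jN|jN].
  apply: (last_case i v^-1%R); rewrite ?invr_eq0 // -jN -qH_sym //.
exists u, (stH i j v * y); split=> //; first by apply: gpredM => //; apply: genN.
by rewrite !qM gE wE !mulgA; congr (_ * _); apply: qHC.
Qed.

Lemma stHN_mono N z : z \in generated (@stHN_gen F N) ->
  exists d, mono z id id d /\ forall m, (N <= m)%N -> d m = 1%R.
Proof.
move=> zN; apply: (generated_ind (P := fun z => exists d, mono z id id d /\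
  forall m, (N <= m)%N -> d m = 1%R) (@stHN_genV N) _ _ zN); last first.
  by exists (fun=> 1%R); split=> //; apply: mono1.
move=> w y [i [j [u [iN jN ij u0 zE]]]] [d [My dN]].
have hN m : (N <= m)%N -> hd i j u m = 1%R.
  by move=> Nm; rewrite /hd !gtn_eqF // (leq_trans _ Nm).
case: zE => ->; eexists; split.
- exact: (monoM (mono_H ij u0) My).
- by move=> m Nm /=; rewrite hN // dN // mulr1.
- exact: (monoM (monoV (mono_H ij u0)) My).
- by move=> m Nm /=; rewrite hN // dN // invr1 mulr1.
Qed.

(** The N-th diagonal entry of [phi F z] is the u of [qHN_decomp]; so u = 1 and the rank drops. *)
Lemma stHN_kernel N z : z \in generated (@stHN_gen F N) -> phi F z = 1 -> q z = 1.
Proof.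
elim: N z => [|N IHN] z zN z1.
  suff /(congr1 q) : z = 1 by rewrite [q 1]hom1.
  apply: (generated_ind (P := eq^~ 1) (@stHN_genV 0) _ _ zN) => // w y.
  by move=> [i [j [u []]]]; rewrite ltn0.
(* With the single index 0 there is no off-diagonal pair, hence no generator. *)
have [N0|N0] := posnP N.
  apply: IHN => //; rewrite N0 in zN *; apply: (generated_sub _ zN) => w.
  by move=> [i [j [u []]]]; rewrite !ltnS !leqn0 => /eqP -> /eqP ->; rewrite eqxx.
have [u [y [u0 yN zE]]] := qHN_decomp N0 zN.
have N0' : N != 0%N by rewrite gtn_eqF.
have [d [My dN]] := stHN_mono yN.
have Mz := monoM (mono_H N0' u0) My.
have phizE : phi F z = phi F (stH N 0 u * y) by apply: q_phi; rewrite qM.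
have u1 : u = 1%R.
  have := mono_mx Mz N N; rewrite -phizE z1 Emx1 /= eqxx mulr1n dN // mul1r.
  by rewrite /hd eqxx ?mulr1n => <-.
rewrite zE u1 stH1 // [q 1]hom1 mul1g; apply: IHN => //.
by rewrite -z1 phizE u1 stH1 // mul1g.
Qed.

Lemma stT_kernel z : z \in stT -> phi F z = 1 -> z \in @symimg F.
Proof. by move=> /stT_exists[N zN] z1; apply/q_eq1/(stHN_kernel zN). Qed.

End Torus.

(** * Unitriangular matrices and the end of the kernel computation *)

Section UpperTriangular.
Variable R : nzRingType.

Definition unitri (g : E R) := forall k l, (l <= k)%N -> Emx g k l = (k == l)%:R%R.

Lemma unitriM g h : unitri g -> unitri h -> unitri (g * h).
Proof.
move=> gU hU k l lk; rewrite EmxM.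
have [n gn] := Emx_finitary g; set r := maxn n k.+1.
have [nr kr] : (n <= r)%N /\ (k < r)%N by rewrite leq_maxl leq_maxr.
rewrite (infmx_mulE _ _ gn nr kr) (bigD1 (Ordinal kr)) //= gU // eqxx mul1r hU //.
rewrite big1 ?addr0 // => p; rewrite -val_eqE /= => pk.
have [pk'|kp] := leqP p k; first by rewrite gU // eq_sym (negPf pk) mul0r.
by rewrite hU ?(leq_trans lk (ltnW kp)) // gtn_eqF ?mulr0 // (leq_ltn_trans lk).
Qed.

Lemma unitriX i j a : (i < j)%N -> unitri (phi R (stX i j a)).
Proof.
have neq : (i < j)%N -> i != j by move=> ij; rewrite ltn_eqF.
move=> ij k l lk; rewrite Emx_phiX ?neq //.
case: (k =P i) => [ki|_]; case: (l =P j) => [lj|_]; rewrite /= ?mulr0n ?addr0 //.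
by move: lk; rewrite ki lj leqNgt ij.
Qed.

Lemma stU_unitri z : z \in @stU R -> unitri (phi R z).
Proof.
move=> zU; apply: (generated_ind (P := fun z => unitri (phi R z)) _ _ _ zU).
- move=> _ [i [j [a [ij ->]]]]; exists i, j, (- a)%R.
  by rewrite stXN // ltn_eqF.
- move=> _ y [i [j [a [ij ->]]]] yU; rewrite gmulfM.
  by apply: unitriM => //; apply: unitriX.
- by rewrite hom1.
Qed.

End UpperTriangular.

(** Strong induction: values below k are already taken by arguments below k. Triangularity of a
    monomial matrix supplies the inequality. *)
Lemma perm_le_id (s : nat -> nat) : injective s -> (forall k, (s k <= k)%N) ->
  s =1 id.
Proof.
move=> s_inj sk; elim/ltn_ind => k IHk; apply/eqP; rewrite eqn_leq sk leqNgt.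
by apply/negP => lt_sk; have /s_inj e := IHk _ lt_sk; rewrite e ltnn in lt_sk.
Qed.

(** In z = u n v, the matrix of n is both monomial and unitriangular, so n is a torus element in the
    kernel, hence a product of symbols. Being central it can be pulled out, and u v lies in U and in
    the kernel, hence is 1. *)
Theorem kernel_phi_symimg (F : fieldType) (z : St F) :
  phi F z = 1 -> z \in @symimg F.
Proof.
move=> z1; have [u [n [v [uU nW vU zE]]]] := bruhat_all z.
have [s [s' [d Mn]]] := stWeyl_mono nW.
have nE : phi F n = phi F (u^-1 * v^-1).
  have -> : n = u^-1 * z * v^-1 by rewrite zE !mulgA mulVg mul1g mulgK.
  by rewrite !gmulfM /= z1 mulg1.
have nU : unitri (phi F n).
  by rewrite nE; apply: stU_unitri; apply: gpredM; apply: gpredVr.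
have sid : s =1 id.
  apply: perm_le_id => [|k]; first exact: can_inj (monoK Mn).
  rewrite leqNgt; apply/negP => ks; have := nU (s k) k (ltnW ks).
  rewrite (mono_mx Mn) eqxx mulr1n gtn_eqF // => /eqP.
  by rewrite (negPf (mono_neq0 Mn k)).
have s'id : s' =1 id by move=> k; rewrite -[in RHS](monoVK Mn k) sid.
have d1 : d =1 (fun=> 1%R).
  by move=> k; have := nU k k (leqnn k); rewrite (mono_mx Mn) sid eqxx !mulr1n.
have Mn1 := eq_mono Mn sid s'id d1.
have n1 : phi F n = 1 := mono_phi1 Mn1.
have nS : n \in @symimg F by apply/stT_kernel/n1/(stWeyl_T nW Mn1).
suff -> : z = n by [].
rewrite zE -(kernel_phi_central u n1) -mulgA.
suff -> : u * v = 1 by rewrite mulg1.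
apply: stU_kernel; first exact: gpredM.
by rewrite -z1 zE !gmulfM /= n1 mulg1.
Qed.

(** * Universality of the Steinberg extension *)

(** A form of the Hall-Witt identity. For root elements it equates [x_ik, [x_kl, x_lj]] and
    [[x_ik, x_kl], x_lj], so that the intermediate index of a commutator can be changed from k to
    l. *)
Lemma lcommA (G : groupType) (u v w : G) : commute u w ->
  commute (lcomm u v) (lcomm v w) -> commute (lcomm v w) (lcomm (lcomm u v) w) ->
  lcomm u (lcomm v w) = lcomm (lcomm u v) w.
Proof.
move=> uw uv_vw vw_uvw; rewrite [LHS]lcommE lconj_lcomm.
have -> : lconj u w = w by apply/lconj_fix.
have -> : lconj u v = lcomm u v * v by rewrite lcommE mulgVK.
rewrite lcommMl; have -> : lconj (lcomm u v) (lcomm v w) = lcomm v w.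
  exact/lconj_fix.
by rewrite vw_uvw mulgK.
Qed.

Section UniversalExtension.
Variables (R : nzRingType) (C : groupType) (p : {multiplicative C -> E R}).
Hypothesis p_surj : forall g, exists c, p c = g.
Hypothesis pC : forall c d, p c = 1 -> commute c d.
Implicit Types (a b : R) (i j k l : nat) (c d v w : C).

Let e i j a : E R := phi R (stX i j a).
Let lift g : C := sval (cid (p_surj g)).
Let liftK g : p (lift g) = g. Proof. exact: svalP (cid (p_surj g)). Qed.

Let eM i j k a b : i != j -> j != k -> i != k ->
  lcomm (e i j a) (e j k b) = e i k (a * b)%R.
Proof. by move=> ij jk ik; rewrite -gmulf_lcomm stXM. Qed.

(** Up to a central element, [c] is a commutator of lifts through a fresh index m. Conjugation by
    [d] preserves the images of these two lifts, hence fixes their commutator. *)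
Lemma lift_commute i j k l a b c d : i != j -> k != l -> i != l -> k != j ->
  p c = e i j a -> p d = e k l b -> commute c d.
Proof.
move=> ij kl il kj pc pd; pose m := (i + j + k + l).+1.
have [im mj ml km] : [/\ i != m, m != j, m != l & k != m].
  by rewrite /m; split; lia.
pose c' := lcomm (lift (e i m a)) (lift (e m j 1%R)).
have pc' : p c' = e i j a.
  by rewrite gmulf_lcomm !liftK eM // mulr1.
have dc' : commute d c'.
  apply/lconj_fix; rewrite lconj_lcomm; apply: (central_lcomm pC).
    by rewrite gmulf_lconj pd liftK -gmulf_lconj lconj_stX_id.
  by rewrite gmulf_lconj pd liftK -gmulf_lconj lconj_stX_id // eq_sym.
rewrite -[c](mulVKg c'); apply/commute_sym/commuteM => //; apply: commute_sym.
by apply: (central_div pC); rewrite pc'.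
Qed.

(* Since [p] has central kernel, the commutator does not depend on the chosen
   lifts, nor (see [lcomm_lift]) on the intermediate index. *)
Let mid i j := (i + j).+1.
Let s i j a := lcomm (lift (e i (mid i j) a)) (lift (e (mid i j) j 1%R)).

Let midP i j : [/\ i != mid i j, mid i j != j & mid i j != i].
Proof. by rewrite /mid; split; lia. Qed.

Lemma p_lcomm_lift i j k a b c d : i != j -> k != j -> i != k ->
  p c = e i k a -> p d = e k j b -> p (lcomm c d) = e i j (a * b)%R.
Proof. by move=> ij kj ik pc pd; rewrite gmulf_lcomm pc pd eM. Qed.

Lemma p_s i j a : i != j -> p (s i j a) = e i j a.
Proof.
move=> ij; have [im mj _] := midP i j.
by rewrite (p_lcomm_lift ij mj im (liftK _) (liftK _)) mulr1.
Qed.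

Lemma lcomm_lift_change i j k l a b c d : i != j -> k != j -> i != k ->
  l != i -> l != j -> l != k -> p c = e i k a -> p d = e k j b ->
  lcomm c d = lcomm (lift (e i l (a * b)%R)) (lift (e l j 1%R)).
Proof.
move=> ij kj ik li lj lk pc pd; pose v := lift (e k l b); pose w := lift (e l j 1%R).
have [il kl jl] : [/\ i != l, k != l & j != l] by rewrite !(eq_sym _ l).
have pv : p v = e k l b by apply: liftK.
have pw : p w = e l j 1%R by apply: liftK.
have pcv := p_lcomm_lift il kl ik pc pv.
have pvw := p_lcomm_lift kj lj kl pv pw; rewrite mulr1 in pvw.
rewrite (@central_lcomm _ _ _ pC c d c (lcomm v w)) ?pvw ?pd // lcommA.
- by apply: (central_lcomm pC); rewrite ?liftK ?pcv.
- by apply: (lift_commute _ _ _ _ pc pw) => //; rewrite eq_sym.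
- by apply: (lift_commute _ _ _ _ pcv pvw).
- apply: (lift_commute _ _ _ _ pvw (p_lcomm_lift ij lj il pcv pw)) => //.
Qed.

Lemma lcomm_lift i j k a b c d : i != j -> k != j -> i != k ->
  p c = e i k a -> p d = e k j b -> lcomm c d = s i j (a * b)%R.
Proof.
move=> ij kj ik pc pd; have [im mj mi] := midP i j.
have [km|km] := eqVneq k (mid i j); last first.
  by apply: (lcomm_lift_change (l := mid i j) _ _ _ _ _ _ pc pd); rewrite // eq_sym.
(* [lcomm_lift_change] requires a new index; when k is already [mid i j], two changes through a
   further index lead back to it. *)
pose l := (mid i j).+1.
have [li lj lm] : [/\ l != i, l != j & l != mid i j] by rewrite /l /mid; split; lia.
rewrite (lcomm_lift_change (l := l) _ _ _ _ _ _ pc pd) ?km //.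
rewrite (lcomm_lift_change (l := mid i j) _ _ _ _ _ _ (liftK _) (liftK _)) //.
- by rewrite mulr1.
- by rewrite eq_sym.
- by rewrite eq_sym.
Qed.

Lemma s_add i j a b : i != j -> s i j (a + b)%R = s i j a * s i j b.
Proof.
move=> ij; have [im mj mi] := midP i j; set m := mid i j in im mj mi *.
have sC : commute (s i j a) (s i j b).
  by apply: (lift_commute _ _ _ _ (p_s a ij) (p_s b ij)); rewrite // eq_sym.
(* [lcommMl] returns the two factors in reverse order, whence the preliminary use of [sC]. *)
rewrite sC [LHS](@central_lcomm _ _ _ pC _ _ (lift (e i m a) * lift (e i m b))
  (lift (e m j 1%R))) //; last first.
  by rewrite liftK gmulfM !liftK /e stXD // gmulfM.
rewrite lcommMl; congr (_ * _); apply/lconj_fix.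
by apply: (lift_commute _ _ _ _ (liftK _) (p_s b ij)); rewrite // eq_sym.
Qed.

Let s_gen (x : St_index R) : C := s (val x.1).1 (val x.1).2 x.2.

Lemma s_gen_rel x y : @St_rel R x y -> word_eval s_gen x = word_eval s_gen y.
Proof.
case=> {x y} [i j ij a b|i j k l ij kl a b il kj|i j k ij jk ik a b].
- by rewrite /word_eval !big_cons !big_nil /= !mulg1 /s_gen /= s_add.
- rewrite word_eval_comm /word_eval big_nil /s_gen /=.
  have /lcomm_eq1 : commute (s i j a) (s k l b).
    exact: (lift_commute _ _ _ _ (p_s a ij) (p_s b kl)).
  by rewrite lcomm.unlock.
- rewrite word_eval_comm /word_eval big_cons big_nil mulg1 /s_gen /=.
  have := lcomm_lift ik jk ij (p_s a ij) (p_s b jk).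
  by rewrite lcomm.unlock.
Qed.

Theorem St_universal : exists psi : {multiplicative St R -> C},
  forall x, p (psi x) = phi R x.
Proof.
pose f : St R -> C := pres_lift s_gen.
have fM : {morph f : x y / x * y} by exact/pres_liftM/s_gen_rel.
pose fm := isMultiplicative.Build (St R) C f fM.
pose psi : {multiplicative St R -> C} := HB.pack f fm.
exists psi => x; apply: (@pres_ext _ _ _ (fun x => p (psi x)) (phi R)).
- by move=> y z; rewrite -gmulfM; congr (p _); apply: fM.
- exact: phiM.
- move=> y; rewrite (_ : psi _ = s_gen y); last exact/pres_lift_gen/s_gen_rel.
  by case: y => [[[i j] /= ij] a]; rewrite /s_gen /= p_s // /e (stXE ij).
Qed.

End UniversalExtension.

(** * Calculus of symbols *)

(* A reflexive decision procedure for equalities between integral combinations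
   of atoms of an abelian group, some atoms being declared to have order 2. *)
Section ZmodReflection.
Local Open Scope ring_scope.
Variable A : zmodType.

Inductive zatom := ZFree of A | ZTors x of x + x = 0 :> A.
Definition zatom_val a := match a with ZFree x => x | @ZTors x _ => x end.
Definition zatom_tors a := if a is ZTors _ _ then true else false.

Inductive zexp := ZVar of nat | Zzero | Zadd of zexp & zexp | Zopp of zexp.

Variable env : seq zatom.

Fixpoint zeval e : A :=
  match e with
  | ZVar i => zatom_val (nth (ZFree 0) env i)
  | Zzero => 0
  | Zadd e1 e2 => zeval e1 + zeval e2
  | Zopp e1 => - zeval e1
  end.

Fixpoint zcoef e (i : nat) : int :=
  match e with
  | ZVar j => (i == j)%:Z
  | Zzero => 0
  | Zadd e1 e2 => zcoef e1 i + zcoef e2 i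
  | Zopp e1 => - zcoef e1 i
  end.

Lemma zeval_sum e :
  zeval e = \sum_(i < size env) zatom_val (nth (ZFree 0) env i) *~ zcoef e i.
Proof.
elim: e => [j||e1 IH1 e2 IH2|e1 IH1] /=.
- have [jn|nj] := ltnP j (size env).
    rewrite (bigD1 (Ordinal jn)) //= eqxx mulr1z big1 ?addr0 // => i.
    by rewrite -val_eqE /= => /negPf ->; rewrite mulr0z.
  rewrite nth_default // big1 // => i _.
  by rewrite (ltn_eqF (leq_trans (ltn_ord i) nj)) mulr0z.
- by rewrite big1 // => i _; rewrite mulr0z.
- by rewrite IH1 IH2 -big_split; apply: eq_bigr => i _; rewrite mulrzDr.
- by rewrite IH1 -sumrN; apply: eq_bigr => i _; rewrite mulrNz.
Qed.

Definition zcheck e1 e2 := all (fun i =>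
  let k := zcoef e1 i - zcoef e2 i in
  (k == 0) || zatom_tors (nth (ZFree 0) env i) && ~~ odd `|k|%N)
  (iota 0 (size env)).

Lemma zcheckP e1 e2 : zcheck e1 e2 -> zeval e1 = zeval e2.
Proof.
move=> /allP H; rewrite !zeval_sum; apply: eq_bigr => i _; apply/eqP.
rewrite -subr_eq0 -mulrzBr; have := H i; rewrite mem_iota ltn_ord => /(_ isT) /=.
move: (_ - _) => k /orP[/eqP->|]; first by rewrite mulr0z.
case: (nth _ _ _) => //= x xx0; rewrite -dvdn2 => /dvdnP[m km].
have {km} [->|->] : k = (m * 2)%:Z \/ k = - (m * 2)%:Z by lia.
  by rewrite -pmulrn mulnC mulrnA mulr2n xx0 mul0rn.
by rewrite mulrNz -pmulrn mulnC mulrnA mulr2n xx0 mul0rn oppr0.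
Qed.

End ZmodReflection.

Lemma N1_neq0 (F : fieldType) : ((-1 : F) != 0)%R.
Proof. by rewrite oppr_eq0 oner_eq0. Qed.

Section SymbolCalculus.
Local Open Scope ring_scope.
Variables (F : fieldType) (A : zmodType) (c : F -> F -> A).
Implicit Types (u v w : F).

Record symbol : Prop := Symbol {
  symMl : forall u u' v, u != 0 -> u' != 0 -> v != 0 ->
    c (u * u') v = c u v + c u' v;
  symMr : forall u v v', u != 0 -> v != 0 -> v' != 0 ->
    c u (v * v') = c u v + c u v';
  sym1B : forall u, u != 0 -> 1 - u != 0 -> c u (1 - u) = 0
}.

Hypothesis cS : symbol.

Let n10 : ((-1 : F) != 0)%R. Proof. exact: N1_neq0. Qed.
Let nz := oner_neq0 F.

Lemma sym1l v : v != 0 -> c 1 v = 0.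
Proof.
by move=> v0; apply: (addIr (c 1 v)); rewrite add0r -(symMl cS) // mulr1.
Qed.

Lemma sym1r u : u != 0 -> c u 1 = 0.
Proof.
by move=> u0; apply: (addIr (c u 1)); rewrite add0r -(symMr cS) // mulr1.
Qed.

Lemma symVl u v : u != 0 -> v != 0 -> c u^-1 v = - c u v.
Proof.
move=> u0 v0; apply/eqP; rewrite -subr_eq0 opprK addrC -(symMl cS) ?invr_eq0 //.
by rewrite mulfV // sym1l.
Qed.

Lemma symVr u v : u != 0 -> v != 0 -> c u v^-1 = - c u v.
Proof.
move=> u0 v0; apply/eqP; rewrite -subr_eq0 opprK addrC -(symMr cS) ?invr_eq0 //.
by rewrite mulfV // sym1r.
Qed.

Lemma sym_opp u : u != 0 -> c u (- u) = 0.
Proof.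
move=> u0; have [->|u1] := eqVneq u 1; first by rewrite sym1l.
have u1' : 1 - u != 0 by rewrite subr_eq0 eq_sym.
have v1' : 1 - u^-1 != 0 by rewrite subr_eq0 eq_sym invr_eq1.
(* The classical factorisation that reduces c(u,-u) to the Steinberg relations at u and at u^-1. *)
have -> : - u = (1 - u) * (1 - u^-1)^-1.
  by field; rewrite u0 subr_eq0 u1.
rewrite (symMr cS) ?invr_eq0 // (sym1B cS) // add0r symVr //.
by rewrite -symVl // (sym1B cS) ?invr_eq0.
Qed.

Lemma symNl u v : u != 0 -> v != 0 -> c (- u) v = c (-1) v + c u v.
Proof. by move=> u0 v0; rewrite -(mulN1r u) (symMl cS). Qed.

Lemma symNr u v : u != 0 -> v != 0 -> c u (- v) = c u (-1) + c u v.
Proof. by move=> u0 v0; rewrite -(mulN1r v) (symMr cS). Qed.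

Lemma symC u v : u != 0 -> v != 0 -> c u v = - c v u.
Proof.
move=> u0 v0; have uv0 : u * v != 0 by rewrite mulf_neq0.
have := sym_opp uv0; rewrite (symMl cS) ?oppr_eq0 //.
rewrite -{1}mulNr -mulrN !(symMr cS) ?oppr_eq0 // !sym_opp // add0r addr0.
by move=> e; apply/eqP; rewrite -subr_eq0 opprK e.
Qed.

Lemma symN1_tors u : u != 0 -> c (-1) u + c (-1) u = 0.
Proof. by move=> u0; rewrite -(symMl cS) // mulrNN mulr1 sym1l. Qed.

Lemma symN1r u : u != 0 -> c u (-1) = c (-1) u.
Proof.
move=> u0; rewrite symC //; apply/eqP; rewrite eq_sym -subr_eq0 opprK.
by rewrite symN1_tors.
Qed.

Lemma symuu u : u != 0 -> c u u = c (-1) u.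
Proof.
by move=> u0; rewrite -{2}[u]opprK symNr ?oppr_eq0 // sym_opp // addr0 symN1r.
Qed.

End SymbolCalculus.

Ltac zmod_same x y := match goal with _ => unify x y end.

Ltac zmod_index env x :=
  match env with
  | ZFree ?y :: _ => let _ := zmod_same x y in constr:(O)
  | @ZTors _ ?y _ :: _ => let _ := zmod_same x y in constr:(O)
  | _ :: ?l => let n := zmod_index l x in constr:(S n)
  end.

Ltac zmod_mem env x :=
  match env with
  | _ => let n := zmod_index env x in constr:(true)
  | _ => constr:(false)
  end.

(** An atom c(-1,u) is registered as having order 2 when u is -1 or is known to be nonzero; [zcheck]
    then compares its coefficients modulo 2. *)
Ltac zmod_atoms cS env t :=
  lazymatch t with
  | (?a + ?b)%R => let e := zmod_atoms cS env a in zmod_atoms cS e b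
  | (- ?a)%R => zmod_atoms cS env a
  | 0%R => env
  | _ =>
    let m := zmod_mem env t in
    lazymatch m with
    | true => env
    | false =>
      lazymatch t with
      | ?c (-1)%R (-1)%R =>
        constr:(@ZTors _ t (symN1_tors cS (N1_neq0 _)) :: env)
      | ?c (-1)%R ?u =>
        match goal with
        | H : is_true (u != 0%R) |- _ =>
          constr:(@ZTors _ t (symN1_tors cS H) :: env)
        | _ => constr:(ZFree t :: env)
        end
      | _ => constr:(ZFree t :: env)
      end
    end
  end.

Ltac zmod_reify env t :=
  lazymatch t with
  | (?a + ?b)%R =>
    let x := zmod_reify env a in let y := zmod_reify env b in constr:(Zadd x y)
  | (- ?a)%R => let x := zmod_reify env a in constr:(Zopp x)
  | 0%R => constr:(Zzero)
  | _ => let n := zmod_index env t in constr:(ZVar n)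
  end.

Ltac zmod_solve cS :=
  lazymatch goal with
  | |- @eq ?A ?l ?r =>
    let env := zmod_atoms cS (@nil (zatom A)) l in
    let env := zmod_atoms cS env r in
    let el := zmod_reify env l in
    let er := zmod_reify env r in
    change (zeval env el = zeval env er);
    apply: zcheckP; vm_compute; reflexivity
  end.

Ltac sym_nz := by rewrite ?(mulf_neq0, invr_eq0, oppr_eq0, oner_eq0).

(** A symbol is reversed only if both of its orders occur in the goal, so that skew-symmetry does
    not loop. *)
Ltac sym_norm cS :=
  let c := lazymatch type of cS with symbol ?c => c end in
  repeat first
  [ rewrite (symMl cS); [|sym_nz|sym_nz|sym_nz]
  | rewrite (symMr cS); [|sym_nz|sym_nz|sym_nz]
  | rewrite (symVl cS); [|sym_nz|sym_nz]
  | rewrite (symVr cS); [|sym_nz|sym_nz]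
  | rewrite (sym1l cS); [|sym_nz]
  | rewrite (sym1r cS); [|sym_nz]
  | match goal with
    | |- context [c (- ?x)%R _] =>
      lazymatch x with 1%R => fail | _ =>
        rewrite (symNl cS (u := x)); [|sym_nz|sym_nz] end
    | |- context [c _ (- ?x)%R] =>
      lazymatch x with 1%R => fail | _ =>
        rewrite (symNr cS (v := x)); [|sym_nz|sym_nz] end
    | |- context [c ?x (-1)%R] =>
      lazymatch x with (-1)%R => fail | _ =>
        rewrite (symN1r cS (u := x)); [|sym_nz] end
    | |- context [c ?x ?x] =>
      lazymatch x with (-1)%R => fail | _ =>
        rewrite (symuu cS (u := x)); [|sym_nz] end
    end
  | match goal with
    | |- context [c ?x ?y] =>
      lazymatch x with (-1)%R => fail | y => fail | _ =>
        match goal with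
        | |- context [c y x] => rewrite (symC cS (u := y) (v := x)); [|sym_nz|sym_nz]
        end
      end
    end ].

Ltac sym_solve cS := sym_norm cS; zmod_solve cS.

(** * Cocycles on the elementary group *)

Section Inversions.
Implicit Types (i j k m : nat) (s : nat -> nat).

(* The number of inversions of [s^-1] with larger entry [m], for [s'] inverse
   to [s]. *)
Definition binv s' m := \sum_(0 <= k < m) (s' m < s' k).

Lemma sum_sw i m (f : nat -> nat) : i.+1 < m ->
  \sum_(0 <= k < m) f (sw i i.+1 k) = \sum_(0 <= k < m) f k.
Proof.
move=> im; have [im2 ii2] : i <= m /\ i <= i.+2 by split; lia.
rewrite !(@big_cat_nat _ _ _ i 0 m) //= !(@big_cat_nat _ _ _ i.+2 i m) //=.
congr (_ + (_ + _))%N; last 2 first.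
- by rewrite !big_nat_recl // !big_geq // /sw !eqxx gtn_eqF //= addn0 addnC addn0.
- apply: eq_big_nat => k /andP[ik _].
  by rewrite /sw gtn_eqF ?gtn_eqF // (ltn_trans _ ik).
apply: eq_big_nat => k /andP[_ ki].
by rewrite /sw !ltn_eqF // ltnW.
Qed.

Lemma binv_left_lt i m s' : m < i -> binv (s' \o sw i i.+1) m = binv s' m.
Proof.
move=> mi; apply: eq_big_nat => k /andP[_ km] /=.
by rewrite /sw !ltn_eqF // ?(ltn_trans km) // ltnW // (ltn_trans km).
Qed.

Lemma binv_left_gt i m s' : i.+1 < m -> binv (s' \o sw i i.+1) m = binv s' m.
Proof.
move=> im; rewrite /binv /= -(sum_sw (fun k => s' m < s' k) im).
by apply: eq_big_nat => k _; rewrite {1}/sw !gtn_eqF // ltnW.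
Qed.

Lemma binv_left0 i s' :
  binv s' i.+1 = (binv (s' \o sw i i.+1) i + (s' i.+1 < s' i))%N.
Proof.
rewrite /binv big_nat_recr //=; congr (_ + _)%N.
apply: eq_big_nat => k /andP[_ ki].
by rewrite /sw eqxx !ltn_eqF // ltnW.
Qed.

Lemma binv_left1 i s' :
  binv (s' \o sw i i.+1) i.+1 = (binv s' i + (s' i < s' i.+1))%N.
Proof.
rewrite /binv big_nat_recr //=; congr (_ + _)%N; last first.
  by rewrite /sw eqxx gtn_eqF // eqxx.
apply: eq_big_nat => k /andP[_ ki].
by rewrite /sw (gtn_eqF (ltnSn i)) eqxx !ltn_eqF // ltnW.
Qed.

Lemma sum_pred1 s (s' : nat -> nat) (a m : nat) : cancel s s' -> cancel s' s ->
  \sum_(0 <= k < m) (s' k == a) = (s a < m).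
Proof.
move=> sK s'K; elim: m => [|m IHm]; first by rewrite big_geq.
rewrite big_nat_recr //= IHm ltnS (leq_eqVlt (s a)) (can2_eq s'K sK) eq_sym.
by case: eqVneq => [->|]; rewrite ?ltnn // addn0.
Qed.

Section Right.
Variables (s s' : nat -> nat) (j m : nat).
Hypotheses (sK : cancel s s') (s'K : cancel s' s).

Lemma binv_right : s' m != j -> s' m != j.+1 -> binv (sw j j.+1 \o s') m = binv s' m.
Proof.
move=> mj mj1; apply: eq_big_nat => k _ /=; congr nat_of_bool.
rewrite {1}/sw (negPf mj) (negPf mj1) /sw.
by case: eqP => [->|_]; last case: eqP => [->|//]; lia.
Qed.

Lemma binv_right0 : s' m = j ->
  binv s' m = (binv (sw j j.+1 \o s') m + (s j.+1 < m))%N.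
Proof.
move=> mj; rewrite -(sum_pred1 _ _ sK s'K) -big_split; apply: eq_big_nat => k _ /=.
rewrite mj {1}/sw eqxx /sw.
by case: eqP => [->|kj]; last case: eqP => [->|kj1]; rewrite /=; lia.
Qed.

Lemma binv_right1 : s' m = j.+1 ->
  binv (sw j j.+1 \o s') m = (binv s' m + (s j < m))%N.
Proof.
move=> mj; rewrite -(sum_pred1 _ _ sK s'K) -big_split; apply: eq_big_nat => k _ /=.
rewrite mj {1}/sw (gtn_eqF (ltnSn j)) eqxx /sw.
by case: eqP => [->|kj]; last case: eqP => [->|kj1]; rewrite /=; lia.
Qed.

End Right.

End Inversions.

Lemma swl i j : sw i j i = j.
Proof. by rewrite /sw eqxx. Qed.

Lemma swr i j : sw i j j = i.
Proof. by rewrite /sw eqxx; case: eqP. Qed.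

(** * The torus part of a monomial element and its change under simple Weyl elements *)

Section BruhatData.
Variable F : fieldType.
Implicit Types (i j k m : nat) (s : nat -> nat) (d : nat -> F).
Local Open Scope ring_scope.

(* For [n] acting as [e_k |-> d_k e_(s k)], [bt s' d m] is the [m]-th diagonal
   entry of the torus part of [n], relative to the lift of [s] given by a
   reduced word in the [stW i i.+1 1]; [bS] is the sign contributed by that
   lift. *)
Definition bS s' m : F := (-1) ^+ binv s' m.
Definition bt s' d m : F := d (s' m) * bS s' m.

Lemma wdl j : wd j j.+1 (1 : F) j = -1.
Proof. by rewrite /wd eqxx invr1. Qed.

Lemma wdr j : wd j j.+1 (1 : F) j.+1 = 1.
Proof. by rewrite /wd gtn_eqF // eqxx. Qed.

Lemma bS_sqr s' m : bS s' m * bS s' m = 1.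
Proof. by rewrite /bS -exprD addnn -mul2n exprM sqrrN expr1n expr1n. Qed.

Lemma bS_neq0 s' m : bS s' m != 0.
Proof. by rewrite expf_neq0 // oppr_eq0 oner_eq0. Qed.

Section Left.
Variables (i : nat) (s s' : nat -> nat) (d : nat -> F).
Hypotheses (sK : cancel s s') (s'K : cancel s' s).
Let s2 := s' \o sw i i.+1.
Let d2 := fun k => d k * wd i i.+1 1 (s k).
(** The sign is -1 exactly when w_i shortens the permutation: then the matrix of w_i^2, which is -1
    at i and i+1, enters the torus part. When w_i lengthens it, the canonical lifts simply
    multiply. *)
Let e : F := (-1) ^+ (s' i.+1 < s' i)%N.

Lemma lt_s'N : (s' i < s' i.+1)%N = ~~ (s' i.+1 < s' i)%N.
Proof.
by rewrite -leqNgt (leq_eqVlt (s' i)) (inj_eq (can_inj s'K)) ltn_eqF.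
Qed.

Lemma bS_left0 : bS s2 i = bS s' i.+1 * e.
Proof.
by rewrite /bS binv_left0 exprD -mulrA -expr2 sqrr_sign mulr1.
Qed.

Lemma bS_left1 : bS s2 i.+1 = - bS s' i * e.
Proof.
rewrite /bS binv_left1 lt_s'N exprD /e; case: ltnP => _.
  by rewrite /= mulr1 mulrN1 opprK.
by rewrite /= mulrN1 mulr1.
Qed.

Lemma bS_left m : m != i -> m != i.+1 -> bS s2 m = bS s' m.
Proof.
move=> mi mi1; rewrite /bS; have [lt_mi|] := ltnP m i; first by rewrite binv_left_lt.
by rewrite leq_eqVlt eq_sym (negPf mi) leq_eqVlt eq_sym (negPf mi1) => /binv_left_gt ->.
Qed.

Lemma bt_left0 : bt s2 d2 i = bt s' d i.+1 * e.
Proof.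
rewrite /bt bS_left0 /s2 /d2 /= s'K /sw eqxx /wd gtn_eqF // eqxx.
by rewrite mulr1 mulrA.
Qed.

Lemma bt_left1 : bt s2 d2 i.+1 = bt s' d i * e.
Proof.
rewrite /bt bS_left1 /s2 /d2 /= s'K /sw eqxx gtn_eqF // /wd eqxx invr1.
by rewrite mulrN1 !mulrA mulrNN.
Qed.

Lemma bt_left m : m != i -> m != i.+1 -> bt s2 d2 m = bt s' d m.
Proof.
move=> mi mi1; have swm : sw i i.+1 m = m by rewrite /sw (negPf mi) (negPf mi1).
by rewrite /bt bS_left // /s2 /d2 /= s'K swm /wd (negPf mi) (negPf mi1) mulr1.
Qed.

End Left.

Section Right.
Variables (j : nat) (s s' : nat -> nat) (d : nat -> F).
Hypotheses (sK : cancel s s') (s'K : cancel s' s).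
Let s2 := sw j j.+1 \o s'.
Let d2 := fun k => wd j j.+1 1 k * d (sw j j.+1 k).
Let e : F := (-1) ^+ (s j.+1 < s j)%N.

Lemma bt_right0 : bt s2 d2 (s j) = bt s' d (s j) * e.
Proof.
rewrite /bt /bS (binv_right0 sK s'K (sK j)) exprD /s2 /d2 /= sK.
rewrite swl swr wdr mul1r.
by rewrite -!mulrA -expr2 sqrr_sign mulr1.
Qed.

Lemma bt_right1 : bt s2 d2 (s j.+1) = bt s' d (s j.+1) * e.
Proof.
have lt : (s j < s j.+1)%N = ~~ (s j.+1 < s j)%N.
  by rewrite -leqNgt (leq_eqVlt (s j)) (inj_eq (can_inj sK)) ltn_eqF.
rewrite /bt /bS (binv_right1 sK s'K (sK j.+1)) exprD /s2 /d2 /= sK lt.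
rewrite swr swl wdl /e.
by case: ltnP => _ /=; rewrite !mulN1r ?mulr1 ?mulrN1 ?mulrNN ?mulrN ?mulNr ?opprK.
Qed.

Lemma bt_right m : m != s j -> m != s j.+1 -> bt s2 d2 m = bt s' d m.
Proof.
move=> mj mj1; have [mj' mj1'] : s' m != j /\ s' m != j.+1.
  by rewrite !(can2_eq s'K sK).
rewrite /bt /bS binv_right // /s2 /d2 /= swK /sw (negPf mj') (negPf mj1').
by rewrite /wd (negPf mj') (negPf mj1') mul1r.
Qed.

End Right.

Lemma bt_neq0 s' d m : (forall k, d k != 0) -> bt s' d m != 0.
Proof. by move=> d0; rewrite mulf_neq0 // bS_neq0. Qed.

End BruhatData.

(** * Products of torus entries along a root *)

Section RootProduct.
Variable F : fieldType.
Local Open Scope ring_scope.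

(* The argument through which [rhof] depends on the torus part; it is dictated
   by [tor_wE]. *)
Definition bP (S t : nat -> F) (p q : nat) : F :=
  S p * S q * \prod_(p.+1 <= m < q.+1) (- t m).

Lemma bP_neq0 S t p q : (forall m, S m != 0) -> (forall m, t m != 0) ->
  bP S t p q != 0.
Proof.
move=> S0 t0; rewrite !mulf_neq0 //; elim/big_ind: _ => [|x y|m _].
- exact: oner_neq0.
- exact: mulf_neq0.
- by rewrite oppr_eq0.
Qed.

Section Left.
Variables (S t S2 t2 : nat -> F) (e : F) (i : nat).
Hypotheses (ee : e * e = 1) (S20 : S2 i = S i.+1 * e) (S21 : S2 i.+1 = - S i * e).
Hypotheses (t20 : t2 i = t i.+1 * e) (t21 : t2 i.+1 = t i * e).
Hypothesis S2o : forall m, m != i -> m != i.+1 -> S2 m = S m.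
Hypothesis t2o : forall m, m != i -> m != i.+1 -> t2 m = t m.

Let prod_lt p q : (q <= i)%N ->
  \prod_(p <= m < q) (- t2 m) = \prod_(p <= m < q) (- t m).
Proof.
by move=> qi; apply: eq_big_nat => m /andP[_ mq]; rewrite t2o //; lia.
Qed.

Let prod_gt p q : (i.+2 <= p)%N ->
  \prod_(p <= m < q) (- t2 m) = \prod_(p <= m < q) (- t m).
Proof.
by move=> ip; apply: eq_big_nat => m /andP[pm _]; rewrite t2o //; lia.
Qed.

Lemma bP_left_p0 q : (i.+1 < q)%N -> bP S2 t2 i.+1 q * t i.+1 = e * bP S t i q.
Proof.
move=> iq; rewrite /bP [in RHS]big_ltn ?ltnS ?(ltnW iq) // prod_gt //.
by rewrite S21 S2o ?gtn_eqF // ?(ltnW iq) //; ring.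
Qed.

Lemma bP_left_p1 q : (i.+1 < q)%N -> bP S2 t2 i q = - t i * bP S t i.+1 q.
Proof.
move=> iq; rewrite /bP [in LHS]big_ltn ?ltnS ?(ltnW iq) // prod_gt //.
rewrite S20 S2o ?gtn_eqF // ?(ltnW iq) // t21.
set X := \prod_(_ <= _ < _) _.
by rewrite (_ : _ * _ = (e * e) * (- t i * (S i.+1 * S q * X))); [rewrite ee mul1r | ring].
Qed.

Lemma bP_left_q0 p : (p < i)%N -> bP S2 t2 p i.+1 = e * t i.+1 * bP S t p i.
Proof.
move=> pi; rewrite /bP (@big_nat_recr _ _ _ i.+1) /=; last lia.
rewrite !(@big_nat_recr _ _ _ i) //=.
rewrite prod_lt // S21 (S2o (m := p)) ?ltn_eqF //; last exact: ltnW.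
rewrite t20 t21; set X := \prod_(_ <= _ < _) _.
rewrite (_ : _ * _ = (e * e) * (e * t i.+1 * (S p * S i * (X * - t i)))).
  by rewrite ee mul1r.
by ring.
Qed.

Lemma bP_left_q1 p : (p < i)%N -> bP S2 t2 p i * t i = - bP S t p i.+1.
Proof.
move=> pi; rewrite /bP (@big_nat_recr _ _ _ i.+1) /=; last lia.
rewrite !(@big_nat_recr _ _ _ i) //=.
rewrite prod_lt // S20 (S2o (m := p)) ?ltn_eqF //; last exact: ltnW.
rewrite t20; set X := \prod_(_ <= _ < _) _.
rewrite (_ : _ * _ = (e * e) * (- (S p * S i.+1 * (X * - t i * - t i.+1)))).
  by rewrite ee mul1r.
by ring.
Qed.

Lemma bP_left p q : p != i -> p != i.+1 -> q != i -> q != i.+1 ->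
  bP S2 t2 p q = bP S t p q.
Proof.
move=> pi pi1 qi qi1; rewrite /bP !S2o //; congr (_ * _).
have [ip|] := leqP i.+2 p; first by rewrite prod_gt // leqW.
have [iq _|iq ip] := leqP q.+1 i; first by rewrite prod_lt.
have [qp|pq] := leqP q p; first by rewrite !big_geq.
have [p_i i_q] : (p.+1 <= i)%N /\ (i.+2 <= q.+1)%N by split; lia.
have ii2 : (i <= i.+2)%N by lia.
have iq1 : (i <= q.+1)%N by lia.
rewrite !(@big_cat_nat _ _ _ i p.+1 q.+1) //= prod_lt //; congr (_ * _).
rewrite !(@big_cat_nat _ _ _ i.+2 i q.+1) //= (prod_gt (p := i.+2)) //; congr (_ * _).
rewrite !big_nat_recl ?leqnn // !big_geq // t20 t21.
(* Both i and i+1 contribute a factor here, and their two signs cancel. *)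
by transitivity ((e * e) * (- t i * (- t i.+1 * 1))); [ring|rewrite ee mul1r].
Qed.

End Left.

Section Scale.
Variables (S t t2 : nat -> F) (y : F) (i : nat).
Hypotheses (y0 : y != 0) (t20 : t2 i = t i * y) (t21 : t2 i.+1 = t i.+1 / y).
Hypothesis t2o : forall m, m != i -> m != i.+1 -> t2 m = t m.

Let prod_o p q : ((q <= i) || (i.+2 <= p))%N ->
  \prod_(p <= m < q) (- t2 m) = \prod_(p <= m < q) (- t m).
Proof.
by move=> qi; apply: eq_big_nat => m /andP[? mq]; rewrite t2o //; lia.
Qed.

Lemma bP_scale_p0 q : (i < q)%N -> bP S t2 i q * y = bP S t i q.
Proof.
move=> iq; rewrite /bP [in LHS]big_ltn ?ltnS // [in RHS]big_ltn ?ltnS // prod_o ?leqnn ?orbT // t21.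
by field.
Qed.

Lemma bP_scale_q0 p : (p < i)%N -> bP S t2 p i = y * bP S t p i.
Proof.
move=> pi; rewrite /bP !(@big_nat_recr _ _ _ i) //= prod_o ?leqnn // t20.
by ring.
Qed.

(** When neither p nor q is i, the factors at i and i+1 are both in the product or both absent, so y
    and y^-1 cancel. *)
Lemma bP_scale p q : p != i -> q != i -> bP S t2 p q = bP S t p q.
Proof.
move=> pi qi; rewrite /bP; congr (_ * _).
have [ip|pi'] := ltnP i p; first by rewrite prod_o // orbC !ltnS ip.
have [iq|iq] := leqP q.+1 i; first by rewrite prod_o // iq.
have [p_i i_q] : (p.+1 <= i)%N /\ (i.+2 <= q.+1)%N by split; lia.
have ii2 : (i <= i.+2)%N by lia.
have iq1 : (i <= q.+1)%N by lia.
rewrite !(@big_cat_nat _ _ _ i p.+1 q.+1) //= prod_o ?leqnn //; congr (_ * _).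
rewrite !(@big_cat_nat _ _ _ i.+2 i q.+1) //= (prod_o (p := i.+2)) ?leqnn ?orbT //; congr (_ * _).
by rewrite !big_nat_recl ?leqnn // !big_geq // t20 t21; field.
Qed.

End Scale.
End RootProduct.

(** * Uniqueness in the Bruhat decomposition *)

Section BruhatDecomposition.
Variable F : fieldType.
Implicit Types (i j k l m : nat) (s : nat -> nat) (a b : F) (p n q z : St F) (g : E F).

(** The coordinate of a simple root. On U it is a homomorphism to the additive group of F. *)
Definition sup z i : F := Emx (phi F z) i i.+1.

Lemma supM p q i : p \in @stU F -> q \in @stU F ->
  sup (p * q) i = (sup p i + sup q i)%R.
Proof.
move=> /stU_unitri pU /stU_unitri qU; rewrite /sup gmulfM EmxM.
have [n pn] := Emx_finitary (phi F p); set r := maxn n i.+2.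
have [nr ir i1r] : [/\ n <= r, i < r & i.+1 < r]%N by rewrite /r; split; lia.
rewrite (infmx_mulE _ _ pn nr ir) (bigD1 (Ordinal ir)) //=.
rewrite (bigD1 (Ordinal i1r)) /= -?val_eqE ?gtn_eqF //.
rewrite pU // eqxx mul1r (qU i.+1) // eqxx mulr1 big1 ?addr0; first by rewrite addrC.
move=> k; rewrite -!val_eqE /= => /andP[ki ki1].
have [lt_ki|] := ltnP k i; first by rewrite pU ?(ltnW lt_ki) // gtn_eqF ?mul0r.
by move=> le_ik; rewrite qU ?(negPf ki1) ?mulr0 //; lia.
Qed.

Lemma sup1 i : sup 1 i = 0%R.
Proof. by rewrite /sup hom1 Emx1 ltn_eqF. Qed.

Lemma supV p i : p \in @stU F -> sup p^-1 i = (- sup p i)%R.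
Proof.
move=> pU; apply/eqP; rewrite -addr_eq0 -supM ?gpredV //.
by rewrite mulVg sup1.
Qed.

Lemma supX k l a i : k != l ->
  sup (stX k l a) i = (a *+ ((i == k) && (i.+1 == l)))%R.
Proof. by move=> kl; rewrite /sup Emx_phiX // ltn_eqF // add0r. Qed.

(** A relation, not a function: [al i] and [ar j] depend on the chosen decomposition except at the
    neighbours that the permutation inverts. *)
Definition bdec g s (s' : nat -> nat) (d al ar : nat -> F) := exists p n q,
  [/\ p \in @stU F, mono n s s' d, q \in @stU F, g = phi F (p * n * q) &
   (forall i, al i = sup p i) /\ (forall j, ar j = sup q j)].

Lemma bdec_exists g : exists s s' d al ar, bdec g s s' d al ar.
Proof.
have [z <-] := phi_surj g; have [p [n [q [pU nW qU ->]]]] := bruhat_all z.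
have [s [s' [d Mn]]] := stWeyl_mono nW.
by exists s, s', d, (sup p), (sup q), p, n, q.
Qed.

(** Two decompositions give x n = N y with x, y in U. Comparing entries identifies the monomial
    parts; where the permutation inverts two neighbours, the superdiagonal entry of x is matched
    with an entry of y below the diagonal, hence vanishes, and symmetrically for y. *)
Lemma bdec_uniq g s s' d al ar t t' e bl br :
  bdec g s s' d al ar -> bdec g t t' e bl br ->
  [/\ s =1 t, s' =1 t', d =1 e,
      forall i, (s' i.+1 < s' i)%N -> al i = bl i &
      forall j, (s j.+1 < s j)%N -> ar j = br j].
Proof.
move=> [p [n [q [pU Mn qU -> [alE arE]]]]] [P [N [Q [PU MN QU gE [blE brE]]]]].
pose x := P^-1 * p; pose y := Q * q^-1.
have [xU yU] : x \in @stU F /\ y \in @stU F by split; rewrite gpredM ?gpredV.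
have xnNy m k : (Emx (phi F x) m (s k) * d k = e (t' m) * Emx (phi F y) (t' m) k)%R.
  rewrite -(@infmx_mul_col _ _ (Emx (phi F n)) _ _ m k (Emx_finitary _)); last first.
    by move=> l; rewrite (mono_mx Mn).
  rewrite -(@infmx_mul_row _ (Emx (phi F N)) _ _ _ m k (Emx_finitary _)); last first.
    move=> l; rewrite (mono_mx MN) eq_sym (can2_eq (monoK MN) (monoVK MN)).
    by case: eqVneq => [->|_]; rewrite ?mulr0n.
  rewrite -!EmxM -!gmulfM; congr (Emx _ _ _).
  have := congr1 (fun g => phi F P^-1 * g * phi F q^-1) gE.
  rewrite -!gmulfM /= => gE'; rewrite (_ : x * n = P^-1 * (p * n * q) * q^-1).
    by rewrite gE' !mulgA mulVg mul1g.
  by rewrite /x !mulgA mulgK.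
have xT := stU_unitri xU; have yT := stU_unitri yU.
have tsid k : t' (s k) = k.
  apply: (@perm_le_id (t' \o s)) => [|{}k].
    exact: inj_comp (can_inj (monoVK MN)) (can_inj (monoK Mn)).
  rewrite leqNgt; apply/negP => /= lt_k; have := xnNy (s k) k.
  rewrite xT // eqxx mul1r yT ?(ltnW lt_k) // gtn_eqF // mulr0 => /eqP.
  by rewrite (negPf (mono_neq0 Mn k)).
have st : s =1 t by move=> k; rewrite -[LHS](monoVK MN) tsid.
have s't' : s' =1 t'.
  by move=> k; rewrite -[k in RHS](monoVK Mn) tsid.
have de : d =1 e.
  by move=> k; have := xnNy (s k) k; rewrite xT // tsid yT // !eqxx mul1r mulr1.
split=> // [i s'i|j sj].
  have := xnNy i (s' i.+1); rewrite (monoVK Mn) -s't' yT; last exact: ltnW.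
  rewrite gtn_eqF // mulr0 => /eqP; rewrite mulf_eq0 (negPf (mono_neq0 Mn _)) orbF.
  rewrite -/(sup x i) /x supM ?gpredV // supV // -alE -blE addrC subr_eq0.
  by move/eqP.
have := xnNy (s j) j.+1; rewrite xT; last exact: ltnW.
rewrite gtn_eqF // mul0r => /esym/eqP; rewrite tsid mulf_eq0 (negPf (mono_neq0 MN _)).
rewrite -/(sup y j) /y supM ?gpredV // supV // -arE -brE subr_eq0.
by move/eqP.
Qed.

End BruhatDecomposition.

(** * Bruhat data under multiplication by unipotent, torus and Weyl elements *)

Section BruhatMoves.
Variable F : fieldType.
Implicit Types (i j k l m : nat) (s : nat -> nat) (a b : F) (p n q z : St F) (g : E F).

Let n10 : (-1 : F)%R != 0%R. Proof. by rewrite oppr_eq0 oner_eq0. Qed.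
Let n1 : (1 : F)%R != 0%R. Proof. exact: oner_neq0. Qed.
Let ii i : i != i.+1. Proof. by rewrite ltn_eqF. Qed.

Definition wE i : E F := phi F (stW i i.+1 1%R).

Lemma stU_lconjH i j y p : i != j -> y != 0%R -> p \in @stU F ->
  lconj (stH i j y) p \in @stU F.
Proof.
move=> ij y0 pU; have Mh := mono_H ij y0.
apply: (generated_ind (P := fun p => lconj (stH i j y) p \in @stU F) _ _ _ pU).
- move=> _ [k [l [a [kl ->]]]]; exists k, l, (- a)%R.
  by rewrite stXN // ltn_eqF.
- move=> _ q [k [l [a [kl ->]]]] qU; rewrite lconjM gpredM //.
  by rewrite (monoX Mh) ?ltn_eqF // stX_stU.
- by rewrite lconj1 gpred1.
Qed.

Lemma sup_Ui i z : z \in generated (@stUi_gen F i) -> sup z i = 0%R.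
Proof.
move=> zU; suff [] : z \in @stU F /\ sup z i = 0%R by [].
apply: (generated_ind (P := fun z => z \in @stU F /\ sup z i = 0%R)
  (@stUi_genV F i) _ _ zU); last by rewrite gpred1 sup1.
move=> _ y [k [l [a [kl kli ->]]]] [yU yi]; split.
  by rewrite gpredM // stX_stU.
have kl' : k != l by rewrite ltn_eqF.
rewrite supM ?stX_stU // supX // yi addr0.
by rewrite (eq_sym i) (eq_sym i.+1); case: eqP kli; case: eqP.
Qed.

Let neq k l : (k < l)%N -> k != l. Proof. by move=> kl; rewrite ltn_eqF. Qed.

Section Moves.
Variables (g : E F) (s s' : nat -> nat) (d al ar : nat -> F).
Hypothesis Bg : bdec g s s' d al ar.

Lemma bdec_UL p : p \in @stU F -> exists al1, bdec (phi F p * g) s s' d al1 ar.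
Proof.
move=> pU; have [p0 [n [q [p0U Mn qU -> [_ arE]]]]] := Bg.
exists (sup (p * p0)), (p * p0), n, q; split=> //; first exact: gpredM.
by rewrite -gmulfM !mulgA.
Qed.

Lemma bdec_UR q : q \in @stU F -> exists ar1, bdec (g * phi F q) s s' d al ar1.
Proof.
move=> qU; have [p [n [q0 [pU Mn q0U -> [alE _]]]]] := Bg.
exists (sup (q0 * q)), p, n, (q0 * q); split=> //; first exact: gpredM.
by rewrite -gmulfM !mulgA.
Qed.

Lemma bdec_T i y : y != 0%R -> exists al1,
  bdec (phi F (stH i i.+1 y) * g) s s' (fun k => d k * hd i i.+1 y (s k))%R al1 ar.
Proof.
move=> y0; have [p [n [q [pU Mn qU -> [_ arE]]]]] := Bg.
set h := stH i i.+1 y; exists (sup (lconj h p)), (lconj h p), (h * n), q.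
split=> //; first exact: stU_lconjH.
  exact: monoM (mono_H (ii i) y0) Mn.
by rewrite -gmulfM !mulgA -mulg_lconj.
Qed.

Section Left.
Variable i : nat.
Let s2 := sw i i.+1 \o s.
Let s2' := s' \o sw i i.+1.
Let d2 := fun k => (d k * wd i i.+1 1 (s k))%R.

(** The permutation gets longer. The element x_(i,i+1)(a) crosses n and lands in U with indices s' i
    < s' i.+1, where [sup] sees it only if these are neighbours. *)
Lemma bdec_LA : (s' i < s' i.+1)%N -> exists al1 ar1,
  bdec (wE i * g) s2 s2' d2 al1 ar1 /\
  forall j, ar1 j = (ar j + (al i * d (s' i.+1) / d (s' i)) *+
    ((j == s' i) && (j.+1 == s' i.+1)))%R.
Proof.
move=> si; have [p [n [q [pU Mn qU -> [alE arE]]]]] := Bg.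
have [a [w [wU pE]]] := stU_decomp i pU.
have ai : al i = a.
  rewrite alE pE supM ?stX_stU // ?(stUi_sub wU) // sup_Ui // supX //.
  by rewrite !eqxx add0r.
set W := stW i i.+1 (1 : F)%R; set x := lconj n^-1 (stX i i.+1 a).
have xE : x = stX (s' i) (s' i.+1) (a * d (s' i.+1) / d (s' i))%R.
  by rewrite /x (monoX (monoV Mn)) // invrK; congr stX; ring.
have xU : x \in @stU F by rewrite xE stX_stU.
have nx : x * q \in @stU F by rewrite gpredM.
exists (sup (lconj W w)), (sup (x * q)); split.
  exists (lconj W w), (W * n), (x * q); split=> //.
  - exact: stUi_lconjW.
  - exact: monoM (mono_W (ii i) n1) Mn.
  - rewrite /wE -gmulfM pE; congr (phi F _).
    rewrite !mulgA -mulg_lconj -(mulgA _ n x) /x -mulg_lconjV.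
    by rewrite !mulgA.
move=> j; rewrite supM // xE supX ?neq // -?arE ?ai addrC; congr (_ + _)%R.
Qed.

Lemma bdec_LB0 : al i = 0%R -> exists al1, bdec (wE i * g) s2 s2' d2 al1 ar.
Proof.
have [p [n [q [pU Mn qU -> [alE arE]]]]] := Bg => ai0.
have [a [w [wU pE]]] := stU_decomp i pU.
have ai : al i = a.
  rewrite alE pE supM ?stX_stU // ?(stUi_sub wU) // sup_Ui // supX //.
  by rewrite !eqxx add0r.
rewrite -ai ai0 stX0 // mulg1 in pE.
set W := stW i i.+1 (1 : F)%R; exists (sup (lconj W w)), (lconj W w), (W * n), q.
split=> //; first exact: stUi_lconjW.
  exact: monoM (mono_W (ii i) n1) Mn.
by rewrite /wE -gmulfM pE; congr (phi F _); rewrite !mulgA -mulg_lconj.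
Qed.

(** The permutation does not change: with b = a^-1, w_i conjugates x_(i,i+1)(a) to x_(i+1,i)(-b^-1)
    = x(-b) w(b) x(-b), and w(b) w(1) has the matrix of h(-b). *)
Lemma bdec_LB1 b : (s' i.+1 < s' i)%N -> al i != 0%R -> b = (al i)^-1%R ->
  exists al1 ar1,
  bdec (wE i * g) s s' (fun k => d k * hd i i.+1 (- b) (s k))%R al1 ar1 /\
  forall j, ar1 j = (ar j + (b * d (s' i) / d (s' i.+1)) *+
    ((j == s' i.+1) && (j.+1 == s' i)))%R.
Proof.
have [p [n [q [pU Mn qU -> [alE arE]]]]] := Bg => si ai0 bE.
have [a [w [wU pE]]] := stU_decomp i pU.
have ai : al i = a.
  rewrite alE pE supM ?stX_stU // ?(stUi_sub wU) // sup_Ui // supX //.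
  by rewrite !eqxx add0r.
have b0 : b != 0%R by rewrite bE invr_eq0.
have aE : a = b^-1%R by rewrite bE invrK.
set W := stW i i.+1 (1 : F)%R; have MWn := monoM (mono_W (ii i) n1) Mn.
set x := lconj (W * n)^-1 (stX i i.+1 (- b)%R).
have xE : x = stX (s' i.+1) (s' i) (b * d (s' i) / d (s' i.+1))%R.
  rewrite /x (monoX (monoV MWn)) //= swl swr !(monoVK Mn) wdl wdr.
  by rewrite mulr1 mulrN1 !invrN !invrK; congr stX; ring.
have xU : x \in @stU F by rewrite xE stX_stU.
exists (sup (lconj W w * stX i i.+1 (- b)%R)), (sup (x * q)); split.
  exists (lconj W w * stX i i.+1 (- b)%R), (stW i i.+1 b * (W * n)), (x * q).
  split=> //.
  - by rewrite gpredM ?stX_stU // stUi_lconjW.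
  - apply: (eq_mono (monoM (mono_W (ii i) b0) MWn)) => k /=.
    + by rewrite swK.
    + by rewrite swK.
    + rewrite -mulrA; congr (_ * _)%R.
      rewrite /wd /hd /sw; have [_|ki] := eqVneq (s k) i.
        by rewrite gtn_eqF // eqxx invr1 mulN1r.
      have [_|ki1] := eqVneq (s k) i.+1; first by rewrite eqxx mul1r invrN.
      by rewrite (negPf ki) (negPf ki1) mul1r.
  - by rewrite gpredM.
  - rewrite /wE -gmulfM pE; congr (phi F _).
    have Wx : W * n * x = stX i i.+1 (- b)%R * (W * n) by rewrite [RHS]mulg_lconjV.
    have Wa : W * stX i i.+1 a = stX i.+1 i (- b^-1)%R * W.
      by rewrite mulg_lconj lconjW_ij // invr1 !mulr1 aE.
    have WbE : stX i i.+1 (- b)%R * stW i i.+1 b * stX i i.+1 (- b)%R =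
        stX i.+1 i (- b^-1)%R.
      by rewrite stW_def !mulgA -stXD // addNr stX0 // mul1g (stXN b) // mulgK.
    transitivity (lconj W w * (W * stX i i.+1 a) * n * q).
      by rewrite !mulgA -mulg_lconj.
    by rewrite Wa -WbE !mulgA -[in RHS](mulgA _ W n) -[in RHS](mulgA _ (W * n)) Wx !mulgA.
move=> j; rewrite supM // xE supX ?neq // -arE addrC; congr (_ + _)%R.
Qed.

End Left.

Section Right.
Variable j : nat.
Let s2 := s \o sw j j.+1.
Let s2' := sw j j.+1 \o s'.
Let d2 := fun k => (wd j j.+1 1 k * d (sw j j.+1 k))%R.

Lemma stU_decompr q : q \in @stU F -> exists a w,
  [/\ w \in generated (@stUi_gen F j), q = stX j j.+1 a * w & sup q j = a].
Proof.
move=> qU; have [a [w [wU qE]]] := stU_decomp j (gpredVr _ qU).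
have qE' : q = stX j j.+1 (- a)%R * w^-1.
  by rewrite stXN // -invgM -qE invgK.
exists (- a)%R, w^-1; rewrite gpredV; split=> //.
rewrite qE' supM ?stX_stU // ?gpredV ?(stUi_sub wU) // supV ?(stUi_sub wU) //.
by rewrite (sup_Ui wU) oppr0 addr0 supX // !eqxx.
Qed.

Let WV : (stW j j.+1 (1 : F)%R)^-1 = stW j j.+1 (-1)%R.
Proof. exact: stWV. Qed.

Lemma bdec_RA : (s j < s j.+1)%N -> exists al1 ar1,
  bdec (g * wE j) s2 s2' d2 al1 ar1 /\
  forall i, al1 i = (al i + (ar j * d j / d j.+1) *+
    ((i == s j) && (i.+1 == s j.+1)))%R.
Proof.
move=> sj; have [p [n [q [pU Mn qU -> [alE arE]]]]] := Bg.
have [a [w [wU qE aE]]] := stU_decompr qU; rewrite -arE in aE.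
set W := stW j j.+1 (1 : F)%R; set x := lconj n (stX j j.+1 a).
have xE : x = stX (s j) (s j.+1) (a * d j / d j.+1)%R.
  by rewrite /x (monoX Mn) // (mulrC (d j)).
have xU : x \in @stU F by rewrite xE stX_stU.
exists (sup (p * x)), (sup (lconj W^-1 w)); split.
  exists (p * x), (n * W), (lconj W^-1 w); split=> //.
  - by rewrite gpredM.
  - exact: monoM Mn (mono_W (ii j) n1).
  - by rewrite WV stUi_lconjW.
  - rewrite /wE -gmulfM qE; congr (phi F _).
    by rewrite -!mulgA -mulg_lconjV !mulgA -(mulgA p x n) /x -mulg_lconj !mulgA.
by move=> i; rewrite supM // xE supX ?neq // -alE aE.
Qed.

Lemma bdec_RB0 : ar j = 0%R -> exists ar1, bdec (g * wE j) s2 s2' d2 al ar1.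
Proof.
have [p [n [q [pU Mn qU -> [alE arE]]]]] := Bg => aj0.
have [a [w [wU qE aE]]] := stU_decompr qU.
rewrite -aE -arE aj0 stX0 // mul1g in qE.
set W := stW j j.+1 (1 : F)%R; exists (sup (lconj W^-1 w)), p, (n * W), (lconj W^-1 w).
split=> //.
- exact: monoM Mn (mono_W (ii j) n1).
- by rewrite WV stUi_lconjW.
- rewrite /wE -gmulfM qE; congr (phi F _).
  by rewrite -!mulgA -mulg_lconjV.
Qed.

(** Mirror image of [bdec_LB1]. The diagonal matrix now comes from w(1) w(b), whence the argument
    -b^-1. *)
Lemma bdec_RB1 b : (s j.+1 < s j)%N -> ar j != 0%R -> b = (ar j)^-1%R ->
  exists al1 ar1,
  bdec (g * wE j) s s' (fun k => d k * hd j j.+1 (- b^-1) k)%R al1 ar1 /\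
  forall i, al1 i = (al i + (b * d j.+1 / d j) *+
    ((i == s j.+1) && (i.+1 == s j)))%R.
Proof.
have [p [n [q [pU Mn qU -> [alE arE]]]]] := Bg => sj aj0 bE.
have [a [w [wU qE aE]]] := stU_decompr qU; rewrite -arE in aE.
have b0 : b != 0%R by rewrite bE invr_eq0.
have ab : a = b^-1%R by rewrite bE invrK.
set W := stW j j.+1 (1 : F)%R; have MnW := monoM Mn (mono_W (ii j) n1).
set x := lconj (n * W) (stX j j.+1 (- b)%R).
have xE : x = stX (s j.+1) (s j) (b * d j.+1 / d j)%R.
  rewrite /x (monoX MnW) //= swl swr wdl wdr mul1r.
  by congr stX; ring.
have xU : x \in @stU F by rewrite xE stX_stU.
have wU' : lconj W^-1 w \in @stU F by rewrite WV stUi_lconjW.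
exists (sup (p * x)), (sup (stX j j.+1 (- b)%R * lconj W^-1 w)); split.
  exists (p * x), (n * W * stW j j.+1 b), (stX j j.+1 (- b)%R * lconj W^-1 w).
  split=> //.
  - by rewrite gpredM.
  - apply: (eq_mono (monoM MnW (mono_W (ii j) b0))) => k /=.
    + by rewrite swK.
    + by rewrite swK.
    + rewrite swK mulrA mulrC; congr (_ * _)%R.
      rewrite /wd /hd /sw; have [_|kj] := eqVneq k j.
        by rewrite gtn_eqF // eqxx mulr1.
      have [_|kj1] := eqVneq k j.+1.
        by rewrite eqxx invr1 mulrN1 invrN invrK.
      by rewrite (negPf kj) (negPf kj1) mulr1.
  - by rewrite gpredM ?stX_stU.
  - rewrite /wE -gmulfM qE; congr (phi F _).
    have nx : x * n * W = n * W * stX j j.+1 (- b)%R.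
      by rewrite (mulg_lconj (n * W)) !mulgA.
    have Wa : stX j j.+1 a * W = W * stX j.+1 j (- b^-1)%R.
      rewrite (mulg_lconjV W) WV lconjW_ij //.
      by rewrite invrN invr1 !mulrN1 opprK ab.
    have WbE : stX j j.+1 (- b)%R * stW j j.+1 b * stX j j.+1 (- b)%R =
        stX j.+1 j (- b^-1)%R.
      by rewrite stW_def !mulgA -stXD // addNr stX0 // mul1g (stXN b) // mulgK.
    transitivity (p * n * (stX j j.+1 a * W) * lconj W^-1 w).
      by rewrite !mulgA -(mulgA _ w W) (mulg_lconjV W w) !mulgA.
    rewrite Wa -WbE !mulgA -[in RHS](mulgA p x) -[in RHS](mulgA p _ W) nx.
    by rewrite !mulgA.
by move=> i; rewrite supM // xE supX ?neq // -alE.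
Qed.

End Right.
End Moves.
End BruhatMoves.

Lemma sw_lt i a b : (a, b) != (i, i.+1) -> (a < b)%N -> (sw i i.+1 a < sw i i.+1 b)%N.
Proof.
rewrite xpair_eqE negb_and /sw => ab.
by case: (a =P i); case: (a =P i.+1); case: (b =P i); case: (b =P i.+1); move: ab; lia.
Qed.

Section Cocycle.
Variables (F : fieldType) (A : zmodType) (c : F -> F -> A).
Hypothesis cS : symbol c.
Implicit Types (i j k l m : nat) (s : nat -> nat) (g : E F).
Local Open Scope ring_scope.

(* Matsumoto's operators on [E F * A]: [lam i] is the cocycle of the left
   action of [wE i] and [rho j] that of the right action of [wE j].  The
   formulas are solutions of [commutation] and [tor_wE]; the terms
   [c (-1) _] have order 2 and only account for the signs in the lifts of the
   permutations. *)
Definition lamf (r : bool) (a t0 t1 : F) : A :=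
  if ~~ r then c t1 (- t0)
  else if a == 0 then c t1 (- t0) + c t0 (-1) + c (-1) (-1)
  else c a^-1 (-1) + c (- a^-1) t0 + c (-1) (-1).

(** With the value 1 at 0, the factor [- inv1 (ar j)] describes the change of the torus part under
    w_j in both cases of an inversion: the sign -1 of w_j^2 when [ar j] is 0, and the rescaling of
    [bdec_RB1] otherwise. *)
Definition inv1 (a : F) : F := if a == 0 then 1 else a^-1.

Definition rhof (r : bool) (a P : F) : A :=
  if ~~ r then 0 else c (-1) (inv1 a) - c P (- inv1 a) + c (-1) (-1).

Lemma inv1_neq0 a : inv1 a != 0.
Proof.
rewrite /inv1; case: ifP => [_|/negbT]; first exact: oner_neq0.
by rewrite invr_eq0.
Qed.

Definition bdata := ((nat -> nat) * (nat -> nat) * (nat -> F) * (nat -> F) * (nat -> F))%type.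

Definition is_bdata g (x : bdata) :=
  bdec g x.1.1.1.1 x.1.1.1.2 x.1.1.2 x.1.2 x.2.

Lemma bdata_exists g : exists x, is_bdata g x.
Proof.
by have [s [s' [d [al [ar H]]]]] := bdec_exists g; exists (s, s', d, al, ar).
Qed.

Definition bdata_of g : bdata := sval (cid (bdata_exists g)).

Lemma bdata_ofP g : is_bdata g (bdata_of g).
Proof. exact: svalP (cid (bdata_exists g)). Qed.

Definition lamv i (s' : nat -> nat) (d al : nat -> F) : A :=
  lamf (s' i.+1 < s' i)%N (al i) (bt s' d i) (bt s' d i.+1).

Definition rhov j s (s' : nat -> nat) (d ar : nat -> F) : A :=
  rhof (s j.+1 < s j)%N (ar j) (bP (bS F s') (bt s' d) (s j.+1) (s j)).

Definition lam i g : A :=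
  let x := bdata_of g in lamv i x.1.1.1.2 x.1.1.2 x.1.2.

Definition rho j g : A :=
  let x := bdata_of g in rhov j x.1.1.1.1 x.1.1.1.2 x.1.1.2 x.2.

(** The function attached to the left action of h_(i,i+1)(y), as [lam] is to that of w_i. *)
Definition tor i (y : F) g : A :=
  let x := bdata_of g in c y (bt x.1.1.1.2 x.1.1.2 i).

Section Values.
Variables (g : E F) (s s' : nat -> nat) (d al ar : nat -> F).
Hypothesis Bg : bdec g s s' d al ar.

(** The chosen decomposition is immaterial: [lamf] reads the superdiagonal entry only where
    [bdec_uniq] determines it. *)
Lemma lamE i : lam i g = lamv i s' d al.
Proof.
have [_ /funext s'E /funext dE alE _] := bdec_uniq (bdata_ofP g) Bg.
rewrite /lam /lamv s'E dE /lamf; case: ltnP => //= si.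
by rewrite alE ?s'E.
Qed.

Lemma rhoE j : rho j g = rhov j s s' d ar.
Proof.
have [/funext sE /funext s'E /funext dE _ arE] := bdec_uniq (bdata_ofP g) Bg.
rewrite /rho /rhov sE s'E dE /rhof; case: ltnP => //= sj.
by rewrite arE ?sE.
Qed.

Lemma torE i y : tor i y g = c y (bt s' d i).
Proof.
have [_ /funext s'E /funext dE _ _] := bdec_uniq (bdata_ofP g) Bg.
by rewrite /tor s'E dE.
Qed.

Lemma bdec_mono : [/\ cancel s s', cancel s' s & forall k, d k != 0].
Proof.
have [p [n [q [_ Mn _ _ _]]]] := Bg.
by split; [exact: monoK Mn | exact: monoVK Mn | exact: mono_neq0 Mn].
Qed.

End Values.

Section Moves.
Variables (g : E F) (s s' : nat -> nat) (d al ar : nat -> F).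
Hypothesis Bg : bdec g s s' d al ar.

Let sK : cancel s s'. Proof. by case: (bdec_mono Bg). Qed.
Let s'K : cancel s' s. Proof. by case: (bdec_mono Bg). Qed.
Let d0 k : d k != 0. Proof. by case: (bdec_mono Bg). Qed.
Let t := bt s' d.
Let t0 m : t m != 0. Proof. exact: bt_neq0. Qed.

Definition scale p q (y : F) (f : nat -> F) m :=
  if m == p then f m * y else if m == q then f m / y else f m.

Lemma scale_l p q y f : scale p q y f p = f p * y.
Proof. by rewrite /scale eqxx. Qed.

Lemma scale_r p q y f : p != q -> scale p q y f q = f q / y.
Proof. by move=> pq; rewrite /scale eqxx eq_sym (negPf pq). Qed.

Lemma scale_o p q y f m : m != p -> m != q -> scale p q y f m = f m.
Proof. by move=> mp mq; rewrite /scale (negPf mp) (negPf mq). Qed.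

Lemma bt_scale_L i y m : y != 0 ->
  bt s' (fun k => d k * hd i i.+1 y (s k)) m = scale i i.+1 y t m.
Proof.
move=> y0; rewrite /bt /scale /hd s'K; case: ifP => _; first by rewrite mulrAC.
by case: ifP => _; rewrite ?mulr1 // mulrAC.
Qed.

Lemma bt_scale_R j y m : y != 0 ->
  bt s' (fun k => d k * hd j j.+1 y^-1 k) m = scale (s j.+1) (s j) y t m.
Proof.
move=> y0; rewrite /bt /scale /hd !(can2_eq s'K sK).
case: (eqVneq m (s j)) => [->|_].
  by rewrite (inj_eq (can_inj sK)) ltn_eqF // mulrAC.
by case: ifP => _; rewrite ?mulr1 // invrK mulrAC.
Qed.

Lemma eq_bP S f h p q : f =1 h -> bP S f p q = bP S h p q :> F.
Proof. by move=> /funext ->. Qed.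

Lemma bt_RA j m : (s j < s j.+1)%N ->
  bt (sw j j.+1 \o s') (fun k => wd j j.+1 1 k * d (sw j j.+1 k)) m = t m.
Proof.
move=> sj; have e1 : (-1) ^+ (s j.+1 < s j)%N = 1 :> F by rewrite ltnNge ltnW.
have [->|mj] := eqVneq m (s j); first by rewrite bt_right0 // e1 mulr1.
have [->|mj1] := eqVneq m (s j.+1); first by rewrite bt_right1 // e1 mulr1.
exact: bt_right.
Qed.

Lemma bt_RB j m : (s j.+1 < s j)%N ->
  bt (sw j j.+1 \o s') (fun k => wd j j.+1 1 k * d (sw j j.+1 k)) m =
  scale (s j.+1) (s j) (-1) t m.
Proof.
move=> sj; have e1 : (-1) ^+ (s j.+1 < s j)%N = -1 :> F by rewrite sj.
rewrite /scale invrN invr1; have [->|mj1] := eqVneq m (s j.+1).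
  by rewrite bt_right1 // e1.
by have [->|mj] := eqVneq m (s j); [rewrite bt_right0 // e1 | apply: bt_right].
Qed.

Section Commutation.
Variables i j : nat.
Let r := (s' i.+1 < s' i)%N.

Let sN k l : (s k == l) = (k == s' l).
Proof. exact: can2_eq. Qed.

Let lt_s : (s' i.+1 < s' i)%N = false -> (s' i < s' i.+1)%N.
Proof. by move=> ri; rewrite (lt_s'N _ s'K) ri. Qed.

Lemma rho_left_lt : (s j < s j.+1)%N -> (s j, s j.+1) != (i, i.+1) ->
  rho j (wE F i * g)%g = 0.
Proof.
move=> sj nij; have sw_sj := sw_lt nij sj.
case: (boolP r) => [ri|/negPf/lt_s ri]; last first.
  have [al1 [ar1 [B _]]] := bdec_LA Bg ri.
  by rewrite (rhoE B) /rhov ltnNge ltnW.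
have [a0|a0] := eqVneq (al i) 0.
  have [al1 B] := bdec_LB0 Bg a0.
  by rewrite (rhoE B) /rhov ltnNge ltnW.
have [al1 [ar1 [B _]]] := bdec_LB1 Bg ri a0 erefl.
by rewrite (rhoE B) /rhov ltnNge ltnW.
Qed.

Lemma rho_left_gt : (s j.+1 < s j)%N -> (s j.+1, s j) != (i, i.+1) ->
  rho j (wE F i * g)%g = rhof true (ar j)
    (if ~~ r || (al i == 0) then
       bP (bS F (s' \o sw i i.+1))
         (bt (s' \o sw i i.+1) (fun k => d k * wd i i.+1 1 (s k)))
         (sw i i.+1 (s j.+1)) (sw i i.+1 (s j))
     else bP (bS F s') (scale i i.+1 (- (al i)^-1) t) (s j.+1) (s j)).
Proof.
move=> sj nij; have sw_sj := sw_lt nij sj.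
case: (boolP r) => [ri|/negPf/lt_s ri] /=; last first.
  have [al1 [ar1 [B arE]]] := bdec_LA Bg ri.
  rewrite (rhoE B) /rhov /= sw_sj arE -!sN.
  by case: eqP sj => [->|_]; case: eqP => [->|_]; rewrite ?addr0 //; lia.
have [a0|a0] := eqVneq (al i) 0.
  have [al1 B] := bdec_LB0 Bg a0.
  by rewrite (rhoE B) /rhov /= sw_sj.
have [al1 [ar1 [B arE]]] := bdec_LB1 Bg ri a0 erefl.
rewrite (rhoE B) /rhov sj arE -!sN.
rewrite (eq_bP _ _ _ (fun m => bt_scale_L i m _)) ?oppr_eq0 ?invr_eq0 //.
move: nij; rewrite xpair_eqE andbC => /negPf ->.
by rewrite addr0.
Qed.

Lemma lam_right_lt : (s j < s j.+1)%N -> (s j, s j.+1) != (i, i.+1) ->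
  lam i (g * wE F j)%g = lam i g.
Proof.
move=> sj nij; have [al1 [ar1 [B alE]]] := bdec_RA Bg sj.
rewrite (lamE B) (lamE Bg) /lamv !bt_RA // alE.
rewrite (_ : (i == s j) && (i.+1 == s j.+1) = false) ?addr0; last first.
  by move: nij; rewrite xpair_eqE ![_ == s _]eq_sym => /negPf.
congr lamf; apply/idP/idP => /=.
  apply: contraLR; rewrite -!leqNgt leq_eqVlt (inj_eq (can_inj s'K)) ltn_eqF //=.
  move=> ri; apply/ltnW/sw_lt => //; apply: contra nij.
  by move=> /eqP[e1 e2]; rewrite -e2 -e1 !s'K eqxx.
move=> ri; apply: sw_lt => //; apply/negP => /eqP[e1 e2].
by move: sj; rewrite -e2 -e1 !s'K; lia.
Qed.

Lemma lam_right_gt : (s j.+1 < s j)%N -> (s j.+1, s j) != (i, i.+1) ->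
  let y := - inv1 (ar j) in
  lam i (g * wE F j)%g = lamf r (al i) (scale (s j.+1) (s j) y t i)
    (scale (s j.+1) (s j) y t i.+1).
Proof.
move=> sj nij /=; rewrite /inv1; have [a0|a0] := eqVneq (ar j) 0.
  have [ar1 B] := bdec_RB0 Bg a0.
  rewrite (lamE B) /lamv !bt_RB //; congr lamf; apply/idP/idP => /=.
    apply: contraLR; rewrite -!leqNgt leq_eqVlt (inj_eq (can_inj s'K)) ltn_eqF //=.
    move=> ri; apply/ltnW/sw_lt => //; apply/negP => /eqP[e1 e2].
    by move: sj; rewrite -e2 -e1 !s'K; lia.
  move=> ri; apply: sw_lt => //; apply: contra nij.
  by move=> /eqP[e1 e2]; rewrite -e2 -e1 !s'K eqxx.
have [al1 [ar1 [B alE]]] := bdec_RB1 Bg sj a0 erefl.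
rewrite (lamE B) /lamv alE -invrN.
rewrite !bt_scale_R ?oppr_eq0 ?invr_eq0 //.
rewrite (_ : (i == s j.+1) && (i.+1 == s j) = false) ?addr0 //.
by move: nij; rewrite xpair_eqE ![_ == s _]eq_sym => /negPf.
Qed.

End Commutation.

End Moves.
End Cocycle.

Lemma binv_special_lt (s' : nat -> nat) i j : injective s' -> s' i = j ->
  s' i.+1 = j.+1 -> binv s' i.+1 = binv s' i.
Proof.
move=> inj si si1; rewrite /binv big_nat_recr //= si si1 ltnNge leqnSn addn0.
apply: eq_big_nat => k /andP[_ ki]; congr nat_of_bool.
rewrite [RHS]leq_eqVlt orbC; case: eqP => [|_]; last by rewrite orbF.
by rewrite -si1 => /inj kE; move: ki; rewrite -kE ltnNge leqnSn.
Qed.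

Lemma binv_special_gt (s' : nat -> nat) i j : injective s' -> s' i = j.+1 ->
  s' i.+1 = j -> binv s' i.+1 = (binv s' i).+1.
Proof.
move=> inj si si1; rewrite /binv big_nat_recr //= si si1 ltnSn addn1; congr _.+1.
apply: eq_big_nat => k /andP[_ ki]; congr nat_of_bool.
rewrite [LHS]leq_eqVlt orbC; case: eqP => [|_]; last by rewrite orbF.
by rewrite -si => /inj kE; move: ki; rewrite -kE ltnn.
Qed.

(** * Symbol identities for the rank-one cases *)

Section Identities.
Variables (F : fieldType) (A : zmodType) (c : F -> F -> A).
Hypothesis cS : symbol c.
Local Open Scope ring_scope.

(** The case where w_i and w_j act on n as the same transposition and lengthen it; x is the
    superdiagonal entry of the right factor after the left move. *)
Lemma special_lt_id (t0 t1 x : F) : t0 != 0 -> t1 != 0 ->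
  c t1 (- t0) + rhof c true x t0 = lamf c true (x * t0 / t1) t0 t1.
Proof.
move=> h0 h1; rewrite /lamf /rhof /inv1 /=.
have [->|x0] := eqVneq x 0; first by rewrite !mul0r eqxx; sym_solve cS.
have -> : (x * t0 / t1 == 0) = false by rewrite !mulf_eq0 invr_eq0 (negPf x0) (negPf h0) (negPf h1).
rewrite !invfM invrK; sym_solve cS.
Qed.

(* The relation coming from [SL_2]: this is where the Steinberg identity
   [c u (1 - u) = 0] is needed. *)
Lemma special_gt_id (t0 t1 a x : F) : t0 != 0 -> t1 != 0 ->
  lamf c true a t0 t1 +
    (if a == 0 then 0
     else rhof c true (x - a^-1 * t0 / t1) (- (t1 * a))) =
  rhof c true x t1 +
    (if x == 0 then lamf c false a (- t0) (- t1)
     else lamf c true (a - x^-1 * t0 / t1) (- x^-1 * t0) (- x * t1)).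
Proof.
move=> h0 h1; rewrite /lamf /rhof /inv1 /=.
have [a00|a0] := eqVneq a 0; have [x00|x0] := eqVneq x 0.
- sym_solve cS.
- rewrite a00 add0r oppr_eq0 !mulf_eq0 !invr_eq0 (negPf x0) (negPf h0) (negPf h1) /=.
  rewrite !invrN !invfM !invrK; sym_solve cS.
- rewrite x00 add0r oppr_eq0 !mulf_eq0 !invr_eq0 (negPf a0) (negPf h0) (negPf h1) /=.
  rewrite !invrN !invfM !invrK; sym_solve cS.
(* The parameter of the Steinberg relation: the entries after the left and the right move are x and
   a multiplied by the same 1 - u. *)
pose u := t0 / (t1 * a * x); have u0 : u != 0 by rewrite !mulf_neq0 ?invr_eq0 ?mulf_neq0.
have -> : x - a^-1 * t0 / t1 = x * (1 - u) by rewrite /u; field; rewrite x0 a0 h1.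
have -> : a - x^-1 * t0 / t1 = a * (1 - u) by rewrite /u; field; rewrite x0 a0 h1.
rewrite !mulf_eq0 (negPf a0) (negPf x0) /=.
have [v0|v0] := eqVneq (1 - u) 0.
  have -> : t0 = t1 * a * x.
    have /eqP := v0; rewrite subr_eq0 => /eqP u1.
    by rewrite -[LHS](divfK (_ : t1 * a * x != 0)) ?mulf_neq0 // -/u -u1 mul1r.
  sym_solve cS.
have := sym1B cS u0 v0; move: v0; set v := 1 - u => v0 cuv.
have {}cuv : c t0 v - c t1 v - c a v - c x v = 0.
  by rewrite -cuv /u; sym_solve cS.
(* The expanded Steinberg relation is inserted as a zero; from here on v is an independent
   variable. *)
rewrite -[LHS]addr0 -cuv; clearbody v; sym_solve cS.
Qed.

End Identities.

Ltac abstract_solve cS t t0 i P b :=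
  clearbody P b; move: (t0 i) (t0 i.+1); move: (t i) (t i.+1) => ? ? ? ?;
  sym_solve cS.

(** * Left and right operators commute *)

Section Commutation.
Variables (F : fieldType) (A : zmodType) (c : F -> F -> A).
Hypothesis cS : symbol c.
Local Open Scope ring_scope.
Implicit Types (g : E F).

Section Data.
Variables (g : E F) (s s' : nat -> nat) (d al ar : nat -> F).
Hypothesis Bg : bdec g s s' d al ar.
Variables i j : nat.

Let sK : cancel s s'. Proof. by case: (bdec_mono Bg). Qed.
Let s'K : cancel s' s. Proof. by case: (bdec_mono Bg). Qed.
Let d0 k : d k != 0. Proof. by case: (bdec_mono Bg). Qed.
Let t := bt s' d.
Let S := bS F s'.
Let t0 m : t m != 0. Proof. exact: bt_neq0. Qed.
Let S0 m : S m != 0. Proof. exact: bS_neq0. Qed.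

Let bP1 (f h : nat -> F) : bP f h i i.+1 = f i * f i.+1 * (- h i.+1).
Proof. by rewrite /bP big_nat1. Qed.

Lemma commutation_special_lt : s j = i -> s j.+1 = i.+1 ->
  lam c i g + rho c j (wE F i * g)%g = rho c j g + lam c i (g * wE F j)%g.
Proof.
move=> sj sj1; have [si si1] : s' i = j /\ s' i.+1 = j.+1 by rewrite -sj1 -sj !sK.
have lt_si : (s' i < s' i.+1)%N by rewrite si si1.
have lt_sj : (s j < s j.+1)%N by rewrite sj sj1.
have SE : S i.+1 = S i.
  by rewrite /S /bS (binv_special_lt (can_inj s'K) si si1).
have e1 : (-1) ^+ (s' i.+1 < s' i)%N = 1 :> F by rewrite ltnNge ltnW.
have [al1 [ar1 [BL arE]]] := bdec_LA Bg lt_si.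
have [al2 [ar2 [BR alE]]] := bdec_RA Bg lt_sj.
rewrite (lamE c Bg) (rhoE c BL) (rhoE c Bg) (lamE c BR) /lamv /rhov.
rewrite !(bt_RA Bg) // /= sj sj1 si si1 swl swr !ltnSn [(j.+1 < j)%N]ltnNge leqnSn /=.
rewrite [(i.+1 < i)%N]ltnNge leqnSn bP1.
rewrite bS_left0 (bS_left1 _ _ s'K) (bt_left1 _ _ s'K) e1 !mulr1 -/S -/t SE.
rewrite !(mulrN, mulNr) opprK /S bS_sqr mul1r {1}/rhof /= add0r.
have -> : al2 i = ar1 j * t i / t i.+1.
  rewrite arE alE sj sj1 si si1 !eqxx !mulr1n /t /bt si si1 -/S SE.
  by field; rewrite !d0 S0.
by rewrite swl swr ltnSn; apply: special_lt_id.
Qed.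

Lemma commutation_special_gt : s j = i.+1 -> s j.+1 = i ->
  lam c i g + rho c j (wE F i * g)%g = rho c j g + lam c i (g * wE F j)%g.
Proof.
move=> sj sj1; have [si si1] : s' i = j.+1 /\ s' i.+1 = j by rewrite -sj -sj1 !sK.
have lt_si : (s' i.+1 < s' i)%N by rewrite si si1.
have lt_sj : (s j.+1 < s j)%N by rewrite sj sj1.
have SE : S i.+1 = - S i.
  by rewrite /S /bS (binv_special_gt (can_inj s'K) si si1) exprS mulN1r.
have dE : d j.+1 / d j = - (t i / t i.+1).
  rewrite /t /bt si si1 -/S SE; field.
  by rewrite ?oppr_eq0 ?d0 ?S0 ?oner_eq0.
have lamgE : lam c i g = lamf c true (al i) (t i) (t i.+1).
  by rewrite (lamE c Bg) /lamv lt_si.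
have rhogE : rho c j g = rhof c true (ar j) (t i.+1).
  rewrite (rhoE c Bg) /rhov lt_sj sj sj1 bP1 -/S -/t SE.
  by rewrite !(mulrN, mulNr) opprK /S bS_sqr mul1r.
have -> : rho c j (wE F i * g)%g = if al i == 0 then 0 else
    rhof c true (ar j - (al i)^-1 * t i / t i.+1) (- (t i.+1 * al i)).
  have [a0|a0] := eqVneq (al i) 0.
    have [al1 BL] := bdec_LB0 Bg a0.
    by rewrite (rhoE c BL) /rhov /= sj sj1 swl swr ltnNge leqnSn.
  have [al1 [ar1 [BL arE]]] := bdec_LB1 Bg lt_si a0 erefl.
  rewrite (rhoE c BL) /rhov lt_sj arE sj sj1 si si1 !eqxx mulr1n bP1.
  rewrite (bt_scale_L Bg) ?oppr_eq0 ?invr_eq0 // scale_r ?ltn_eqF // -/S SE -/t.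
  rewrite -[X in rhof _ _ (_ + X) _]mulrA dE mulrN mulrA.
  congr (rhof _ _ _ _); rewrite !(mulrN, mulNr) ?opprK /S bS_sqr mul1r.
  by rewrite invrN invrK mulrN.
have -> : lam c i (g * wE F j)%g = if ar j == 0 then
      lamf c false (al i) (- t i) (- t i.+1)
    else lamf c true (al i - (ar j)^-1 * t i / t i.+1)
      (- (ar j)^-1 * t i) (- ar j * t i.+1).
  have [a0|a0] := eqVneq (ar j) 0.
    have [ar1 BR] := bdec_RB0 Bg a0.
    rewrite (lamE c BR) /lamv !(bt_RB Bg) // /= si si1 swl swr ltnNge leqnSn /=.
    by rewrite sj sj1 scale_l scale_r ?ltn_eqF // invrN invr1 !mulrN1.
  have [al1 [ar1 [BR alE]]] := bdec_RB1 Bg lt_sj a0 erefl.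
  rewrite (lamE c BR) /lamv lt_si alE sj sj1 !eqxx mulr1n.
  rewrite -[X in lamf _ _ (_ + X) _ _]mulrA dE mulrN mulrA -invrN.
  rewrite !(bt_scale_R Bg) ?oppr_eq0 ?invr_eq0 // sj sj1 scale_l scale_r ?ltn_eqF //.
  by rewrite -/t invrN invrK; congr lamf; rewrite mulrC.
rewrite lamgE rhogE; exact: special_gt_id.
Qed.

Lemma commutation_lt : (s j < s j.+1)%N -> (s j, s j.+1) != (i, i.+1) ->
  lam c i g + rho c j (wE F i * g)%g = rho c j g + lam c i (g * wE F j)%g.
Proof.
move=> sj nij; rewrite (rho_left_lt c Bg) // (lam_right_lt c Bg) //.
by rewrite (rhoE c Bg) /rhov ltnNge ltnW //= add0r addr0.
Qed.

(** The left move permutes or rescales the torus part at i and i+1, the right move rescales it at p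
    = s j.+1 and q = s j. The change of [lam] and that of [bP] inside [rho] balance, case by case
    according to how {p, q} meets {i, i+1}. *)
Lemma commutation_gt : (s j.+1 < s j)%N -> (s j.+1, s j) != (i, i.+1) ->
  lam c i g + rho c j (wE F i * g)%g = rho c j g + lam c i (g * wE F j)%g.
Proof.
move=> sj nij; rewrite (rho_left_gt c Bg) // (lam_right_gt c Bg) //.
rewrite (lamE c Bg) (rhoE c Bg) /lamv /rhov sj -/t -/S.
set r := (s' i.+1 < s' i)%N; set e : F := (-1) ^+ r.
have ee : e * e = 1 by rewrite -expr2 sqrr_sign.
set p := s j.+1; set q := s j; rewrite -/p -/q in sj nij.
have pq : p != q by rewrite ltn_eqF.
have P0 : bP S t p q != 0 by apply: bP_neq0.
set P := bP S t p q in P0 *; rewrite /rhof /=.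
have := inv1_neq0 (ar j); set b := inv1 (ar j) => b0.
have [T0 T1] := (t0 i, t0 i.+1); have nb0 : - b != 0 by rewrite oppr_eq0.
have sw_o m : m != i -> m != i.+1 -> sw i i.+1 m = m.
  by move=> mi mi1; rewrite /sw (negPf mi) (negPf mi1).
case: ifP => [mv|/negbT]; last first.
  rewrite negb_or negbK => /andP[rT a0].
  have h0 : - (al i)^-1 != 0 by rewrite oppr_eq0 invr_eq0.
  have sc0 := scale_l i i.+1 (- (al i)^-1) t.
  have sc1 := @scale_r _ i i.+1 (- (al i)^-1) t (negbT (ltn_eqF (ltnSn i))).
  have sco := @scale_o _ i i.+1 (- (al i)^-1) t.
  rewrite /lamf rT (negPf a0) /=.
  have [ip|ip] := eqVneq i p.
    have iq : (i < q)%N by rewrite ip.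
    have K := bP_scale_p0 S h0 sc1 sco iq.
    have -> : scale p q (- b) t i = t i * - b by rewrite ip scale_l.
    have -> : bP S (scale i i.+1 (- (al i)^-1) t) p q = P / - (al i)^-1.
      by apply: (mulIf h0); rewrite divfK // -ip K ip.
    abstract_solve cS t t0 i P b.
  have [iq|iq] := eqVneq i q.
    have pi : (p < i)%N by rewrite iq.
    have K := bP_scale_q0 S h0 sc0 sco pi.
    have -> : scale p q (- b) t i = t i / - b by rewrite iq scale_r.
    have -> : bP S (scale i i.+1 (- (al i)^-1) t) p q = - (al i)^-1 * P.
      by rewrite -iq K iq.
    abstract_solve cS t t0 i P b.
  rewrite scale_o // (bP_scale S h0 sc0 sc1 sco) 1?eq_sym // -/P.
  by rewrite addrC.
pose S2 := bS F (s' \o sw i i.+1).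
pose t2 := bt (s' \o sw i i.+1) (fun k => d k * wd i i.+1 1 (s k)).
have HS0 : S2 i = S i.+1 * e by apply: bS_left0.
have HS1 : S2 i.+1 = - S i * e by apply: bS_left1 s'K.
have HSo m : m != i -> m != i.+1 -> S2 m = S m by apply: bS_left.
have Ht0 : t2 i = t i.+1 * e by apply: bt_left0 s'K.
have Ht1 : t2 i.+1 = t i * e by apply: bt_left1 s'K.
have Hto m : m != i -> m != i.+1 -> t2 m = t m by move=> mi mi1; apply: bt_left.
have lamfE u0 u1 : lamf c r (al i) u0 u1 =
    c u1 (- u0) + (if r then c u0 (-1) + c (-1) (-1) else 0).
  by move: mv; rewrite /lamf; case: (r) => //= [->|]; rewrite ?addrA ?addr0.
rewrite !lamfE -/S2 -/t2.
have eE : r /\ e = -1 \/ r = false /\ e = 1.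
  by rewrite /e; case: (r); [left|right].
have i1_i : i.+1 != i by rewrite gtn_eqF.
have [ip|ip] := eqVneq i p.
  have iq : (i.+1 < q)%N.
    by move: nij sj; rewrite xpair_eqE -ip eqxx /= => ? ?; lia.
  have q_i : q != i by rewrite gtn_eqF // ltnW.
  have q_i1 : q != i.+1 by rewrite gtn_eqF.
  have K := bP_left_p0 HS1 HSo Hto iq.
  rewrite (sw_o q) // -ip swl scale_l scale_o // 1?eq_sym //.
  have -> : bP S2 t2 i.+1 q = e * P / t i.+1.
    by apply: (mulIf T1); rewrite divfK // K ip.
  case: eE => -[-> ->]; abstract_solve cS t t0 i P b.
have [ip1|ip1] := eqVneq i.+1 p.
  have iq : (i.+1 < q)%N by rewrite ip1.
  have q_i : q != i by rewrite gtn_eqF // ltnW.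
  have q_i1 : q != i.+1 by rewrite gtn_eqF.
  have K := bP_left_p1 ee HS0 Ht1 HSo Hto iq.
  rewrite (sw_o q) // -ip1 swr scale_l scale_o // 1?eq_sym //.
  rewrite K ip1 -/P; case: eE => -[-> _]; abstract_solve cS t t0 i P b.
have [iq|iq] := eqVneq i q.
  have pi : (p < i)%N by rewrite iq.
  have p_i1 : p != i.+1 by rewrite ltn_eqF // ltnW.
  have K := bP_left_q0 ee HS1 Ht0 Ht1 HSo Hto pi.
  rewrite (sw_o p) 1?eq_sym // -iq swl scale_r 1?eq_sym // scale_o // 1?eq_sym //.
  rewrite K iq -/P; case: eE => -[-> ->]; abstract_solve cS t t0 i P b.
have [iq1|iq1] := eqVneq i.+1 q.
  have pi : (p < i)%N.
    by move: nij sj; rewrite xpair_eqE -iq1 eqxx andbT => ? ?; lia.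
  have p_i1 : p != i.+1 by rewrite ltn_eqF // ltnW.
  have K := bP_left_q1 ee HS0 Ht0 HSo Hto pi.
  rewrite (sw_o p) 1?eq_sym // -iq1 swr (scale_r _ _ p_i1) (scale_o _ _ ip) 1?eq_sym //.
  have -> : bP S2 t2 p i = - P / t i.
    by apply: (mulIf T0); rewrite divfK // K iq1.
  case: eE => -[-> _]; abstract_solve cS t t0 i P b.
rewrite (sw_o p) 1?eq_sym // (sw_o q) 1?eq_sym // (bP_left ee Ht0 Ht1 HSo Hto) 1?eq_sym // -/P.
by rewrite !scale_o // addrC.
Qed.

End Data.

Theorem commutation g i j :
  lam c i g + rho c j (wE F i * g)%g = rho c j g + lam c i (g * wE F j)%g.
Proof.
have [s [s' [d [al [ar Bg]]]]] := bdec_exists g.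
have [sK s'K _] := bdec_mono Bg.
have [sj|sj|] := ltngtP (s j) (s j.+1); last by move=> /(can_inj sK); lia.
- have [/eqP|ne] := boolP ((s j, s j.+1) == (i, i.+1)); last exact: (commutation_lt Bg sj ne).
  by case=> e1 e2; exact: (commutation_special_lt Bg e1 e2).
- have [/eqP|ne] := boolP ((s j.+1, s j) == (i, i.+1)); last exact: (commutation_gt Bg sj ne).
  by case=> e1 e2; exact: (commutation_special_gt Bg e2 e1).
Qed.

End Commutation.

(** * Invariance under U and the torus operators *)

Section Invariance.
Variables (F : fieldType) (A : zmodType) (c : F -> F -> A).
Implicit Types (g : E F) (p : St F).

Lemma rho_stU j g p : p \in @stU F -> rho c j (phi F p * g) = rho c j g.
Proof.
move=> pU; have [s [s' [d [al [ar Bg]]]]] := bdec_exists g.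
by have [al1 B] := bdec_UL Bg pU; rewrite (rhoE c B) (rhoE c Bg).
Qed.

Lemma lam_stU i g p : p \in @stU F -> lam c i (g * phi F p) = lam c i g.
Proof.
move=> pU; have [s [s' [d [al [ar Bg]]]]] := bdec_exists g.
by have [ar1 B] := bdec_UR Bg pU; rewrite (lamE c B) (lamE c Bg).
Qed.

Lemma tor_stU i y g p : p \in @stU F -> tor c i y (g * phi F p) = tor c i y g.
Proof.
move=> pU; have [s [s' [d [al [ar Bg]]]]] := bdec_exists g.
by have [ar1 B] := bdec_UR Bg pU; rewrite (torE c B) (torE c Bg).
Qed.

Hypothesis cS : symbol c.
Local Open Scope ring_scope.

(** Rescaling by h_(i,i+1)(y) changes [bP] by a factor y^-1 or y exactly when i is its lower or
    upper end, and there the right move multiplies or divides the torus entry at i by the other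
    argument of the same symbol. *)
Lemma tor_wE i j y g : y != 0 ->
  tor c i y g + rho c j (phi F (stH i i.+1 y) * g)%g =
  rho c j g + tor c i y (g * wE F j)%g.
Proof.
move=> y0; have [s [s' [d [al [ar Bg]]]]] := bdec_exists g.
have [sK s'K d0] := bdec_mono Bg.
have [al1 BT] := bdec_T Bg i y0.
rewrite (rhoE c BT) (rhoE c Bg) (torE c Bg) /rhov.
have [sj|sj|] := ltngtP (s j) (s j.+1); last by move=> /(can_inj sK); lia.
  have [al2 [ar2 [BR _]]] := bdec_RA Bg sj.
  by rewrite (torE c BR) (bt_RA Bg) // /rhof /= add0r addr0.
have -> : tor c i y (g * wE F j)%g =
    c y (scale (s j.+1) (s j) (- inv1 (ar j)) (bt s' d) i).
  rewrite /inv1; have [a0|a0] := eqVneq (ar j) 0.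
    by have [ar1 BR] := bdec_RB0 Bg a0; rewrite (torE c BR) (bt_RB Bg).
  have [al2 [ar2 [BR _]]] := bdec_RB1 Bg sj a0 erefl.
  by rewrite (torE c BR) -invrN (bt_scale_R Bg) ?oppr_eq0 ?invr_eq0.
rewrite (eq_bP _ _ _ (fun m => bt_scale_L Bg i m y0)) /rhof /=.
have t0 m : bt s' d m != 0 by apply: bt_neq0.
have P0 : bP (bS F s') (bt s' d) (s j.+1) (s j) != 0.
  by apply: bP_neq0 => // m; apply: bS_neq0.
set t := bt s' d in t0 P0 *; set S := bS F s' in P0 *.
move: (s j.+1) (s j) sj P0 (inv1_neq0 (ar j)) => p q pq; move: (inv1 _) => b P0 b0.
have sc0 := scale_l i i.+1 y t.
have sc1 := @scale_r _ i i.+1 y t (negbT (ltn_eqF (ltnSn i))).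
have sco := @scale_o _ i i.+1 y t.
have T0 := t0 i.
have [ip|ip] := eqVneq i p.
  rewrite -ip in pq P0 *; have K := bP_scale_p0 S y0 sc1 sco pq.
  rewrite scale_l; have -> : bP S (scale i i.+1 y t) i q = bP S t i q / y.
    by rewrite -K mulfK.
  by move: (bP _ _ _ _) P0 (t i) T0 => P P0 ti T0; sym_solve cS.
have [iq|iq] := eqVneq i q.
  rewrite -iq in pq P0 *; have K := bP_scale_q0 S y0 sc0 sco pq.
  rewrite scale_r 1?eq_sym // K.
  by move: (bP _ _ _ _) P0 (t i) T0 => P P0 ti T0; sym_solve cS.
by rewrite scale_o // (bP_scale S y0 sc0 sc1 sco) 1?eq_sym // addrC.
Qed.

(** h_01(y) divides the torus entry at 1 by y, which the operator of h_12(z) reads, whereas h_12(z)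
    leaves the entry at 0 alone. The defect is c(z,y). *)
Lemma tor_comm y z g : y != 0 -> z != 0 ->
  tor c 1 z g + tor c 0 y (phi F (stH 1 2 z) * g)%g =
  c z y + (tor c 0 y g + tor c 1 z (phi F (stH 0 1 y) * g)%g).
Proof.
move=> y0 z0; have [s [s' [d [al [ar Bg]]]]] := bdec_exists g.
have [sK s'K d0] := bdec_mono Bg.
have [al1 B1] := bdec_T Bg 1 z0; have [al2 B2] := bdec_T Bg 0 y0.
rewrite (torE c B1) (torE c B2) !(torE c Bg).
rewrite !(bt_scale_L Bg) // scale_o // scale_r //.
have t0 m : bt s' d m != 0 by apply: bt_neq0.
move: (bt _ _ 1%N) (t0 1%N) (bt _ _ 0%N) (t0 0%N) => t1 T1 t2 T2; sym_solve cS.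
Qed.

End Invariance.

(** * The central extension attached to a symbol *)

(* [Skew x k] stands for the permutation [(g, a) |-> (x * g, a + k g)] of
   [G * A]. *)
Section FunctionExtension.
Variables (G : groupType) (A : zmodType).

Record skew := Skew { skew_elt : G; skew_fun : G -> A }.

HB.instance Definition _ := gen_eqMixin skew.
HB.instance Definition _ := gen_choiceMixin skew.

Lemma skew_eq (x y : skew) : skew_elt x = skew_elt y -> skew_fun x =1 skew_fun y -> x = y.
Proof. by case: x y => [a f] [b h] /= -> /funext ->. Qed.

Definition skew_one := Skew 1 (fun=> 0%R).
Definition skew_mul x y :=
  Skew (skew_elt x * skew_elt y) (fun g => skew_fun y g + skew_fun x (skew_elt y * g)%g)%R.
Definition skew_inv x :=
  Skew (skew_elt x)^-1 (fun g => - skew_fun x ((skew_elt x)^-1 * g)%g)%R.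

Fact skew_mulA : associative skew_mul.
Proof.
by move=> x y z; apply: skew_eq => [|g] /=; rewrite ?mulgA ?addrA.
Qed.
Fact skew_mul1g : left_id skew_one skew_mul.
Proof. by move=> x; apply: skew_eq => [|g] /=; rewrite ?mul1g ?addr0. Qed.
Fact skew_mulg1 : right_id skew_one skew_mul.
Proof. by move=> x; apply: skew_eq => [|g] /=; rewrite ?mulg1 ?mul1g ?add0r. Qed.
Fact skew_mulVg : left_inverse skew_one skew_inv skew_mul.
Proof. by move=> x; apply: skew_eq => [|g] /=; rewrite ?mulVg ?mulKg ?subrr. Qed.
Fact skew_mulgV : right_inverse skew_one skew_inv skew_mul.
Proof. by move=> x; apply: skew_eq => [|g] /=; rewrite ?mulgV ?addNr. Qed.
HB.instance Definition _ := isGroup.Build skew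
  skew_mulA skew_mul1g skew_mulg1 skew_mulVg skew_mulgV.

Fact skew_eltM : {morph skew_elt : x y / x * y}.
Proof. by []. Qed.
HB.instance Definition _ := isMultiplicative.Build skew G skew_elt skew_eltM.

End FunctionExtension.

Section CentralExtension.
Variables (F : fieldType) (A : zmodType) (c : F -> F -> A).
Hypothesis cS : symbol c.
Implicit Types (g : E F) (x y : skew (E F) A) (z : St F).

(* Elements whose action on [E F * A] commutes with the right translations
   [(g, a) |-> (g * phi (stX k l b), a)], [k < l], and
   [(g, a) |-> (g * wE j, a + rho j g)]. *)
Definition matsumoto : {pred skew (E F) A} := [pred x | `[<
  (forall k l b g, (k < l)%N -> skew_fun x (g * phi F (stX k l b)) = skew_fun x g) /\
  (forall j g, skew_fun x g + rho c j (skew_elt x * g)%g =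
               rho c j g + skew_fun x (g * wE F j)%g)%R >]].

Lemma matsumotoP x : reflect
  ((forall k l b g, (k < l)%N -> skew_fun x (g * phi F (stX k l b)) = skew_fun x g) /\
  (forall j g, skew_fun x g + rho c j (skew_elt x * g)%g =
               rho c j g + skew_fun x (g * wE F j)%g)%R) (x \in matsumoto).
Proof. by rewrite inE; apply: asboolP. Qed.

Fact matsumotoM : mulg_closed matsumoto.
Proof.
move=> x y /matsumotoP[xX xw] /matsumotoP[yX yw]; apply/matsumotoP.
split=> [k l b g kl|j g] /=; first by rewrite yX // mulgA xX.
by rewrite -mulgA -addrA xw addrA yw -addrA mulgA.
Qed.
Fact matsumoto1 : 1 \in matsumoto.
Proof.
by apply/matsumotoP; split=> [|j g] //=; rewrite mul1g addrC.
Qed.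
Fact matsumotoV : invg_closed matsumoto.
Proof.
move=> x /matsumotoP[xX xw]; apply/matsumotoP.
split=> [k l b g kl|j g] /=; first by rewrite mulgA xX.
have := xw j ((skew_elt x)^-1 * g); rewrite mulVKg -!mulgA => e.
by rewrite -[rho c j g](addKr (skew_fun x ((skew_elt x)^-1 * g))) e addrA addrK.
Qed.
HB.instance Definition _ := isMulClosed.Build _ matsumoto matsumotoM.
HB.instance Definition _ := isMul1Closed.Build _ matsumoto matsumoto1.
HB.instance Definition _ := isInvClosed.Build _ matsumoto matsumotoV.

Lemma matsumoto_X k l b : (k < l)%N ->
  Skew (phi F (stX k l b)) (fun=> 0%R) \in matsumoto.
Proof.
move=> kl; apply/matsumotoP; split=> //= j g.
by rewrite rho_stU ?stX_stU // addrC.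
Qed.

Lemma matsumoto_W i : Skew (wE F i) (lam c i) \in matsumoto.
Proof.
apply/matsumotoP; split=> [k l b g kl|j g] /=; first by rewrite lam_stU ?stX_stU.
exact: commutation.
Qed.

Lemma matsumoto_H i (y : F) : y != 0%R ->
  Skew (phi F (stH i i.+1 y)) (tor c i y) \in matsumoto.
Proof.
move=> y0; apply/matsumotoP; split=> [k l b g kl|j g] /=.
  by rewrite tor_stU ?stX_stU.
exact: tor_wE.
Qed.

Lemma matsumoto_const x : x \in matsumoto -> skew_elt x = 1 ->
  forall g, skew_fun x g = skew_fun x 1.
Proof.
move=> /matsumotoP[xX xw] x1 g.
(* Since [x] lies over 1, the two values of [rho] in the commutation law cancel. *)
have xw1 j h : skew_fun x (h * wE F j) = skew_fun x h.
  by apply: (addrI (rho c j h)); rewrite -xw x1 mul1g addrC.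
have [z <-] := phi_surj g; rewrite -[phi F z]mul1g; move: (1).
elim/St_ind: z => [h|z y Hz Hy h|i j a ij h|i h|i h].
- by rewrite hom1 mulg1.
- by rewrite gmulfM mulgA Hy Hz.
- exact: xX.
- exact: xw1.
- rewrite -(xw1 i) -mulgA /wE -gmulfM /= -stWV ?ltn_eqF ?oner_neq0 //.
  by rewrite mulVg hom1 mulg1.
Qed.

Definition mats := subgrp matsumoto.
HB.instance Definition _ := Group.on mats.

Definition mats_proj (x : mats) : E F := skew_elt (val x).
Fact mats_projM : {morph mats_proj : x y / x * y}.
Proof. by []. Qed.
HB.instance Definition _ := isMultiplicative.Build mats (E F) mats_proj mats_projM.

Lemma mats_proj_surj g : exists x : mats, mats_proj x = g.
Proof.
have [z <-] := phi_surj g; elim/St_ind: z => [|z y [x xz] [x2 xy]|k l b kl|i|i].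
- by exists 1; rewrite !hom1.
- by exists (x * x2); rewrite !gmulfM /= xz xy.
- by exists (Subgrp (matsumoto_X b kl)).
- by exists (Subgrp (matsumoto_W i)).
- exists (Subgrp (matsumoto_W i))^-1; rewrite homV /=.
  by rewrite -[RHS]/(phi F _) -stWV ?ltn_eqF // homV.
Qed.

Lemma mats_projC (x y : mats) : mats_proj x = 1 -> commute x y.
Proof.
move=> x1; apply/val_inj/skew_eq => [|g] /=.
  by rewrite [skew_elt (val x)]x1 mulg1 mul1g.
have const := matsumoto_const (valP x) x1.
by rewrite const [skew_elt (val x)]x1 mul1g (const g) addrC.
Qed.

(** Universality maps St(F) into the extension. Over the kernel of [phi] the functions are constant,
    so their value at 1 is additive. *)
Lemma matsumoto_cocycle : exists K : St F -> A,
  (forall z (y : St F), phi F z = 1 -> phi F y = 1 -> K (z * y) = (K z + K y)%R) /\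
  (forall u v, u != 0%R -> v != 0%R -> K (symb u v) = c u v).
Proof.
have [psi psiP] := St_universal mats_proj_surj mats_projC.
exists (fun z => skew_fun (val (psi z)) 1); split=> [z y z1 y1|u v u0 v0].
  rewrite gmulfM /= [skew_elt (val (psi y))](psiP y) y1 mulg1.
  exact: addrC.
have uV0 : u^-1%R != 0%R by rewrite invr_eq0.
(* The symbol is the commutator of h_10(u) and h_12(v). The torus operators are those of h_(i,i+1),
   and h_01(u^-1) has the same image as h_10(u). *)
pose T0 : mats := Subgrp (matsumoto_H 0 uV0); pose T1 : mats := Subgrp (matsumoto_H 1 v0).
have psi_symb : psi (symb u v) = lcomm T0 T1.
  rewrite -(@symbE _ 1%N 0%N 2%N) // /sym gmulf_lcomm.
  apply: (central_lcomm mats_projC); last exact: psiP.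
  rewrite psiP; have [n01 n10] : (0 != 1)%N /\ (1 != 0)%N by [].
  apply: (mono_phi_eq (mono_H n10 u0)); apply: (eq_mono (mono_H n01 uV0)) => // k.
  by rewrite /hd invrK; case: eqP => [->|].
have L1 : skew_elt (val (psi (symb u v))) = 1.
  by rewrite [LHS](psiP (symb u v)) phi_symb.
have /(congr1 (fun x : mats => skew_fun (val x) 1)) :
    T0 * T1 = psi (symb u v) * (T1 * T0).
  by rewrite psi_symb lcomm.unlock !mulgA !mulgVK.
rewrite /= (matsumoto_const (valP (psi (symb u v))) L1) mulg1.
have := tor_comm cS 1 uV0 v0; rewrite !mulg1 => ->.
rewrite addrC => /addrI <-.
(* The commutator yields c(v, u^-1), which is c(u,v) by skew-symmetry. *)
by rewrite (symVr cS) // -(symC cS).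
Qed.

End CentralExtension.

(** * Injectivity of Sym F -> St F *)

Section SymAbelian.
Variable F : fieldType.
Implicit Types (u v : units F) (x y : Sym F).

Lemma Sym_gen1B u v : (val u != 1)%R -> (val v = 1 - val u)%R -> Sym_gen u v = 1.
Proof. by move=> u1 uv; apply/presP/word_cong_rel/Sym_rel1B. Qed.

Lemma Sym_genMl u u' w v : (val w = val u * val u')%R ->
  Sym_gen w v = Sym_gen u v * Sym_gen u' v.
Proof. by move=> wE; rewrite -presM; apply/presP/word_cong_rel/Sym_relMl. Qed.

Lemma Sym_genMr u v v' w : (val w = val v * val v')%R ->
  Sym_gen u w = Sym_gen u v * Sym_gen u v'.
Proof. by move=> wE; rewrite -presM; apply/presP/word_cong_rel/Sym_relMr. Qed.

Lemma units_mul u v : exists w : units F, (val w = val u * val v)%R.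
Proof.
have uvU : (val u * val v)%R \is a GRing.unit by rewrite unitfE mulf_neq0 ?units_neq0.
by exists (exist (fun x : F => x \is a GRing.unit) _ uvU).
Qed.

(* Expand [<u u', v v'>] in the two possible orders. *)
Lemma Sym_gen_commute u v u' v' : commute (Sym_gen u v) (Sym_gen u' v').
Proof.
have [w wE] := units_mul u u'; have [t tE] := units_mul v' v.
have := Sym_genMl t wE.
rewrite (Sym_genMr w tE) !(Sym_genMl _ wE) !(Sym_genMr _ tE) -!mulgA => /mulgI.
by rewrite !mulgA => /mulIg.
Qed.

Lemma Sym_commute x y : commute x y.
Proof.
have gen u v z : commute z (Sym_gen u v).
  elim/Sym_ind: z => [|u' v' z zC|u' v' z zC]; apply: commute_sym.
  - exact: commute1.
  - by apply: commuteM; [exact: Sym_gen_commute | exact: commute_sym].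
  - by apply: commuteM; [exact/commuteV/Sym_gen_commute | exact: commute_sym].
elim/Sym_ind: y => [|u v y xy|u v y xy]; first exact: commute1.
- exact: commuteM.
- by apply: commuteM => //; apply: commuteV.
Qed.

(** A copy of [Sym F] in additive notation, because symbols take values in a [zmodType]. No relation
    of the presentation states commutativity; it is supplied by [Sym_commute]. *)
Definition symz : Type := Sym F.
HB.instance Definition _ := Choice.on symz.
Fact symz_addC : commutative (fun x y : Sym F => x * y). Proof. exact: Sym_commute. Qed.
HB.instance Definition _ := GRing.isZmodule.Build symz
  (@mulgA (Sym F)) symz_addC (@mul1g (Sym F)) (@mulVg (Sym F)).

(* [tsym a b = 1] if [a] or [b] is zero. *)
Definition tsym (a b : F) : symz :=
  match @idP (a \is a GRing.unit), @idP (b \is a GRing.unit) with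
  | ReflectT aU, ReflectT bU =>
      Sym_gen (exist (fun x : F => x \is a GRing.unit) a aU)
              (exist (fun x : F => x \is a GRing.unit) b bU)
  | _, _ => 1
  end.

Lemma tsymE u v : tsym (val u) (val v) = Sym_gen u v.
Proof.
case: u v => [a aU] [b bU]; rewrite /tsym /=.
case: {-}_ / idP => [aU'|//]; case: {-}_ / idP => [bU'|//].
by rewrite (bool_irrelevance aU' aU) (bool_irrelevance bU' bU).
Qed.

Lemma tsym_symbol : symbol tsym.
Proof.
have unitsP (a : F) : a != 0%R -> exists u, val u = a.
  by rewrite -unitfE => aU; exists (exist (fun x : F => x \is a GRing.unit) a aU).
split=> [a a' b|a b b'|a].
- move=> /unitsP[u <-] /unitsP[u' <-] /unitsP[v <-].
  by have [w wE] := units_mul u u'; rewrite -wE !tsymE (Sym_genMl _ wE).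
- move=> /unitsP[u <-] /unitsP[v <-] /unitsP[v' <-].
  by have [w wE] := units_mul v v'; rewrite -wE !tsymE (Sym_genMr _ wE).
- move=> /unitsP[u <-]; have [->|u1 /unitsP[v vE]] := eqVneq (val u) 1%R.
    by rewrite subrr eqxx.
  by rewrite -vE tsymE (Sym_gen1B u1 vE).
Qed.

(** For the universal symbol [tsym], the cocycle provides a left inverse of [SymSt]. *)
Theorem SymSt_inj : injective (@SymSt F).
Proof.
have [K [KM Ksymb]] := matsumoto_cocycle tsym_symbol.
suff KK x : K (SymSt x) = x by move=> x y e; rewrite -[LHS]KK e KK.
apply: (@pres_ext _ _ (Sym F) (fun x => K (SymSt x)) id) => //=.
  by move=> y z; rewrite gmulfM /= KM ?phi_SymSt.
move=> [u v]; rewrite -[pres_gen _ _]/(Sym_gen u v) SymSt_gen.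
by rewrite Ksymb ?units_neq0 // tsymE.
Qed.

End SymAbelian.

(** * Coinvariants *)

Section GammaSubImage.
Variables (Gamma : groupType) (G H : gammaGroupType Gamma) (f : gammaHom G H).
Hypothesis f_surj : forall y, exists x, f x = y.

Let img : {pred H} := [pred y | `[< exists2 x, x \in GammaSub G & f x = y >]].

Let imgP y : reflect (exists2 x, x \in GammaSub G & f x = y) (y \in img).
Proof. by rewrite inE; apply: asboolP. Qed.

Let imgM : mulg_closed img.
Proof.
move=> _ _ /imgP[x xG <-] /imgP[y yG <-]; apply/imgP.
by exists (x * y); rewrite ?gpredM ?gmulfM.
Qed.
Let img1 : 1 \in img.
Proof. by apply/imgP; exists 1; rewrite ?gpred1 ?hom1. Qed.
Let imgV : invg_closed img.
Proof.
move=> _ /imgP[x xG <-]; apply/imgP.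
by exists x^-1; rewrite ?homV //; apply: gpredVr.
Qed.
Let imgJ x y : x \in img -> x ^ y \in img.
Proof.
move=> /imgP[z zG <-]; have [w <-] := f_surj y; apply/imgP.
by exists (z ^ w); [exact: gpredJr | rewrite !gmulfM homV].
Qed.
HB.instance Definition _ := isMulClosed.Build H img imgM.
HB.instance Definition _ := isMul1Closed.Build H img img1.
HB.instance Definition _ := isInvClosed.Build H img imgV.
HB.instance Definition _ := isConjClosed.Build H img imgJ.

(** Surjectivity of [f] is used twice: to lift the generators, and to make the image of [GammaSub G]
    normal. *)
Lemma GammaSub_surj y : y \in GammaSub H ->
  exists2 x, x \in GammaSub G & f x = y.
Proof.
move=> /normal_closureP/(_ img) yH; apply/imgP/yH => _ [g [z ->]] /=.
have [w <-] := f_surj z; apply/imgP; exists (gact g w * w^-1).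
  by apply: sub_normal_closure; exists g, w.
by rewrite gmulfM homV; congr (_ * _); apply: gact_hom.
Qed.

End GammaSubImage.

Section Coinvariants.
Variables (Gamma : groupType) (S G H : gammaGroupType Gamma).
Variables (s : gammaHom S G) (f : gammaHom G H).
Hypothesis s_inj : injective s.
Hypothesis fs1 : forall x, f (s x) = 1.
Hypothesis s_ker : forall z, f z = 1 -> exists x, s x = z.
Hypothesis f_surj : forall y, exists x, f x = y.

Let sk_subproof x : s x \in kernel f.
Proof. by rewrite inE; apply/eqP/fs1. Qed.

Let sk (x : S) : subgrp (kernel f) := Subgrp (sk_subproof x).
Let skM : {morph sk : x y / x * y}.
Proof. by move=> x y; apply/val_inj; rewrite /= gmulfM. Qed.
Let sk_gact g x : sk (gact g x) = gact g (sk x).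
Proof. by apply/val_inj; apply: gact_hom. Qed.
HB.instance Definition _ := isMultiplicative.Build S (subgrp (kernel f)) sk skM.
HB.instance Definition _ := isGammaHom.Build Gamma S (subgrp (kernel f)) sk sk_gact.

Let sinv (z : G) : S := xget 1 [set x | s x = z].
Let sinvK z : f z = 1 -> s (sinv z) = z.
Proof. by move=> /s_ker[x xz]; apply: (@xgetPex _ 1 [set x | s x = z]); exists x. Qed.

Let kerP (k : subgrp (kernel f)) : f (val k) = 1.
Proof. by apply/eqP; have := subgrp_valP k; rewrite inE. Qed.

(** Inverse to [sk]. As both are homomorphisms of Gamma-groups, Gamma Ker(f) corresponds to Gamma S,
    which is what [GammaKerE] uses. *)
Let ks (k : subgrp (kernel f)) : S := sinv (val k).
Let ksK k : s (ks k) = val k. Proof. exact/sinvK/kerP. Qed.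
Let ksM : {morph ks : x y / x * y}.
Proof. by move=> x y; apply: s_inj; rewrite gmulfM /= !ksK. Qed.
Let ks_gact g x : ks (gact g x) = gact g (ks x).
Proof. by apply: s_inj; rewrite gact_hom /= !ksK. Qed.
HB.instance Definition _ := isMultiplicative.Build (subgrp (kernel f)) S ks ksM.
HB.instance Definition _ := isGammaHom.Build Gamma (subgrp (kernel f)) S ks ks_gact.

Let kerG := subgrp (kernel (GammaSub_map f)).

Let kerG_ker (y : kerG) : val (val y) \in kernel f.
Proof. by have := subgrp_valP y; rewrite !inE => /eqP/(congr1 val) /= ->. Qed.

Let toker (y : kerG) : subgrp (kernel f) := Subgrp (kerG_ker y).
Let tokerM : {morph toker : x y / x * y}.
Proof. by move=> x y; apply/val_inj. Qed.
HB.instance Definition _ := isMultiplicative.Build kerG (subgrp (kernel f)) toker tokerM.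

Let GammaKerE (y : kerG) : (y \in GammaKer f) = (ks (toker y) \in GammaSub S).
Proof.
apply/GammaKerP/idP => [[k kG kE]|yS].
  have -> : toker y = k by apply/val_inj.
  exact: (GammaSub_hom ks).
exists (sk (ks (toker y))); first exact: (GammaSub_hom sk).
exact: ksK.
Qed.

Let inj (q : KerGamma_quotient f) : coinv S := quot (GammaSub S) (ks (toker (repr q))).

Let injE y : inj (quot (GammaKer f) y) = quot (GammaSub S) (ks (toker y)).
Proof.
by apply/Defs.quotP; rewrite -homV -gmulfM /= -homV -gmulfM /= -GammaKerE quot_reprP.
Qed.

Let injM : {morph inj : p q / p * q}.
Proof.
by move=> p q; rewrite -[p]quotK -[q]quotK -quotM !injE tokerM ksM quotM.
Qed.
HB.instance Definition _ := isMultiplicative.Build (KerGamma_quotient f) (coinv S) inj injM.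

Let prj_subproof q : coinv_map s q \in kernel (coinv_map f).
Proof.
rewrite -[q]quotK inE !coinv_mapE; apply/eqP.
exact: (etrans (coinv_mapE f (s (repr q))) (congr1 (quot (GammaSub H)) (fs1 (repr q)))).
Qed.

Let prj (q : coinv S) : subgrp (kernel (coinv_map f)) := Subgrp (prj_subproof q).
Let prjM : {morph prj : p q / p * q}.
Proof. by move=> p q; apply/val_inj; rewrite /= gmulfM. Qed.
HB.instance Definition _ :=
  isMultiplicative.Build (coinv S) (subgrp (kernel (coinv_map f))) prj prjM.

Let prjE x : prj (quot (GammaSub S) x) = 1 <-> s x \in GammaSub G.
Proof.
have -> : prj (quot (GammaSub S) x) = 1 <-> quot (GammaSub G) (s x) = quot (GammaSub G) 1.
  by rewrite -coinv_mapE; split=> [/(congr1 val)//|e]; apply/val_inj.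
by rewrite Defs.quotP mulg1 gpredV.
Qed.

Theorem coinv_short_exact :
  exists (i : {multiplicative KerGamma_quotient f -> coinv S})
         (p : {multiplicative coinv S -> subgrp (kernel (coinv_map f))}),
    short_exact i p.
Proof.
exists inj, prj; split=> [p q|b|c].
- move/Defs.quotP; rewrite -homV -gmulfM /= -homV -gmulfM /= -GammaKerE => /Defs.quotP.
  by rewrite !quotK.
- rewrite -[b]quotK inE; split=> [/eqP/prjE sG|[a]].
    (* The element [s] of the representative lies in Gamma G and is killed by [f], so it lies in Ker
       Gamma(f) and gives the preimage. *)
    have yP : Subgrp sG \in kernel (GammaSub_map f).
      by rewrite inE; apply/eqP/val_inj/fs1.
    exists (quot (GammaKer f) (Subgrp yP)); apply: etrans (injE _) _; congr quot.
    by apply: s_inj; rewrite ksK.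
  by move=> <-; apply/eqP/prjE; rewrite ksK; apply: (subgrp_valP (val (repr a))).
- have := subgrp_valP c; rewrite -[val c]quotK inE; set z := repr _ => /eqP cz.
  have /Defs.quotP : quot (GammaSub H) (f z) = quot (GammaSub H) 1.
    exact: (etrans (esym (coinv_mapE f z)) cz).
  (* As f z is in Gamma H, it is the image of some y in Gamma G; then z y^-1 lies in Ker(f) and has
     the class of z. *)
  rewrite mulg1 gpredV => /(GammaSub_surj f_surj)[y yG fy].
  have [x xz] : exists x, s x = z * y^-1.
    by apply: s_ker; rewrite gmulfM homV; apply/(canLR (mulgK _)); rewrite mul1g; apply: esym.
  exists (quot (GammaSub S) x); apply/val_inj.
  apply: etrans (coinv_mapE s x) _; rewrite xz -[RHS]quotK -/z; apply/Defs.quotP.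
  by rewrite invgM invgK mulgVK.
Qed.

End Coinvariants.

(** * Compatibility of symbols with the action, and conclusion *)

Section Equivariance.
Variables (Gamma : groupType) (F : gammaFieldType Gamma).
Implicit Types (h : Gamma) (u v a : F).

Lemma gact_stX h i j a : gact h (stX i j a) = stX i j (ract h a).
Proof.
have [->|ij] := eqVneq i j; last by rewrite !(stXE ij); apply: St_actE.
have X1 b : stX j j b = 1 :> St F.
  by rewrite /stX; case: {-}_ / idP => // ij; have /eqP[] := ij.
by rewrite !X1 hom1.
Qed.

Lemma gact_stW h i j u : gact h (stW i j u) = stW i j (ract h u).
Proof. by rewrite !stW_def !gmulfM /= !gact_stX rmorphN fmorphV. Qed.

Lemma gact_stH h i j u : gact h (stH i j u) = stH i j (ract h u).
Proof. by rewrite !stH_def gmulfM /= !gact_stW rmorphN rmorph1. Qed.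

Lemma gact_symb h u v : gact h (symb u v) = symb (ract h u) (ract h v).
Proof. by rewrite /symb /sym gmulf_lcomm /= !gact_stH. Qed.

Fact SymSt_gact h (x : Sym F) : SymSt (gact h x) = gact h (SymSt x).
Proof.
apply: (@pres_ext _ _ _ (fun x : Sym F => SymSt (gact h x))
  (fun x => gact h (SymSt x))) => [y z|y z|[u v]] /=.
- by rewrite gactMr gmulfM.
- by rewrite gmulfM gactMr.
rewrite -[pres_gen _ _]/(Sym_gen u v) [gact h _]Sym_actE !SymSt_gen gact_symb //.
Qed.
HB.instance Definition _ :=
  isGammaHom.Build Gamma (Sym F) (St F) (@SymSt F) SymSt_gact.

End Equivariance.

Theorem theorem5p7 (Gamma : groupType) (F : gammaFieldType Gamma) :
  exists (i : {multiplicative KerGamma_quotient (phi F) -> SymGamma F})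
         (p : {multiplicative SymGamma F -> K2Gamma F}),
    short_exact i p.
Proof.
apply: (@coinv_short_exact Gamma (Sym F) (St F) (E F) (@SymSt F) (phi F)).
- exact: SymSt_inj.
- exact: phi_SymSt.
- by move=> z /kernel_phi_symimg/symimgP.
- exact: phi_surj.
Qed.
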